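(* Let $g,h\in\mathcal{S}$ and let $F(z)=\dfrac{g(z)h(z)}{z}$ for $z\in\mathbb{D}$. Then $F$ belongs to the class $\mathcal{M}$ in the disk $|z|\leq r_0$, where $r_0$ ($\approx 0.260985$) is the smallest positive root in $(0,1)$ of the equation $$6r^2+4(\sqrt{2}+4)r^3+\frac{2r^2\sqrt{-8r^{10}+31r^8-44r^6+27r^4}}{(1-r^2)^{2}}+\frac{r^4(4r^2-11r+9)}{(1-r)^3}+4\left(\frac{r^8(15-20 r^2+15 r^4-4 r^6)}{(1-r^2)^4}-r^4\left(\log(1-r^2)+r^2\right)\right)^{1/2}-1=0.$$
   Context: $\mathbb{D}=\{z\in\mathbb{C}:|z|<1\}$. $\mathcal{A}$ is the family of functions $f$ analytic in $\mathbb{D}$ with $f(0)=0$ and $f'(0)=1$. $\mathcal{S}$ is the set of $f\in\mathcal{A}$ that are univalent (injective) in $\mathbb{D}$. $\mathcal{M}$ is the class of $f\in\mathcal{A}$ (with $f(z)\neq 0$ for $z\in\mathbb{D}\setminus\{0\}$, so that $z/f(z)$ is analytic in $\mathbb{D}$ with value $1$ at $0$) such that $$\left|z^2\left(\frac{z}{f(z)}\right)''+f'(z)\left(\frac{z}{f(z)}\right)^2-1\right|\leq 1\quad\text{for all } z\in\mathbb{D}.$$ For $0<r<1$, a function $F$ ''belongs to $\mathcal{M}$ in the disk $|z|\le r$'' if $F$ is analytic there with $F(0)=0$, $F'(0)=1$, $F(z)\ne0$ for $0<|z|\le r$, and the inequality $$\left|z^2\left(\frac{z}{F(z)}\right)''+F'(z)\left(\frac{z}{F(z)}\right)^2-1\right|\leq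 1$$ holds for all $|z|\le r$. Removable singularities at $0$ are removed. *)

(* Defs.v *)
From Stdlib Require Import Reals.
From Coquelicot Require Import Coquelicot.

Open Scope R_scope.
Open Scope C_scope.

Definition unit_disk (z : C) : Prop := Cmod z < 1.

Definition closed_disk (r : R) (z : C) : Prop := Cmod z <= r.

(* Analytic at [z]: complex differentiable throughout a neighbourhood of [z].
   On an open set this is complex differentiability at each point; on a closed
   disk it means analyticity in some open set containing that disk. *)
Definition analytic_at (f : C -> C) (z : C) : Prop :=
  locally z (fun w => ex_derive (K := C_AbsRing) (V := C_NormedModule) f w).

Definition analytic_on (A : C -> Prop) (f : C -> C) : Prop :=
  forall z, A z -> analytic_at f z.

Definition normalized_on (A : C -> Prop) (f : C -> C) : Prop :=
  analytic_on A f /\ f 0 = 0 /\ C_derive f 0 = 1.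

Definition class_A (f : C -> C) : Prop := normalized_on unit_disk f.

Definition class_S (f : C -> C) : Prop :=
  class_A f /\
  forall z w, unit_disk z -> unit_disk w -> f z = f w -> z = w.

(* [z / f z] with its removable singularity at 0 removed; the value there is
   [1 / f'(0) = 1] for normalized [f]. *)
Definition id_over (f : C -> C) (z : C) : C :=
  if Ceq_dec z 0 then 1 else z / f z.

(* The defining conditions of the class M, required at the points of [A]; the
   class itself is [class_M_on unit_disk]. *)
Definition class_M_on (A : C -> Prop) (f : C -> C) : Prop :=
  normalized_on A f /\
  (forall z, A z -> z <> 0 -> f z <> 0) /\
  forall z, A z ->
    Cmod (z ^ 2 * C_derive (C_derive (id_over f)) z
          + C_derive f z * (id_over f z) ^ 2 - 1) <= 1.

(* [g z * h z / z] with its removable singularity at 0 removed; the value there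
   is 0 when [g] and [h] vanish at 0. *)
Definition mul_over_id (g h : C -> C) (z : C) : C :=
  if Ceq_dec z 0 then 0 else g z * h z / z.

Close Scope C_scope.

Definition radius_fun (r : R) : R :=
  6 * r ^ 2 + 4 * (sqrt 2 + 4) * r ^ 3
  + 2 * r ^ 2 * sqrt (- 8 * r ^ 10 + 31 * r ^ 8 - 44 * r ^ 6 + 27 * r ^ 4)
    / (1 - r ^ 2) ^ 2
  + r ^ 4 * (4 * r ^ 2 - 11 * r + 9) / (1 - r) ^ 3
  + 4 * sqrt (r ^ 8 * (15 - 20 * r ^ 2 + 15 * r ^ 4 - 4 * r ^ 6)
                / (1 - r ^ 2) ^ 4
              - r ^ 4 * (ln (1 - r ^ 2) + r ^ 2))
  - 1.

Definition is_smallest_root_in_01 (phi : R -> R) (r0 : R) : Prop :=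
  0 < r0 < 1 /\ phi r0 = 0 /\ forall r, 0 < r < 1 -> phi r = 0 -> r0 <= r.

(* Main.v *)
(* With p = z / g = 1 + b_1 z + b_2 z^2 + ... and q = z / h one has F = z / (p q), and the expression
   defining the class M becomes T (p q) - 1, where T w = z^2 w'' - z w' + w multiplies z^n by (n - 1)^2.
   Expanding p q around (1 + b_1 z) (1 + c_1 z), each term is estimated by Cauchy-Schwarz from the area
   theorem (the sum of (n - 1) |b_n|^2 over n >= 2 is at most 1) and from |b_1| <= 9/4; the total stays
   below 1 for |z| <= 0.26099, a disk slightly larger than |z| <= r0.

   The area theorem is proved by logarithmic energy.  The kernel - ln (|w - w'|^2 + tau) is positive on
   densities of mean zero, being a power series with nonnegative coefficients in a Gram kernel of rank
   three, up to terms depending on one variable only.  On the curve w = g (rho e^(it)) it splits into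
   the kernel of the circle and - ln |(g z - g w) / (z - w)|^2, whose Fourier coefficients are given by
   holomorphy; its coefficient at z is (1 - w / g w) / w.  Testing with e^(it) against polynomials in
   e^(-it) and letting tau tend to 0 gives the theorem.

   The bound on b_1 follows from the area theorem because z / g has no zeros, by an argument of Rouche
   type.  Goursat's lemma on rectangles in the coordinate log z makes circle means of holomorphic
   functions independent of the radius, hence Cauchy's formula and Taylor series. *)
Require Import Defs.
From Stdlib Require Import Reals Ranalysis5 Lra Lia ClassicalEpsilon.
From Coquelicot Require Import Coquelicot.
Open Scope R_scope.

(** The energy argument looks at a curve only through pairs of its points, so univalence enters as
    the nonvanishing of (g z - g w) / (z - w), diagonal included, and the interior of the image
    curve never has to be described. The diagonal, where this quotient becomes g', is handled by
    Hurwitz's argument. The regularization tau keeps the logarithm finite at coinciding points; its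
    error is not uniformly small near the diagonal, hence it is estimated in the mean over both
    variables, where it is a difference of two explicit circle energies.

    The constant 9/4 comes from the circle |z| = 3/4: there 9/4 * 3/4 - 1 = 0.6875 just exceeds
    0.687, the area-theorem bound for the terms of z / g of order at least 2. With 9/4 and the tail
    bounds at radius 0.26099 the final sum is about 0.967.

    The equation for r0 meets the analytic part only through r0 <= 0.26099. A sign change of
    [radius_fun] on 0.260985 -+ 0.0000005 gives a root, and monotonicity on [0, 0.3] makes it the
    smallest. *)

(** * Continuity of complex-valued functions *)

(** Componentwise and over any uniform space, so that one notion serves functions on the plane,
    closed curves and kernels of two real variables. *)
Definition contC {U : UniformSpace} (F : U -> C) (x : U) : Prop :=
  continuous (fun y => Re (F y)) x /\ continuous (fun y => Im (F y)) x.

Lemma Cmod_le_abs (z : C) : Cmod z <= Rabs (Re z) + Rabs (Im z).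
Proof.
  destruct z as [x y].
  replace ((x, y) : C) with (RtoC x + RtoC y * Ci)%C.
  2: { unfold Cplus, Cmult, RtoC, Ci; simpl; f_equal; ring. }
  eapply Rle_trans; [apply Cmod_triangle|].
  rewrite Cmod_mult, Cmod_Ci, !Cmod_R, Rmult_1_r.
  apply Req_le; f_equal; f_equal; simpl; ring.
Qed.

Lemma im_le_Cmod (z : C) : Rabs (Im z) <= Cmod z.
Proof.
  eapply Rle_trans; [|apply Rmax_Cmod]. apply Rmax_r.
Qed.

Lemma Ceq_ReIm (z w : C) : Re z = Re w -> Im z = Im w -> z = w.
Proof. destruct z, w; simpl; intros; subst; reflexivity. Qed.

Lemma re_minus (z w : C) : Re (z - w) = Re z - Re w.
Proof. reflexivity. Qed.

Lemma im_minus (z w : C) : Im (z - w) = Im z - Im w.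
Proof. reflexivity. Qed.

Lemma Cmod_minus_sym (z w : C) : Cmod (z - w) = Cmod (w - z).
Proof. replace (z - w)%C with (- (w - z))%C by ring. apply Cmod_opp. Qed.

Lemma Cmod_triangle' (x y : C) : Cmod x - Cmod y <= Cmod (x - y).
Proof.
  generalize (Cmod_triangle (x - y) y).
  replace (x - y + y)%C with x by ring. lra.
Qed.

Lemma contC_eps {U : UniformSpace} (F : U -> C) (x : U) :
  contC F x <-> forall eps, 0 < eps -> locally x (fun y => Cmod (F y - F x) < eps).
Proof.
  split.
  - intros [H1 H2] eps Heps.
    assert (He : 0 < eps / 2) by lra.
    generalize (proj1 (filterlim_locally _ _) H1 (mkposreal _ He))
               (proj1 (filterlim_locally _ _) H2 (mkposreal _ He)).
    intros A B. generalize (filter_and _ _ A B).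
    apply filter_imp. intros y [Hy1 Hy2].
    eapply Rle_lt_trans; [apply Cmod_le_abs|].
    unfold ball in Hy1, Hy2; simpl in Hy1, Hy2. unfold AbsRing_ball, abs, minus, plus, opp in Hy1, Hy2.
    change (Rabs (Re (F y) + - Re (F x)) < eps / 2) in Hy1.
    change (Rabs (Im (F y) + - Im (F x)) < eps / 2) in Hy2.
    rewrite re_minus, im_minus. unfold Rminus. lra.
  - intros H; split; apply filterlim_locally; intros eps;
    generalize (H eps (cond_pos eps)); apply filter_imp; intros y Hy;
    unfold ball; simpl; unfold AbsRing_ball, abs, minus, plus, opp; simpl.
    + eapply Rle_lt_trans; [|exact Hy]. generalize (re_le_Cmod (F y - F x)).
      rewrite re_minus. intros A; exact A.
    + eapply Rle_lt_trans; [|exact Hy]. generalize (im_le_Cmod (F y - F x)).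
      rewrite im_minus. intros A; exact A.
Qed.

Lemma locally_Cmod (z : C) (P : C -> Prop) :
  locally z P <-> exists d, 0 < d /\ forall w, Cmod (w - z) < d -> P w.
Proof.
  split.
  - intros [d Hd]. exists d. split; [apply cond_pos|]. intros w Hw. apply Hd.
    apply C_NormedModule_mixin_compat1. exact Hw.
  - intros [d [Hd H]].
    (* Balls of the uniform space [C] are squares; a square of half side e lies in the disk of
       radius sqrt 2 * e. *)
    assert (Hs : 0 < sqrt 2) by (apply sqrt_lt_R0; lra).
    assert (Hp : 0 < d / sqrt 2) by (apply Rdiv_lt_0_compat; lra).
    exists (mkposreal _ Hp). intros w Hw. apply H.
    generalize (C_NormedModule_mixin_compat2 z w (mkposreal _ Hp) Hw). simpl.
    intros A. eapply Rlt_le_trans; [exact A|]. right. field. lra.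
Qed.

Section ContC.
Context {U : UniformSpace}.
Implicit Types (F G : U -> C) (x : U).

Lemma contC_ext F G x : (forall y, F y = G y) -> contC F x -> contC G x.
Proof.
  intros H [A B]; split; [eapply continuous_ext, A|eapply continuous_ext, B];
  intros; simpl; rewrite H; reflexivity.
Qed.

Lemma contC_ext_loc F G x : locally x (fun y => F y = G y) -> contC F x -> contC G x.
Proof.
  intros H [A B]; split; [eapply continuous_ext_loc, A|eapply continuous_ext_loc, B];
  (eapply filter_imp; [|exact H]); simpl; intros y Hy; rewrite Hy; reflexivity.
Qed.

Lemma contC_const (c : C) x : contC (fun _ : U => c) x.
Proof. split; apply continuous_const. Qed.

Lemma contC_RtoC (f : U -> R) x : continuous f x -> contC (fun y => RtoC (f y)) x.
Proof. intros H; split; [exact H|apply continuous_const]. Qed.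

Lemma contC_plus F G x : contC F x -> contC G x -> contC (fun y => F y + G y)%C x.
Proof.
  intros [A B] [A' B']; split.
  - apply (continuous_plus (fun y => Re (F y)) (fun y => Re (G y))); assumption.
  - apply (continuous_plus (fun y => Im (F y)) (fun y => Im (G y))); assumption.
Qed.

Lemma contC_opp F x : contC F x -> contC (fun y => - F y)%C x.
Proof.
  intros [A B]; split.
  - apply (continuous_opp (fun y => Re (F y))); assumption.
  - apply (continuous_opp (fun y => Im (F y))); assumption.
Qed.

Lemma contC_minus F G x : contC F x -> contC G x -> contC (fun y => F y - G y)%C x.
Proof. intros; apply contC_plus; [|apply contC_opp]; assumption. Qed.

Lemma contC_conj F x : contC F x -> contC (fun y => Cconj (F y)) x.
Proof.
  intros [A B]; split; [exact A|].
  apply (continuous_opp (fun y => Im (F y))); assumption.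
Qed.

Lemma contC_mult F G x : contC F x -> contC G x -> contC (fun y => F y * G y)%C x.
Proof.
  intros [A B] [A' B']; split.
  - apply (continuous_minus (fun y => Re (F y) * Re (G y)) (fun y => Im (F y) * Im (G y)));
    apply (continuous_mult (K := R_AbsRing)); assumption.
  - apply (continuous_plus (fun y => Re (F y) * Im (G y)) (fun y => Im (F y) * Re (G y)));
    apply (continuous_mult (K := R_AbsRing)); assumption.
Qed.

Lemma continuous_Cmod F x : contC F x -> continuous (fun y => Cmod (F y)) x.
Proof.
  intros H. apply filterlim_locally. intros eps.
  generalize (proj1 (contC_eps F x) H eps (cond_pos eps)). apply filter_imp.
  intros y Hy. unfold ball; simpl; unfold AbsRing_ball, abs, minus, plus, opp; simpl.
  apply Rabs_def1.
  - generalize (Cmod_triangle' (F y) (F x)). lra.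
  - generalize (Cmod_triangle' (F x) (F y)). rewrite Cmod_minus_sym. lra.
Qed.

Lemma contC_inv F x : F x <> 0%C -> contC F x -> contC (fun y => / F y)%C x.
Proof.
  intros Hx H.
  assert (Hm : 0 < Cmod (F x)) by (apply Cmod_gt_0; exact Hx).
  assert (K : continuous (fun y => / ((Re (F y)) ^ 2 + (Im (F y)) ^ 2)) x).
  { apply continuous_comp with (g := fun r => / r).
    - destruct H as [A B].
      apply (continuous_plus (fun y => Re (F y) ^ 2) (fun y => Im (F y) ^ 2));
      simpl; apply (continuous_mult (K := R_AbsRing)); try assumption;
      apply (continuous_mult (K := R_AbsRing)); try assumption; apply continuous_const.
    - apply continuity_pt_filterlim. apply continuity_pt_inv.
      + apply derivable_continuous_pt, derivable_pt_id.
      + rewrite <- Cmod2_alt. apply Rgt_not_eq. apply pow_lt. exact Hm. }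
  destruct H as [A B]. split.
  - apply (continuous_ext (fun y => Re (F y) * / ((Re (F y)) ^ 2 + (Im (F y)) ^ 2))).
    + reflexivity.
    + apply (continuous_mult (K := R_AbsRing)); assumption.
  - apply (continuous_ext (fun y => - Im (F y) * / ((Re (F y)) ^ 2 + (Im (F y)) ^ 2))).
    + reflexivity.
    + apply (continuous_mult (K := R_AbsRing)); [|assumption].
      apply (continuous_opp (fun y => Im (F y))); assumption.
Qed.

Lemma contC_div F G x : G x <> 0%C -> contC F x -> contC G x -> contC (fun y => F y / G y)%C x.
Proof. intros; apply contC_mult; [|apply contC_inv]; assumption. Qed.

Lemma contC_pow F n x : contC F x -> contC (fun y => F y ^ n)%C x.
Proof.
  intros H; induction n; simpl; [apply contC_const|apply contC_mult; assumption].
Qed.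

Lemma contC_comp (f : C -> C) F x : contC F x -> contC f (F x) -> contC (fun y => f (F y)) x.
Proof.
  intros H K. apply contC_eps. intros eps Heps.
  destruct (proj1 (locally_Cmod _ _) (proj1 (contC_eps f (F x)) K eps Heps)) as [d [Hd Hf]].
  generalize (proj1 (contC_eps F x) H d Hd). apply filter_imp. intros y; apply Hf.
Qed.

End ContC.

Lemma contC_id (z : C) : contC (fun w => w) z.
Proof.
  apply contC_eps; intros eps Heps. apply locally_Cmod. exists eps; auto.
Qed.

(** * Complex differentiability *)

Section ComplexDerivative.
Implicit Types (f g : C -> C) (z w l m c : C).

(** The difference quotient is multiplied out, so the point w = z needs no exception. *)
Definition cder (f : C -> C) (z l : C) : Prop :=
  forall eps, 0 < eps -> exists d, 0 < d /\
    forall w, Cmod (w - z) < d -> Cmod (f w - f z - l * (w - z)) <= eps * Cmod (w - z).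

Lemma is_derive_cder (f : C -> C) (z l : C) :
  is_derive (K := C_AbsRing) (V := C_NormedModule) f z l <-> cder f z l.
Proof.
  split.
  - intros [_ H] eps Heps.
    specialize (H z (fun P H => H)).
    specialize (H (mkposreal eps Heps)). simpl in H.
    (* [is_derive] uses the neighbourhoods of the absolute ring [C]; [locally_C] translates them
       into those of the product space. *)
    destruct (proj1 (locally_Cmod z _) (proj2 (locally_C z _) H)) as [d [Hd Hw]].
    exists d; split; [exact Hd|]. intros w Hwd. specialize (Hw w Hwd).
    unfold minus, plus, opp, scal, norm in Hw; simpl in Hw.
    unfold mult in Hw; simpl in Hw.
    replace (f w - f z - l * (w - z))%C with (f w + - f z + - ((w + - z) * l))%C by ring. exact Hw.
  - intros H. split; [apply is_linear_scal_l|].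
    intros x Hx.
    apply (is_filter_lim_locally_unique (V := AbsRing_NormedModule C_AbsRing)) in Hx. subst x. intros eps.
    apply locally_C, locally_Cmod. destruct (H eps (cond_pos eps)) as [d [Hd Hw]].
    exists d; split; [exact Hd|]. intros w Hwd. specialize (Hw w Hwd).
    unfold minus, plus, opp, scal, norm; simpl.
    unfold mult; simpl.
    replace (f w + - f z + - ((w + - z) * l))%C with (f w - f z - l * (w - z))%C by ring. exact Hw.
Qed.

(** Caratheodory's criterion: with a continuous slope function, the sum, product, reciprocal and
    chain rules become an algebraic identity plus continuity. *)
Lemma cder_caratheodory (f : C -> C) (z l : C) :
  cder f z l <-> exists phi : C -> C, contC phi z /\ phi z = l /\
    locally z (fun w => f w - f z = phi w * (w - z))%C.
Proof.
  split.
  - intros H.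
    exists (fun w => if Ceq_dec w z then l else ((f w - f z) / (w - z))%C).
    split; [|split].
    + apply contC_eps. intros eps Heps. apply locally_Cmod.
      destruct (H (eps / 2)) as [d [Hd Hw]]; [lra|].
      exists d; split; [exact Hd|]. intros w Hwd.
      destruct (Ceq_dec z z) as [_|n]; [|congruence].
      destruct (Ceq_dec w z) as [e|n].
      * replace (l - l)%C with (RtoC 0) by ring. rewrite Cmod_0; exact Heps.
      * assert (n' : (w - z <> 0)%C) by (intro E; apply n; replace w with (w - z + z)%C by ring; rewrite E; ring).
        replace ((f w - f z) / (w - z) - l)%C with ((f w - f z - l * (w - z)) / (w - z))%C by (field; exact n').
        rewrite Cmod_div by exact n'. specialize (Hw w Hwd).
        assert (0 < Cmod (w - z)) by (apply Cmod_gt_0; exact n').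
        apply Rle_lt_trans with (eps / 2); [|lra].
        apply Rle_div_l; [assumption|]. exact Hw.
    + destruct (Ceq_dec z z) as [_|n]; [reflexivity|congruence].
    + apply locally_Cmod. exists 1; split; [lra|]. intros w _.
      destruct (Ceq_dec w z) as [e|n]; [subst; ring|].
      assert (n' : (w - z <> 0)%C) by (intro E; apply n; replace w with (w - z + z)%C by ring; rewrite E; ring).
      field; exact n'.
  - intros [phi [Hc [Hl Hp]]] eps Heps.
    apply contC_eps with (eps := eps) in Hc; [|exact Heps].
    generalize (filter_and _ _ Hc Hp). intros Hb.
    apply locally_Cmod in Hb. destruct Hb as [d [Hd Hw]].
    exists d; split; [exact Hd|]. intros w Hwd. destruct (Hw w Hwd) as [A B].
    rewrite B. subst l. replace (phi w * (w - z) - phi z * (w - z))%C with ((phi w - phi z) * (w - z))%C by ring.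
    rewrite Cmod_mult. apply Rmult_le_compat_r; [apply Cmod_ge_0|lra].
Qed.

Lemma cder_ext_loc (f g : C -> C) z l :
  locally z (fun w => f w = g w) -> cder f z l -> cder g z l.
Proof.
  intros H K eps Heps. destruct (K eps Heps) as [d [Hd Hw]].
  destruct (proj1 (locally_Cmod _ _) H) as [d' [Hd' Hw']].
  exists (Rmin d d'). split; [apply Rmin_pos; assumption|].
  intros w Hwd. rewrite <- (Hw' w), <- (Hw' z).
  - apply Hw. eapply Rlt_le_trans; [exact Hwd|apply Rmin_l].
  - replace (z - z)%C with (RtoC 0) by ring. rewrite Cmod_0; exact Hd'.
  - eapply Rlt_le_trans; [exact Hwd|apply Rmin_r].
Qed.

Lemma cder_ext (f g : C -> C) z l : (forall w, f w = g w) -> cder f z l -> cder g z l.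
Proof.
  intros H. apply cder_ext_loc. apply filter_forall. exact H.
Qed.

Lemma cder_cont f z l : cder f z l -> contC f z.
Proof.
  intros H. apply cder_caratheodory in H. destruct H as [phi [Hc [Hl Hp]]].
  apply contC_ext_loc with (F := fun w => (f z + phi w * (w - z))%C).
  - revert Hp. apply filter_imp. intros w Hw. rewrite <- Hw. ring.
  - apply contC_plus; [apply contC_const|]. apply contC_mult; [exact Hc|].
    apply contC_minus; [apply contC_id|apply contC_const].
Qed.

Lemma C_derive_cder f z l : cder f z l -> C_derive f z = l.
Proof. intros H. apply is_C_derive_unique, is_derive_cder, H. Qed.

Lemma cder_const c z : cder (fun _ => c) z 0.
Proof.
  intros eps Heps. exists 1; split; [lra|]. intros w _.
  replace (c - c - 0 * (w - z))%C with (RtoC 0) by ring. rewrite Cmod_0.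
  apply Rmult_le_pos; [lra|apply Cmod_ge_0].
Qed.

Lemma cder_id z : cder (fun w => w) z 1.
Proof.
  intros eps Heps. exists 1; split; [lra|]. intros w _.
  replace (w - z - 1 * (w - z))%C with (RtoC 0) by ring. rewrite Cmod_0.
  apply Rmult_le_pos; [lra|apply Cmod_ge_0].
Qed.

Lemma cder_plus f g z l m : cder f z l -> cder g z m -> cder (fun w => f w + g w)%C z (l + m)%C.
Proof.
  intros H K. apply cder_caratheodory in H. apply cder_caratheodory in K.
  destruct H as [phi [Hc [Hl Hp]]], K as [psi [Kc [Kl Kp]]].
  apply cder_caratheodory. exists (fun w => phi w + psi w)%C. split; [|split].
  - apply contC_plus; assumption.
  - congruence.
  - generalize (filter_and _ _ Hp Kp). apply filter_imp. intros w [A B].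
    replace (f w + g w - (f z + g z))%C with ((f w - f z) + (g w - g z))%C by ring.
    rewrite A, B. ring.
Qed.

Lemma cder_mult f g z l m :
  cder f z l -> cder g z m -> cder (fun w => f w * g w)%C z (l * g z + f z * m)%C.
Proof.
  intros H K. assert (K0 := cder_cont _ _ _ K).
  apply cder_caratheodory in H. apply cder_caratheodory in K.
  destruct H as [phi [Hc [Hl Hp]]], K as [psi [Kc [Kl Kp]]].
  apply cder_caratheodory. exists (fun w => phi w * g w + f z * psi w)%C. split; [|split].
  - apply contC_plus; apply contC_mult; try assumption. apply contC_const.
  - congruence.
  - generalize (filter_and _ _ Hp Kp). apply filter_imp. intros w [A B].
    replace (f w * g w - f z * g z)%C with ((f w - f z) * g w + f z * (g w - g z))%C by ring.
    rewrite A, B. ring.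
Qed.

Lemma cder_inv f z l :
  f z <> 0%C -> cder f z l -> cder (fun w => / f w)%C z (- l / (f z * f z))%C.
Proof.
  intros Hz H. assert (H0 := cder_cont _ _ _ H).
  apply cder_caratheodory in H. destruct H as [phi [Hc [Hl Hp]]].
  apply cder_caratheodory. exists (fun w => - phi w / (f w * f z))%C. split; [|split].
  - apply contC_div.
    + apply Cmult_neq_0; assumption.
    + apply contC_opp; assumption.
    + apply contC_mult; [assumption|apply contC_const].
  - congruence.
  - assert (Hn : locally z (fun w => f w <> 0%C)).
    { assert (Hm : 0 < Cmod (f z)) by (apply Cmod_gt_0; exact Hz).
      generalize (proj1 (contC_eps f z) H0 _ Hm). apply filter_imp.
      intros w Hw E. rewrite E in Hw.
      replace (0 - f z)%C with (- f z)%C in Hw by ring. rewrite Cmod_opp in Hw. lra. }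
    generalize (filter_and _ _ Hp Hn). apply filter_imp. intros w [A B].
    replace (/ f w - / f z)%C with (- (f w - f z) / (f w * f z))%C by (field; auto).
    rewrite A. field; auto.
Qed.

Lemma cder_scal c f z l : cder f z l -> cder (fun w => c * f w)%C z (c * l)%C.
Proof.
  intros H. generalize (cder_mult _ _ _ _ _ (cder_const c z) H).
  replace (0 * f z + c * l)%C with (c * l)%C by ring. auto.
Qed.

Lemma cder_minus f g z l m : cder f z l -> cder g z m -> cder (fun w => f w - g w)%C z (l - m)%C.
Proof.
  intros H K. apply (cder_ext (fun w => f w + (-1) * g w)%C).
  - intros; ring.
  - replace (l - m)%C with (l + (-1) * m)%C by ring. apply cder_plus; [assumption|].
    apply cder_scal; assumption.
Qed.

Lemma cder_shift f a z l : cder f (a + z)%C l -> cder (fun w => f (a + w))%C z l.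
Proof.
  intros H eps Heps. destruct (H eps Heps) as [d [Hd Hw]].
  exists d; split; [exact Hd|]. intros w Hwd.
  specialize (Hw (a + w)%C). replace (a + w - (a + z))%C with (w - z)%C in Hw by ring. auto.
Qed.

(** Mere differentiability at each point. Continuity of the derivative is a theorem ([hol_derive]),
    which is why the Cauchy theory below starts from Goursat's bisection and not from Green's
    formula. *)
Definition hol (R0 : R) (f : C -> C) : Prop := forall z, Cmod z < R0 -> exists l, cder f z l.

Lemma hol_cont R0 f z : hol R0 f -> Cmod z < R0 -> contC f z.
Proof. intros H Hz. destruct (H z Hz) as [l Hl]. eapply cder_cont; exact Hl. Qed.

Lemma locally_disk R0 z : Cmod z < R0 -> locally z (fun w => Cmod w < R0).
Proof.
  intros H. apply locally_Cmod. exists (R0 - Cmod z); split; [lra|].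
  intros w Hw. generalize (Cmod_triangle' w z). lra.
Qed.

Lemma hol_ext R0 f g : (forall z, Cmod z < R0 -> f z = g z) -> hol R0 f -> hol R0 g.
Proof.
  intros E H z Hz. destruct (H z Hz) as [l Hl]. exists l.
  eapply cder_ext_loc; [|exact Hl]. generalize (locally_disk R0 z Hz).
  apply filter_imp. exact E.
Qed.

Lemma hol_const R0 c : hol R0 (fun _ => c).
Proof. intros z _; eexists; apply cder_const. Qed.

Lemma hol_id R0 : hol R0 (fun z => z).
Proof. intros z _; eexists; apply cder_id. Qed.

Lemma hol_plus R0 f g : hol R0 f -> hol R0 g -> hol R0 (fun z => f z + g z)%C.
Proof.
  intros H K z Hz. destruct (H z Hz) as [l Hl], (K z Hz) as [m Hm].
  eexists; apply cder_plus; eassumption.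
Qed.

Lemma hol_minus R0 f g : hol R0 f -> hol R0 g -> hol R0 (fun z => f z - g z)%C.
Proof.
  intros H K z Hz. destruct (H z Hz) as [l Hl], (K z Hz) as [m Hm].
  eexists; apply cder_minus; eassumption.
Qed.

Lemma hol_mult R0 f g : hol R0 f -> hol R0 g -> hol R0 (fun z => f z * g z)%C.
Proof.
  intros H K z Hz. destruct (H z Hz) as [l Hl], (K z Hz) as [m Hm].
  eexists; apply cder_mult; eassumption.
Qed.

Lemma hol_inv R0 f : (forall z, Cmod z < R0 -> f z <> 0%C) -> hol R0 f -> hol R0 (fun z => / f z)%C.
Proof.
  intros N H z Hz. destruct (H z Hz) as [l Hl]. eexists; apply cder_inv; eauto.
Qed.

Lemma hol_div R0 f g : (forall z, Cmod z < R0 -> g z <> 0%C) ->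
  hol R0 f -> hol R0 g -> hol R0 (fun z => f z / g z)%C.
Proof. intros; apply hol_mult; [|apply hol_inv]; assumption. Qed.

Lemma hol_pow R0 f n : hol R0 f -> hol R0 (fun z => f z ^ n)%C.
Proof. intros H; induction n; simpl; [apply hol_const|apply hol_mult; assumption]. Qed.

End ComplexDerivative.

(* Bisecting both sides keeps the aspect ratio, so [Hloc] only concerns rectangles similar to
   [A, B] x [C, D]; for these, diameter times perimeter is comparable to the area. *)
Section Bisection.
Variables (A B C D : R) (P : R -> R -> R -> R -> Prop).
Hypotheses (HAB : A < B) (HCD : C < D).
Hypothesis Hsub : forall a b c d, A <= a -> a < b -> b <= B -> C <= c -> c < d -> d <= D ->
  P a ((a + b) / 2) c ((c + d) / 2) -> P ((a + b) / 2) b c ((c + d) / 2) ->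
  P a ((a + b) / 2) ((c + d) / 2) d -> P ((a + b) / 2) b ((c + d) / 2) d -> P a b c d.
Hypothesis Hloc : forall x y, A <= x <= B -> C <= y <= D -> exists del, 0 < del /\
  forall a b c d, A <= a -> a <= x <= b -> b <= B -> C <= c -> c <= y <= d -> d <= D ->
    a < b -> c < d -> b - a < del -> d - c < del ->
    (b - a) * (D - C) = (d - c) * (B - A) -> P a b c d.

Let W n := (B - A) / 2 ^ n.
Let H n := (D - C) / 2 ^ n.
Let Q n (p : R * R) := P (fst p) (fst p + W n) (snd p) (snd p + H n).

(** Excluded middle selects the first of three quarters on which [P] fails. If [P] holds on all
    three, the fourth is taken by default, and [Hsub] then forces [P] to fail there. *)
Let next n (p : R * R) : R * R :=
  let l := fst p in let r := fst p + W (S n) in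
  let u := snd p in let v := snd p + H (S n) in
  if excluded_middle_informative (Q (S n) (l, u)) then
  if excluded_middle_informative (Q (S n) (r, u)) then
  if excluded_middle_informative (Q (S n) (l, v)) then (r, v)
  else (l, v) else (r, u) else (l, u).

Let corner := fix corner n := match n with O => (A, C) | S n => next n (corner n) end.

Let W_S n : W n = 2 * W (S n).
Proof. unfold W; simpl. field. apply pow_nonzero; lra. Qed.

Let H_S n : H n = 2 * H (S n).
Proof. unfold H; simpl. field. apply pow_nonzero; lra. Qed.

Let W_pos n : 0 < W n.
Proof. unfold W. apply Rdiv_lt_0_compat; [lra|apply pow_lt; lra]. Qed.

Let H_pos n : 0 < H n.
Proof. unfold H. apply Rdiv_lt_0_compat; [lra|apply pow_lt; lra]. Qed.

Let next_step n p : fst p <= fst (next n p) <= fst p + W (S n) /\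
  snd p <= snd (next n p) <= snd p + H (S n).
Proof.
  unfold next. generalize (W_pos (S n)) (H_pos (S n)). intros.
  repeat destruct excluded_middle_informative; simpl; lra.
Qed.

Let corner_in n : A <= fst (corner n) /\ fst (corner n) + W n <= B /\
  C <= snd (corner n) /\ snd (corner n) + H n <= D.
Proof.
  induction n as [|n IH].
  - simpl. unfold W, H; simpl. lra.
  - simpl. generalize (next_step n (corner n)). rewrite W_S, H_S in IH. lra.
Qed.

Let next_bad n p : A <= fst p -> fst p + W n <= B -> C <= snd p -> snd p + H n <= D ->
  ~ Q n p -> ~ Q (S n) (next n p).
Proof.
  intros h1 h2 h3 h4 N. unfold next.
  destruct excluded_middle_informative as [q1|]; [|assumption].
  destruct excluded_middle_informative as [q2|]; [|assumption].
  destruct excluded_middle_informative as [q3|]; [|assumption].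
  intros q4. apply N. unfold Q in *; simpl in *.
  generalize (W_pos n) (H_pos n); intros.
  apply Hsub; try lra.
  - replace ((fst p + (fst p + W n)) / 2) with (fst p + W (S n)) by (rewrite (W_S n); field).
    replace ((snd p + (snd p + H n)) / 2) with (snd p + H (S n)) by (rewrite (H_S n); field). exact q1.
  - replace ((fst p + (fst p + W n)) / 2) with (fst p + W (S n)) by (rewrite (W_S n); field).
    replace ((snd p + (snd p + H n)) / 2) with (snd p + H (S n)) by (rewrite (H_S n); field).
    replace (fst p + W n) with (fst p + W (S n) + W (S n)) by (rewrite (W_S n); ring). exact q2.
  - replace ((fst p + (fst p + W n)) / 2) with (fst p + W (S n)) by (rewrite (W_S n); field).
    replace ((snd p + (snd p + H n)) / 2) with (snd p + H (S n)) by (rewrite (H_S n); field).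
    replace (snd p + H n) with (snd p + H (S n) + H (S n)) by (rewrite (H_S n); ring). exact q3.
  - replace ((fst p + (fst p + W n)) / 2) with (fst p + W (S n)) by (rewrite (W_S n); field).
    replace ((snd p + (snd p + H n)) / 2) with (snd p + H (S n)) by (rewrite (H_S n); field).
    replace (fst p + W n) with (fst p + W (S n) + W (S n)) by (rewrite (W_S n); ring).
    replace (snd p + H n) with (snd p + H (S n) + H (S n)) by (rewrite (H_S n); ring). exact q4.
Qed.

(** The common point is the supremum of the left endpoints, each of which lies below every right
    endpoint. *)
Let nested (u w : nat -> R) : (forall n, u n <= u (S n)) -> (forall n, u (S n) + w (S n) <= u n + w n) ->
  (forall n, 0 < w n) -> exists x, forall n, u n <= x <= u n + w n.
Proof.
  intros Hu Hw Hp.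
  assert (L : forall n k, u n <= u (n + k)%nat /\ u (n + k)%nat + w (n + k)%nat <= u n + w n).
  { intros n k; induction k as [|k IH].
    - rewrite Nat.add_0_r; lra.
    - rewrite Nat.add_succ_r. generalize (Hu (n + k)%nat) (Hw (n + k)%nat); lra. }
  assert (M : forall n m, u n <= u m + w m).
  { intros n m. destruct (Nat.le_ge_cases n m) as [h|h].
    - generalize (L n (m - n)%nat) (Hp m). replace (n + (m - n))%nat with m by lia. lra.
    - generalize (L m (n - m)%nat) (Hp n). replace (m + (n - m))%nat with n by lia. lra. }
  destruct (completeness (fun x => exists n, x = u n)) as [x [X1 X2]].
  - exists (u 0%nat + w 0%nat). intros y [n ->]; apply M.
  - exists (u 0%nat); exists 0%nat; reflexivity.
  - exists x; intros n; split.
    + apply X1; exists n; reflexivity.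
    + apply X2. intros y [k ->]; apply M.
Qed.

Lemma bisection : P A B C D.
Proof.
  destruct (excluded_middle_informative (P A B C D)) as [|N]; [assumption|exfalso].
  assert (Bad : forall n, ~ Q n (corner n)).
  { intros n; induction n as [|n IH].
    - simpl; unfold Q, W, H; simpl.
      replace (A + (B - A) / 1) with B by field. replace (C + (D - C) / 1) with D by field. exact N.
    - simpl. destruct (corner_in n) as [? [? [? ?]]]. apply next_bad; assumption. }
  destruct (nested (fun n => fst (corner n)) W) as [x Hx]; try (intros n; simpl).
  { apply next_step. } { rewrite (W_S n). generalize (next_step n (corner n)); lra. } { apply W_pos. }
  destruct (nested (fun n => snd (corner n)) H) as [y Hy]; try (intros n; simpl).
  { apply next_step. } { rewrite (H_S n). generalize (next_step n (corner n)); lra. } { apply H_pos. }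
  destruct (Hloc x y) as [del [Hdel Hd]].
  { generalize (Hx 0%nat) (corner_in 0); simpl; lra. }
  { generalize (Hy 0%nat) (corner_in 0); simpl; lra. }
  assert (Small : exists n, W n < del /\ H n < del).
  { destruct (pow_lt_1_zero (1 / 2)) with (y := del / (B - A + (D - C))) as [n Hn].
    - rewrite Rabs_pos_eq; lra.
    - apply Rdiv_lt_0_compat; lra.
    - exists n. specialize (Hn n (Nat.le_refl n)).
      rewrite Rabs_pos_eq in Hn by (apply pow_le; lra).
      apply Rlt_div_r in Hn; [|lra].
      assert (E : forall r, r / 2 ^ n = (1 / 2) ^ n * r).
      { intros r. unfold Rdiv. rewrite Rpow_mult_distr, pow1, pow_inv. ring. }
      unfold W, H. rewrite !E. assert (0 < (1 / 2) ^ n) by (apply pow_lt; lra). nra. }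
  destruct Small as [n [S1 S2]].
  apply (Bad n). unfold Q. destruct (corner_in n) as [? [? [? ?]]].
  generalize (W_pos n) (H_pos n) (Hx n) (Hy n); intros.
  apply Hd; try lra. unfold W, H. field. apply pow_nonzero; lra.
Qed.

End Bisection.

(** * Line integrals around rectangles and Goursat's lemma *)

(** The counterclockwise integral of P dx + Q dy over the boundary of [a, b] x [c, d]. *)
Definition circulation (P Q : R -> R -> R) (a b c d : R) : R :=
  RInt (fun x => P x c) a b - RInt (fun x => P x d) a b
  + (RInt (fun y => Q b y) c d - RInt (fun y => Q a y) c d).

Section Circulation.
Variables (P Q : R -> R -> R).

Let ex_hor a b y := ex_RInt (fun x => P x y) a b.
Let ex_ver c d x := ex_RInt (fun y => Q x y) c d.

Lemma circulation_split_x a m b c d :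
  ex_hor a m c -> ex_hor m b c -> ex_hor a m d -> ex_hor m b d ->
  circulation P Q a b c d = circulation P Q a m c d + circulation P Q m b c d.
Proof.
  intros h1 h2 h3 h4. unfold circulation.
  generalize (RInt_Chasles (V := R_CompleteNormedModule) _ _ _ _ h1 h2).
  generalize (RInt_Chasles (V := R_CompleteNormedModule) _ _ _ _ h3 h4).
  unfold plus; simpl. intros. lra.
Qed.

Lemma circulation_split_y a b c m d :
  ex_ver c m a -> ex_ver m d a -> ex_ver c m b -> ex_ver m d b ->
  circulation P Q a b c d = circulation P Q a b c m + circulation P Q a b m d.
Proof.
  intros h1 h2 h3 h4. unfold circulation.
  generalize (RInt_Chasles (V := R_CompleteNormedModule) _ _ _ _ h1 h2).
  generalize (RInt_Chasles (V := R_CompleteNormedModule) _ _ _ _ h3 h4).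
  unfold plus; simpl. intros. lra.
Qed.

(** The shared number [k] is both dP/dy and dQ/dx: the form P dx + Q dy is closed at the point, in
    the sense of total differentiability only. *)
Definition closed_form_at x y := exists p k q,
  differentiable_pt_lim P x y p k /\ differentiable_pt_lim Q x y k q.

Lemma differentiable_pt_lim_continuous_x (F : R -> R -> R) x y p k :
  differentiable_pt_lim F x y p k -> continuous (fun t => F t y) x.
Proof.
  intros H. apply continuity_pt_filterlim.
  generalize (differentiable_continuity_pt F x y (ex_intro _ p (ex_intro _ k H))).
  intros K. apply continuity_2d_pt_filterlim in K.
  apply continuity_pt_filterlim.
  apply (continuous_comp_2 (fun t : R => t) (fun _ : R => y) (fun a b => F a b)).
  - apply continuous_id. - apply continuous_const. - exact K.
Qed.

Lemma differentiable_pt_lim_continuous_y (F : R -> R -> R) x y p k :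
  differentiable_pt_lim F x y p k -> continuous (fun t => F x t) y.
Proof.
  intros H.
  generalize (differentiable_continuity_pt F x y (ex_intro _ p (ex_intro _ k H))).
  intros K. apply continuity_2d_pt_filterlim in K.
  apply (continuous_comp_2 (fun _ : R => x) (fun t : R => t) (fun a b => F a b)).
  - apply continuous_const. - apply continuous_id. - exact K.
Qed.

Lemma ex_hor_closed a b y : a <= b -> (forall x, a <= x <= b -> closed_form_at x y) -> ex_hor a b y.
Proof.
  intros L H. apply (ex_RInt_continuous (V := R_CompleteNormedModule)).
  intros z. rewrite Rmin_left, Rmax_right by lra. intros Hz.
  destruct (H z Hz) as [p [k [q [A _]]]]. eapply differentiable_pt_lim_continuous_x; exact A.
Qed.

Lemma ex_ver_closed c d x : c <= d -> (forall y, c <= y <= d -> closed_form_at x y) -> ex_ver c d x.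
Proof.
  intros L H. apply (ex_RInt_continuous (V := R_CompleteNormedModule)).
  intros z. rewrite Rmin_left, Rmax_right by lra. intros Hz.
  destruct (H z Hz) as [p [k [q [_ A]]]]. eapply differentiable_pt_lim_continuous_y; exact A.
Qed.

(** The first-order parts k (d - c) on the horizontal sides and k (b - a) on the vertical ones
    integrate to opposite values, so only the deviations from them contribute. The case k = 0 is the
    plain length estimate. *)
Lemma circulation_bound_affine a b c d k M : a <= b -> c <= d ->
  ex_hor a b c -> ex_hor a b d -> ex_ver c d a -> ex_ver c d b ->
  (forall x, a <= x <= b -> Rabs (P x c - P x d + k * (d - c)) <= M) ->
  (forall y, c <= y <= d -> Rabs (Q b y - Q a y - k * (b - a)) <= M) ->
  Rabs (circulation P Q a b c d) <= M * ((b - a) + (d - c)).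
Proof.
  intros Lab Lcd h1 h2 h3 h4 BP BQ.
  assert (e1 : ex_RInt (fun x => P x c - P x d) a b) by (apply (ex_RInt_minus (V := R_NormedModule)); assumption).
  assert (e2 : ex_RInt (fun y => Q b y - Q a y) c d) by (apply (ex_RInt_minus (V := R_NormedModule)); assumption).
  assert (E : circulation P Q a b c d =
    RInt (fun x => P x c - P x d + k * (d - c)) a b + RInt (fun y => Q b y - Q a y - k * (b - a)) c d).
  { unfold circulation.
    rewrite (RInt_plus (V := R_CompleteNormedModule) (fun x => P x c - P x d) (fun _ => k * (d - c))) by (try assumption; apply ex_RInt_const).
    rewrite (RInt_minus (V := R_CompleteNormedModule) (fun y => Q b y - Q a y) (fun _ => k * (b - a))) by (try assumption; apply ex_RInt_const).
    rewrite (RInt_minus (V := R_CompleteNormedModule) (fun x => P x c) (fun x => P x d)) by assumption.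
    rewrite (RInt_minus (V := R_CompleteNormedModule) (fun y => Q b y) (fun y => Q a y)) by assumption.
    rewrite !RInt_const. unfold plus, minus, opp, scal; simpl. unfold mult, plus, opp; simpl. ring. }
  rewrite E. eapply Rle_trans; [apply Rabs_triang|]. rewrite Rmult_plus_distr_l.
  apply Rplus_le_compat; (rewrite (Rmult_comm M); apply abs_RInt_le_const; [assumption| |assumption]).
  - apply (ex_RInt_plus (V := R_NormedModule)); [assumption|apply ex_RInt_const].
  - apply (ex_RInt_minus (V := R_NormedModule)); [assumption|apply ex_RInt_const].
Qed.

Theorem goursat a b c d : a < b -> c < d ->
  (forall x y, a <= x <= b -> c <= y <= d -> closed_form_at x y) ->
  circulation P Q a b c d = 0.
Proof.
  intros Lab Lcd H.
  assert (K : forall eps, 0 < eps -> Rabs (circulation P Q a b c d) <= eps * ((b - a) * (d - c))).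
  { intros eps Heps.
    apply (bisection a b c d (fun a b c d => Rabs (circulation P Q a b c d) <= eps * ((b - a) * (d - c)))); try assumption.
    - intros a' b' c' d' h1 h2 h3 h4 h5 h6 q1 q2 q3 q4.
      rewrite (circulation_split_x a' ((a' + b') / 2) b') by
        (apply ex_hor_closed; [lra|intros; apply H; lra]).
      rewrite (circulation_split_y a' ((a' + b') / 2) c' ((c' + d') / 2) d') by
        (apply ex_ver_closed; [lra|intros; apply H; lra]).
      rewrite (circulation_split_y ((a' + b') / 2) b' c' ((c' + d') / 2) d') by
        (apply ex_ver_closed; [lra|intros; apply H; lra]).
      apply Rabs_le_between in q1. apply Rabs_le_between in q2. apply Rabs_le_between in q3. apply Rabs_le_between in q4.
      apply Rabs_le.
      set (e := eps * ((b' - a') * (d' - c'))).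
      assert (E1 : eps * (((a' + b') / 2 - a') * ((c' + d') / 2 - c')) = e / 4) by (unfold e; field).
      assert (E2 : eps * ((b' - (a' + b') / 2) * ((c' + d') / 2 - c')) = e / 4) by (unfold e; field).
      assert (E3 : eps * (((a' + b') / 2 - a') * (d' - (c' + d') / 2)) = e / 4) by (unfold e; field).
      assert (E4 : eps * ((b' - (a' + b') / 2) * (d' - (c' + d') / 2)) = e / 4) by (unfold e; field).
      rewrite E1 in q1. rewrite E2 in q2. rewrite E3 in q3. rewrite E4 in q4. lra.
    - intros x y Hx Hy. destruct (H x y Hx Hy) as [p [k [q [DP DQ]]]].
      (* For a rectangle similar to the large one, 2 eta times the square of its half perimeter is
         exactly eps times its area. *)
      set (eta := eps * ((b - a) * (d - c)) / (2 * ((b - a) + (d - c)) ^ 2)).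
      assert (Heta : 0 < eta).
      { unfold eta. apply Rdiv_lt_0_compat.
        - apply Rmult_lt_0_compat; [lra|]. apply Rmult_lt_0_compat; lra.
        - apply Rmult_lt_0_compat; [lra|]. apply pow_lt; lra. }
      destruct (DP (mkposreal _ Heta)) as [d1 H1]. destruct (DQ (mkposreal _ Heta)) as [d2 H2].
      simpl in H1, H2.
      exists (Rmin d1 d2). split; [apply Rmin_pos; apply cond_pos|].
      intros a' b' c' d' h1 h2 h3 h4 h5 h6 h7 h8 h9 h10 R.
      assert (Hr1 := Rmin_l d1 d2). assert (Hr2 := Rmin_r d1 d2).
      assert (Near : forall s t, a' <= s <= b' -> c' <= t <= d' ->
        Rabs (s - x) <= b' - a' /\ Rabs (t - y) <= d' - c').
      { intros s t Hs Ht; split; apply Rabs_le; lra. }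
      assert (EP : forall s t, a' <= s <= b' -> c' <= t <= d' ->
         Rabs (P s t - P x y - (p * (s - x) + k * (t - y))) <= eta * ((b' - a') + (d' - c'))).
      { intros s t Hs Ht. destruct (Near s t Hs Ht) as [N1 N2].
        eapply Rle_trans; [apply H1; lra|]. apply Rmult_le_compat_l; [lra|].
        apply Rmax_lub; lra. }
      assert (EQ : forall s t, a' <= s <= b' -> c' <= t <= d' ->
         Rabs (Q s t - Q x y - (k * (s - x) + q * (t - y))) <= eta * ((b' - a') + (d' - c'))).
      { intros s t Hs Ht. destruct (Near s t Hs Ht) as [N1 N2].
        eapply Rle_trans; [apply H2; lra|]. apply Rmult_le_compat_l; [lra|].
        apply Rmax_lub; lra. }
      eapply Rle_trans.
      { apply circulation_bound_affine with (k := k) (M := 2 * (eta * ((b' - a') + (d' - c')))); try lra.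
        - apply ex_hor_closed; [lra|intros; apply H; lra].
        - apply ex_hor_closed; [lra|intros; apply H; lra].
        - apply ex_ver_closed; [lra|intros; apply H; lra].
        - apply ex_ver_closed; [lra|intros; apply H; lra].
        - intros s Hs. generalize (EP s c' Hs) (EP s d' Hs). intros A1 A2.
          assert (A1' := A1 ltac:(lra)). assert (A2' := A2 ltac:(lra)).
          apply Rabs_le_between in A1'. apply Rabs_le_between in A2'. apply Rabs_le.
          rewrite !Rmult_minus_distr_l in *. lra.
        - intros t Ht. generalize (EQ a' t) (EQ b' t). intros A1 A2.
          assert (A1' := A1 ltac:(lra) Ht). assert (A2' := A2 ltac:(lra) Ht).
          apply Rabs_le_between in A1'. apply Rabs_le_between in A2'. apply Rabs_le.
          rewrite !Rmult_minus_distr_l in *. lra. }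
      right.
      assert (Es : (d' - c') = (b' - a') * (d - c) / (b - a)) by (rewrite R; field; lra).
      rewrite Es. unfold eta. field. split; lra. }
  destruct (Req_dec (circulation P Q a b c d) 0) as [|N]; [assumption|exfalso].
  apply Rabs_pos_lt in N.
  assert (Ar : 0 < (b - a) * (d - c)) by (apply Rmult_lt_0_compat; lra).
  specialize (K (Rabs (circulation P Q a b c d) / (2 * ((b - a) * (d - c))))).
  assert (E : Rabs (circulation P Q a b c d) / (2 * ((b - a) * (d - c))) * ((b - a) * (d - c)) = Rabs (circulation P Q a b c d) / 2) by (field; split; lra).
  rewrite E in K. assert (0 < Rabs (circulation P Q a b c d) / (2 * ((b - a) * (d - c)))).
  { apply Rdiv_lt_0_compat; lra. }
  specialize (K H0). lra.
Qed.

(** A square of half side e about the exceptional point is cut out. The four remaining pieces have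
    circulation 0 by [goursat], and boundedness makes the contribution of the square at most 8 M
    e. *)
Theorem goursat_except x0 y0 M del a b c d :
  a < x0 < b -> c < y0 < d -> 0 < del ->
  (forall x y, a <= x <= b -> c <= y <= d -> x <> x0 \/ y <> y0 -> closed_form_at x y) ->
  (forall x y, Rabs (x - x0) < del -> Rabs (y - y0) < del -> x <> x0 \/ y <> y0 ->
     Rabs (P x y) <= M /\ Rabs (Q x y) <= M) ->
  circulation P Q a b c d = 0.
Proof.
  intros Hx Hy Hdel H HM.
  assert (HM0 : 0 <= M).
  { destruct (HM (x0 + del / 2) y0) as [A _].
    - replace (x0 + del / 2 - x0) with (del / 2) by ring. rewrite Rabs_pos_eq; lra.
    - replace (y0 - y0) with 0 by ring. rewrite Rabs_R0; lra.
    - left; lra.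
    - eapply Rle_trans; [apply Rabs_pos|exact A]. }
  assert (K : forall e, 0 < e -> e < del -> a < x0 - e -> x0 + e < b -> c < y0 - e -> y0 + e < d ->
    Rabs (circulation P Q a b c d) <= 8 * M * e).
  { intros e h0 h1 h2 h3 h4 h5.
    assert (Hh : forall u v y, a <= u -> u <= v -> v <= b -> c <= y <= d -> y <> y0 -> ex_hor u v y).
    { intros u v y k1 k2 k3 k4 k5. apply ex_hor_closed; [lra|]. intros; apply H; first [lra | right; exact k5]. }
    assert (Hv : forall u v x, c <= u -> u <= v -> v <= d -> a <= x <= b -> x <> x0 -> ex_ver u v x).
    { intros u v x k1 k2 k3 k4 k5. apply ex_ver_closed; [lra|]. intros; apply H; first [lra | left; exact k5]. }
    rewrite (circulation_split_x a (x0 - e) b) by (apply Hh; lra).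
    rewrite (circulation_split_x (x0 - e) (x0 + e) b) by (apply Hh; lra).
    rewrite (goursat a (x0 - e)) by (first [lra | intros; apply H; first [lra | left; lra]]).
    rewrite (goursat (x0 + e) b) by (first [lra | intros; apply H; first [lra | left; lra]]).
    rewrite (circulation_split_y _ _ c (y0 - e) d) by (apply Hv; lra).
    rewrite (circulation_split_y _ _ (y0 - e) (y0 + e) d) by (apply Hv; lra).
    rewrite (goursat _ _ c (y0 - e)) by (first [lra | intros; apply H; first [lra | right; lra]]).
    rewrite (goursat _ _ (y0 + e) d) by (first [lra | intros; apply H; first [lra | right; lra]]).
    replace (0 + (0 + (circulation P Q (x0 - e) (x0 + e) (y0 - e) (y0 + e) + 0) + 0))
      with (circulation P Q (x0 - e) (x0 + e) (y0 - e) (y0 + e)) by ring.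
    replace (8 * M * e) with (2 * M * ((x0 + e - (x0 - e)) + (y0 + e - (y0 - e)))) by ring.
    assert (HPt : forall x y, Rabs (x - x0) <= e -> Rabs (y - y0) <= e -> x <> x0 \/ y <> y0 -> Rabs (P x y) <= M /\ Rabs (Q x y) <= M).
    { intros x y k1 k2 k3. apply HM; first [lra | exact k3]. }
    apply circulation_bound_affine with (k := 0);
      [lra|lra|apply Hh; lra|apply Hh; lra|apply Hv; lra|apply Hv; lra| |].
    - intros x Hxe.
      destruct (HPt x (y0 - e)) as [A _]; [apply Rabs_le; lra|apply Rabs_le; lra|right; lra|].
      destruct (HPt x (y0 + e)) as [B _]; [apply Rabs_le; lra|apply Rabs_le; lra|right; lra|].
      apply Rabs_le_between in A. apply Rabs_le_between in B. apply Rabs_le; lra.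
    - intros y Hye.
      destruct (HPt (x0 - e) y) as [_ A]; [apply Rabs_le; lra|apply Rabs_le; lra|left; lra|].
      destruct (HPt (x0 + e) y) as [_ B]; [apply Rabs_le; lra|apply Rabs_le; lra|left; lra|].
      apply Rabs_le_between in A. apply Rabs_le_between in B. apply Rabs_le; lra. }
  destruct (Req_dec (circulation P Q a b c d) 0) as [|N]; [assumption|exfalso].
  apply Rabs_pos_lt in N. set (I := Rabs (circulation P Q a b c d)) in *.
  set (m := Rmin (Rmin (x0 - a) (b - x0)) (Rmin (y0 - c) (d - y0))).
  assert (Hm : 0 < m) by (unfold m; repeat apply Rmin_pos; lra).
  assert (m1 : m <= x0 - a) by (unfold m; eapply Rle_trans; [apply Rmin_l|apply Rmin_l]).
  assert (m2 : m <= b - x0) by (unfold m; eapply Rle_trans; [apply Rmin_l|apply Rmin_r]).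
  assert (m3 : m <= y0 - c) by (unfold m; eapply Rle_trans; [apply Rmin_r|apply Rmin_l]).
  assert (m4 : m <= d - y0) by (unfold m; eapply Rle_trans; [apply Rmin_r|apply Rmin_r]).
  set (e := Rmin (Rmin (m / 2) (del / 2)) (I / (16 * (M + 1)))).
  assert (He : 0 < e).
  { unfold e. repeat apply Rmin_pos; try lra. apply Rdiv_lt_0_compat; lra. }
  assert (e1 : e <= m / 2) by (unfold e; eapply Rle_trans; [apply Rmin_l|apply Rmin_l]).
  assert (e2 : e <= del / 2) by (unfold e; eapply Rle_trans; [apply Rmin_l|apply Rmin_r]).
  assert (e3 : e <= I / (16 * (M + 1))) by (unfold e; apply Rmin_r).
  specialize (K e He). apply Rle_div_r in e3; [|lra].
  assert (I <= 8 * M * e) by (apply K; lra). nra.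
Qed.

End Circulation.

(** * The complex exponential and polar coordinates *)

Definition cis (t : R) : C := (cos t, sin t).
Definition cexp (z : C) : C := (exp (Re z) * cis (Im z))%C.

Lemma cis_plus s t : cis (s + t) = (cis s * cis t)%C.
Proof. unfold cis, Cmult; simpl. rewrite cos_plus, sin_plus. f_equal; ring. Qed.

Lemma cis_0 : cis 0 = 1%C.
Proof. unfold cis. rewrite cos_0, sin_0. reflexivity. Qed.

Lemma cis_2PI : cis (2 * PI) = 1%C.
Proof. unfold cis. rewrite cos_2PI, sin_2PI. reflexivity. Qed.

Lemma Cmod_cis t : Cmod (cis t) = 1.
Proof.
  unfold Cmod, cis; simpl fst; simpl snd.
  replace (cos t ^ 2 + sin t ^ 2) with 1; [apply sqrt_1|].
  generalize (sin2_cos2 t). unfold Rsqr. intros. lra.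
Qed.

Lemma cis_conj t : (cis t * Cconj (cis t) = 1)%C.
Proof. rewrite <- Cmod2_conj, Cmod_cis. rewrite pow1. reflexivity. Qed.

Lemma cis_neq0 t : cis t <> 0%C.
Proof. apply Cmod_gt_0. rewrite Cmod_cis; lra. Qed.

Lemma cis_inv t : (/ cis t = Cconj (cis t))%C.
Proof.
  replace (Cconj (cis t)) with ((cis t * Cconj (cis t)) * / cis t)%C by (field; apply cis_neq0).
  rewrite cis_conj. ring.
Qed.

Lemma cexp_plus z w : cexp (z + w) = (cexp z * cexp w)%C.
Proof.
  unfold cexp. rewrite re_plus, im_plus, exp_plus, cis_plus, RtoC_mult. ring.
Qed.

Lemma derive_at_0 (f : R -> R) l eps : is_derive f 0 l -> 0 < eps ->
  exists d, 0 < d /\ forall h, Rabs h < d -> Rabs (f h - f 0 - l * h) <= eps * Rabs h.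
Proof.
  intros H Heps. apply is_derive_Reals in H.
  destruct (H eps Heps) as [d Hd]. exists d; split; [apply cond_pos|].
  intros h Hh. destruct (Req_dec h 0) as [->|N].
  - replace (f 0 - f 0 - l * 0) with 0 by ring. rewrite Rabs_R0; lra.
  - specialize (Hd h N Hh). rewrite Rplus_0_l in Hd.
    replace (f h - f 0 - l * h) with (((f h - f 0) / h - l) * h) by (field; exact N).
    rewrite Rabs_mult. apply Rmult_le_compat_r; [apply Rabs_pos|lra].
Qed.

Lemma cder_cexp_0 : cder cexp 0 1.
Proof.
  intros eps Heps.
  (* The four error terms below cost 1 + 2 + 2 + 1 = 6 multiples of e |w|; the cap 1 gives |1 + s|
     <= 2. *)
  set (e := Rmin (eps / 8) 1).
  assert (He : 0 < e) by (unfold e; apply Rmin_pos; lra).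
  assert (He1 : e <= eps / 8) by apply Rmin_l.
  destruct (derive_at_0 exp 1 e) as [d1 [Hd1 H1]]; [|exact He|].
  { evar_last; [apply is_derive_exp|apply exp_0]. }
  destruct (derive_at_0 cos 0 e) as [d2 [Hd2 H2]]; [|exact He|].
  { evar_last; [apply is_derive_cos|rewrite sin_0; ring]. }
  destruct (derive_at_0 sin 1 e) as [d3 [Hd3 H3]]; [|exact He|].
  { evar_last; [apply is_derive_sin|apply cos_0]. }
  exists (Rmin (Rmin d1 d2) (Rmin d3 e)). split; [repeat first [assumption | apply Rmin_pos]|].
  intros w. replace (w - 0)%C with w by ring. intros Hw.
  assert (Hw1 : Cmod w < d1) by (eapply Rlt_le_trans; [exact Hw|eapply Rle_trans; [apply Rmin_l|apply Rmin_l]]).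
  assert (Hw2 : Cmod w < d2) by (eapply Rlt_le_trans; [exact Hw|eapply Rle_trans; [apply Rmin_l|apply Rmin_r]]).
  assert (Hw3 : Cmod w < d3) by (eapply Rlt_le_trans; [exact Hw|eapply Rle_trans; [apply Rmin_r|apply Rmin_l]]).
  assert (Hw4 : Cmod w < e) by (eapply Rlt_le_trans; [exact Hw|eapply Rle_trans; [apply Rmin_r|apply Rmin_r]]).
  generalize (re_le_Cmod w) (im_le_Cmod w). intros Lr Li.
  set (s := Re w) in *. set (t := Im w) in *.
  assert (Ew : w = (s + t * Ci)%C).
  { apply Ceq_ReIm; unfold s, t; destruct w; simpl; ring. }
  assert (E0 : cexp 0 = 1%C).
  { unfold cexp; simpl. rewrite exp_0, cis_0. ring. }
  rewrite E0. unfold cexp at 1. fold s t.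
  specialize (H1 s ltac:(lra)). specialize (H2 t ltac:(lra)). specialize (H3 t ltac:(lra)).
  rewrite exp_0 in H1. rewrite cos_0 in H2. rewrite sin_0 in H3.
  (* The errors of exp, cos and sin are separated; the leftover s t i is of second order. *)
  replace (exp s * cis t - 1 - 1 * w)%C with
    ((exp s - 1 - 1 * s)%R * cis t + ((1 + s)%R * (cos t - 1 - 0 * t)%R
     + (1 + s)%R * (sin t - 0 - 1 * t)%R * Ci + s * t * Ci))%C.
  2: { rewrite Ew. apply Ceq_ReIm; unfold cis; simpl; ring. }
  assert (Ht0 := Rabs_pos t). assert (Hs0 := Rabs_pos s).
  assert (Hm := Cmod_ge_0 w).
  assert (Hsb : Rabs (1 + s) <= 2).
  { eapply Rle_trans; [apply Rabs_triang|]. rewrite Rabs_R1. assert (e <= 1) by apply Rmin_r. lra. }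
  eapply Rle_trans; [apply Cmod_triangle|].
  eapply Rle_trans; [apply Rplus_le_compat_l; eapply Rle_trans; [apply Cmod_triangle|]; apply Rplus_le_compat_r, Cmod_triangle|].
  rewrite !Cmod_mult, Cmod_cis, Cmod_Ci, !Cmod_R.
  assert (B1 : Rabs (exp s - 1 - 1 * s) * 1 <= e * Cmod w) by nra.
  assert (B2 : Rabs (1 + s) * Rabs (cos t - 1 - 0 * t) <= 2 * (e * Cmod w)).
  { apply Rmult_le_compat; try apply Rabs_pos; [assumption|]. nra. }
  assert (B3 : Rabs (1 + s) * Rabs (sin t - 0 - 1 * t) * 1 <= 2 * (e * Cmod w)).
  { rewrite Rmult_1_r. apply Rmult_le_compat; try apply Rabs_pos; [assumption|]. nra. }
  assert (B4 : Rabs s * Rabs t * 1 <= e * Cmod w).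
  { rewrite Rmult_1_r. apply Rmult_le_compat; try apply Rabs_pos; lra. }
  nra.
Qed.

Lemma cder_cexp z : cder cexp z (cexp z).
Proof.
  assert (H : cder (fun w => cexp z * cexp (- z + w))%C z (cexp z * 1)%C).
  { apply cder_scal. apply cder_shift. replace (- z + z)%C with (RtoC 0) by ring. apply cder_cexp_0. }
  replace (cexp z * 1)%C with (cexp z) in H by ring.
  eapply cder_ext; [|exact H]. intros w. cbv beta. rewrite <- cexp_plus. f_equal; ring.
Qed.

Lemma cder_comp (f g : C -> C) z l m :
  cder g z m -> cder f (g z) l -> cder (fun w => f (g w)) z (l * m)%C.
Proof.
  intros H K. assert (H0 := cder_cont _ _ _ H).
  apply cder_caratheodory in H. apply cder_caratheodory in K.
  destruct H as [phi [Hc [Hl Hp]]], K as [psi [Kc [Kl Kp]]].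
  apply cder_caratheodory. exists (fun w => psi (g w) * phi w)%C. split; [|split].
  - apply contC_mult; [apply contC_comp|]; assumption.
  - congruence.
  - apply locally_Cmod in Kp. destruct Kp as [d [Hd Kd]].
    generalize (filter_and _ _ Hp (proj1 (contC_eps g z) H0 d Hd)).
    apply filter_imp. intros w [A B]. rewrite (Kd _ B), A. ring.
Qed.

(** f dz = (Re f dx - Im f dy) + i (Im f dx + Re f dy), and the Cauchy-Riemann equations say that
    both real forms are closed. *)
Lemma cder_closed_form (f : C -> C) (x y : R) l : cder f (x, y) l ->
  closed_form_at (fun s t => Re (f (s, t))) (fun s t => - Im (f (s, t))) x y /\
  closed_form_at (fun s t => Im (f (s, t))) (fun s t => Re (f (s, t))) x y.
Proof.
  intros H. destruct l as [a b].
  assert (D : forall eps : posreal, locally_2d (fun u v =>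
     Cmod (f (u, v) - f (x, y) - (a, b) * ((u, v) - (x, y))) <= eps * Rmax (Rabs (u - x)) (Rabs (v - y))) x y).
  { intros eps. destruct (H (eps / 2)) as [d [Hd Hw]]; [generalize (cond_pos eps); lra|].
    assert (Hs2 : sqrt 2 <= 2).
    { rewrite <- (sqrt_pow2 2) at 2 by lra. apply sqrt_le_1_alt; lra. }
    assert (Hd2 : 0 < d / 2) by lra.
    exists (mkposreal _ Hd2). simpl. intros u v Hu Hv.
    assert (B : Cmod ((u, v) - (x, y)) <= 2 * Rmax (Rabs (u - x)) (Rabs (v - y))).
    { eapply Rle_trans; [apply Cmod_2Rmax|]. apply Rmult_le_compat_r; [|exact Hs2].
      eapply Rle_trans; [|apply Rmax_l]. apply Rabs_pos. }
    assert (Rmax (Rabs (u - x)) (Rabs (v - y)) < d / 2) by (apply Rmax_lub_lt; assumption).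
    eapply Rle_trans; [apply Hw; lra|].
    generalize (cond_pos eps). nra. }
  split.
  - exists a, (- b), (- a). split; intros eps; generalize (D eps); apply locally_2d_impl, locally_2d_forall; intros u v B.
    + eapply Rle_trans; [|exact B]. eapply Rle_trans; [|apply re_le_Cmod]. right. f_equal.
      rewrite !re_minus, re_mult. simpl. ring.
    + eapply Rle_trans; [|exact B]. eapply Rle_trans; [|apply im_le_Cmod]. right. rewrite <- Rabs_Ropp. f_equal.
      rewrite !im_minus, im_mult. simpl. ring.
  - exists b, a, (- b). split; intros eps; generalize (D eps); apply locally_2d_impl, locally_2d_forall; intros u v B.
    + eapply Rle_trans; [|exact B]. eapply Rle_trans; [|apply im_le_Cmod]. right. f_equal.
      rewrite !im_minus, im_mult. simpl. ring.
    + eapply Rle_trans; [|exact B]. eapply Rle_trans; [|apply re_le_Cmod]. right. f_equal.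
      rewrite !re_minus, re_mult. simpl. ring.
Qed.

(** * Means over a period *)

Definition Ccontinuous (F : R -> C) : Prop := forall t, contC F t.

(** For F t = q (r e^(it)) this is the contour integral of q(z) dz / z over |z| = r divided by 2 pi
    i; all contour integrals below take this form. *)
Definition mean (F : R -> C) : C :=
  (RInt (fun t => Re (F t)) 0 (2 * PI) / (2 * PI), RInt (fun t => Im (F t)) 0 (2 * PI) / (2 * PI)).

Lemma two_PI_pos : 0 < 2 * PI.
Proof. generalize PI_RGT_0; lra. Qed.

Lemma ex_RInt_cont (f : R -> R) a b : (forall t, continuous f t) -> ex_RInt f a b.
Proof. intros H. apply (ex_RInt_continuous (V := R_CompleteNormedModule)). intros; apply H. Qed.

Lemma mean_ext F G : (forall t, F t = G t) -> mean F = mean G.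
Proof.
  intros H. unfold mean. f_equal; f_equal; apply RInt_ext; intros; rewrite H; reflexivity.
Qed.

Lemma mean_plus F G : Ccontinuous F -> Ccontinuous G -> mean (fun t => F t + G t)%C = (mean F + mean G)%C.
Proof.
  intros H K. unfold mean, Cplus; simpl. generalize two_PI_pos; intros.
  f_equal.
  - rewrite (RInt_plus (V := R_CompleteNormedModule) (fun t => Re (F t)) (fun t => Re (G t)))
      by (apply ex_RInt_cont; intros; first [apply H|apply K]).
    unfold plus; simpl. field. lra.
  - rewrite (RInt_plus (V := R_CompleteNormedModule) (fun t => Im (F t)) (fun t => Im (G t)))
      by (apply ex_RInt_cont; intros; first [apply H|apply K]).
    unfold plus; simpl. field. lra.
Qed.

Lemma mean_const c : mean (fun _ => c) = c.
Proof.
  unfold mean. rewrite !RInt_const. generalize two_PI_pos; intros.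
  destruct c; simpl. unfold scal; simpl. unfold mult; simpl. f_equal; field; lra.
Qed.

Lemma RInt_Rmult (f : R -> R) a b l : ex_RInt f a b -> RInt (fun x : R => l * f x) a b = l * RInt f a b.
Proof. exact (RInt_scal (V := R_CompleteNormedModule) f a b l). Qed.

Lemma mean_scal c F : Ccontinuous F -> mean (fun t => c * F t)%C = (c * mean F)%C.
Proof.
  intros H. generalize two_PI_pos; intros.
  assert (eR : ex_RInt (fun t => Re (F t)) 0 (2 * PI)) by (apply ex_RInt_cont; intros; apply H).
  assert (eI : ex_RInt (fun t => Im (F t)) 0 (2 * PI)) by (apply ex_RInt_cont; intros; apply H).
  unfold mean, Cmult; simpl. f_equal.
  - rewrite (RInt_minus (V := R_CompleteNormedModule) (fun t => fst c * Re (F t)) (fun t => snd c * Im (F t)))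
      by (apply (ex_RInt_scal (V := R_NormedModule)); assumption).
    rewrite (RInt_Rmult _ _ _ (fst c) eR).
    rewrite (RInt_Rmult _ _ _ (snd c) eI).
    unfold minus, plus, opp, scal; simpl. unfold mult; simpl. field. lra.
  - rewrite (RInt_plus (V := R_CompleteNormedModule) (fun t => fst c * Im (F t)) (fun t => snd c * Re (F t)))
      by (apply (ex_RInt_scal (V := R_NormedModule)); assumption).
    rewrite (RInt_Rmult _ _ _ (fst c) eI).
    rewrite (RInt_Rmult _ _ _ (snd c) eR).
    unfold minus, plus, opp, scal; simpl. unfold mult; simpl. field. lra.
Qed.

Lemma mean_minus F G : Ccontinuous F -> Ccontinuous G -> mean (fun t => F t - G t)%C = (mean F - mean G)%C.
Proof.
  intros H K. rewrite (mean_ext _ (fun t => F t + (-1) * G t)%C) by (intros; ring).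
  rewrite mean_plus, (mean_scal (-1)).
  - ring.
  - exact K.
  - exact H.
  - intros t; apply contC_mult; [apply contC_const|apply K].
Qed.

Lemma mean_conj F : Ccontinuous F -> mean (fun t => Cconj (F t)) = Cconj (mean F).
Proof.
  intros H. unfold mean, Cconj; simpl. f_equal.
  rewrite (RInt_opp (V := R_CompleteNormedModule) (fun t => Im (F t))) by (apply ex_RInt_cont; intros; apply H).
  unfold opp; simpl. field. generalize two_PI_pos; lra.
Qed.

Lemma Re_mean_le F M : Ccontinuous F -> (forall t, 0 <= t <= 2 * PI -> Re (F t) <= M) -> Re (mean F) <= M.
Proof.
  intros H B. unfold mean; simpl. generalize two_PI_pos; intros P.
  apply Rle_div_l; [exact P|].
  replace (M * (2 * PI)) with (RInt (fun _ => M) 0 (2 * PI)).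
  - apply RInt_le; [lra| | |intros; apply B; lra].
    + apply ex_RInt_cont; intros; apply H.
    + apply ex_RInt_const.
  - rewrite RInt_const. unfold scal; simpl; unfold mult; simpl. ring.
Qed.

(** Multiplying by the conjugate of the mean turns its modulus into a real part, to which
    monotonicity of the real integral applies. *)
Lemma Cmod_mean_le F M : Ccontinuous F -> (forall t, 0 <= t <= 2 * PI -> Cmod (F t) <= M) -> Cmod (mean F) <= M.
Proof.
  intros H B.
  assert (M0 : 0 <= M).
  { generalize (B 0) two_PI_pos (Cmod_ge_0 (F 0)); intros. specialize (H0 ltac:(lra)). lra. }
  destruct (Ceq_dec (mean F) 0) as [e|n].
  - rewrite e, Cmod_0; exact M0.
  - assert (P : 0 < Cmod (mean F)) by (apply Cmod_gt_0; exact n).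
    assert (K : Re (Cconj (mean F) * mean F) <= Cmod (mean F) * M).
    { rewrite <- mean_scal by exact H. apply Re_mean_le.
      - intros t; apply contC_mult; [apply contC_const|apply H].
      - intros t Ht. eapply Rle_trans; [apply Rle_abs|]. eapply Rle_trans; [apply re_le_Cmod|].
        rewrite Cmod_mult, Cmod_conj. apply Rmult_le_compat_l; [lra|apply B; exact Ht]. }
    rewrite Cmult_comm, <- Cmod2_conj in K. rewrite re_RtoC in K. nra.
Qed.

Lemma RInt_shift_period (f : R -> R) T a : (forall t, continuous f t) -> (forall t, f (t + T) = f t) ->
  RInt f a (a + T) = RInt f 0 T.
Proof.
  intros H P.
  assert (e : forall x y, ex_RInt f x y) by (intros; apply ex_RInt_cont; exact H).
  generalize (RInt_Chasles (V := R_CompleteNormedModule) _ _ _ _ (e a T) (e T (a + T)))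
    (RInt_Chasles (V := R_CompleteNormedModule) _ _ _ _ (e 0 a) (e a T))
    (RInt_comp_lin (V := R_CompleteNormedModule) f 1 T 0 a).
  replace (1 * 0 + T) with T by ring. replace (1 * a + T) with (a + T) by ring.
  intros E1 E2 E3. specialize (E3 (e _ _)).
  rewrite (RInt_ext _ f) in E3.
  - unfold plus in E1, E2; simpl in *. lra.
  - intros x _. unfold scal; simpl. unfold mult; simpl. rewrite !Rmult_1_l. apply P.
Qed.

Lemma cis_period t : cis (t + 2 * PI) = cis t.
Proof. rewrite cis_plus, cis_2PI. ring. Qed.

Lemma contC_cis t : contC cis t.
Proof.
  split; apply continuity_pt_filterlim; [apply continuity_cos|apply continuity_sin].
Qed.

Lemma contC_circle (q : C -> C) r t : contC q (r * cis t)%C -> contC (fun t => q (r * cis t)%C) t.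
Proof.
  intros H. apply (contC_comp q (fun t => r * cis t)%C); [|exact H].
  apply contC_mult; [apply contC_const|apply contC_cis].
Qed.

Lemma Cmod_circle r t : 0 <= r -> Cmod (r * cis t) = r.
Proof. intros H. rewrite Cmod_mult, Cmod_cis, Cmod_R, Rabs_pos_eq by exact H. ring. Qed.

Lemma exp_le_compat x y : x <= y -> exp x <= exp y.
Proof. intros [H| ->]; [left; apply exp_increasing; exact H|right; reflexivity]. Qed.

(** * Independence of circle means from the radius *)

Section CircleMeans.
Variable q : C -> C.

Let polar s t : C := (RtoC (exp s) * cis t)%C.

Let polar_closed s t l : cder q (polar s t) l ->
  closed_form_at (fun s t => Re (q (polar s t))) (fun s t => - Im (q (polar s t))) s t /\
  closed_form_at (fun s t => Im (q (polar s t))) (fun s t => Re (q (polar s t))) s t.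
Proof.
  intros H. apply (cder_closed_form (fun z => q (cexp z)) s t (l * cexp (s, t))%C).
  apply cder_comp; [apply cder_cexp|exact H].
Qed.

(* In the coordinates [z = exp (s + i t)] the two radial sides of the rectangle cancel by periodicity,
   and the vertical ones are the means over two circles. *)
Let mean_of_circulation s1 s2 t0 :
  (forall t, contC (fun t => q (polar s1 t)) t) -> (forall t, contC (fun t => q (polar s2 t)) t) ->
  circulation (fun s t => Re (q (polar s t))) (fun s t => - Im (q (polar s t))) s1 s2 t0 (t0 + 2 * PI) = 0 ->
  circulation (fun s t => Im (q (polar s t))) (fun s t => Re (q (polar s t))) s1 s2 t0 (t0 + 2 * PI) = 0 ->
  mean (fun t => q (polar s1 t)) = mean (fun t => q (polar s2 t)).
Proof.
  intros C1 C2 A B.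
  assert (Per : forall s t, polar s (t + 2 * PI) = polar s t).
  { intros s t. unfold polar. rewrite cis_period. reflexivity. }
  unfold circulation in A, B.
  assert (E1 : forall s, RInt (fun x => Re (q (polar x (t0 + 2 * PI)))) s1 s = RInt (fun x => Re (q (polar x t0))) s1 s)
    by (intros s; apply RInt_ext; intros; rewrite Per; reflexivity).
  assert (E2 : forall s, RInt (fun x => Im (q (polar x (t0 + 2 * PI)))) s1 s = RInt (fun x => Im (q (polar x t0))) s1 s)
    by (intros s; apply RInt_ext; intros; rewrite Per; reflexivity).
  rewrite E1 in A. rewrite E2 in B.
  assert (F1 : forall s, (forall t, contC (fun t => q (polar s t)) t) -> RInt (fun t => Re (q (polar s t))) t0 (t0 + 2 * PI) = RInt (fun t => Re (q (polar s t))) 0 (2 * PI)).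
  { intros s Hs. apply RInt_shift_period; [intros; apply Hs|intros; rewrite Per; reflexivity]. }
  assert (F2 : forall s, (forall t, contC (fun t => q (polar s t)) t) -> RInt (fun t => - Im (q (polar s t))) t0 (t0 + 2 * PI) = - RInt (fun t => Im (q (polar s t))) 0 (2 * PI)).
  { intros s Hs. rewrite (RInt_shift_period (fun t => - Im (q (polar s t)))).
    - apply (RInt_opp (V := R_CompleteNormedModule) (fun t => Im (q (polar s t)))). apply ex_RInt_cont. intros; apply Hs.
    - intros t. apply (continuous_opp (V := R_NormedModule) (fun t => Im (q (polar s t)))). apply Hs.
    - intros; rewrite Per; reflexivity. }
  rewrite !F2 in A by assumption. rewrite !F1 in B by assumption.
  unfold mean. f_equal; f_equal; lra.
Qed.

Let polar_ln r t : 0 < r -> polar (ln r) t = (r * cis t)%C.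
Proof. intros H. unfold polar. rewrite exp_ln by exact H. reflexivity. Qed.

Lemma circle_mean_const r1 r2 : 0 < r1 -> r1 < r2 ->
  (forall z, r1 <= Cmod z <= r2 -> exists l, cder q z l) ->
  mean (fun t => q (r1 * cis t)%C) = mean (fun t => q (r2 * cis t)%C).
Proof.
  intros h1 h2 H.
  rewrite (mean_ext _ (fun t => q (polar (ln r1) t))) by (intros; rewrite polar_ln; auto).
  rewrite (mean_ext (fun t => q (r2 * cis t)%C) (fun t => q (polar (ln r2) t))) by (intros; rewrite polar_ln; [auto|lra]).
  assert (P := two_PI_pos).
  assert (Hln : ln r1 < ln r2) by (apply ln_increasing; lra).
  assert (Hc : forall s t, ln r1 <= s <= ln r2 -> exists l, cder q (polar s t) l).
  { intros s t Hs. apply H. unfold polar. rewrite Cmod_circle by (left; apply exp_pos).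
    split; [rewrite <- (exp_ln r1) by lra|rewrite <- (exp_ln r2) by lra]; apply exp_le_compat; lra. }
  assert (Cc : forall s t, ln r1 <= s <= ln r2 -> contC (fun t => q (polar s t)) t).
  { intros s t Hs. unfold polar. apply contC_circle. destruct (Hc s t Hs) as [l Hl]. eapply cder_cont; exact Hl. }
  apply (mean_of_circulation _ _ 0).
  - intros; apply Cc; lra.
  - intros; apply Cc; lra.
  - apply goursat; [exact Hln|lra|]. intros s t Hs Ht. destruct (Hc s t Hs) as [l Hl]. eapply polar_closed; exact Hl.
  - apply goursat; [exact Hln|lra|]. intros s t Hs Ht. destruct (Hc s t Hs) as [l Hl]. eapply polar_closed; exact Hl.
Qed.

Lemma unit_cis (z : C) : Cmod z = 1 -> exists t, z = cis t.
Proof.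
  intros H. destruct z as [a b].
  assert (E : a ^ 2 + b ^ 2 = 1).
  { generalize (Cmod2_alt (a, b)). rewrite H. simpl Re; simpl Im. lra. }
  assert (Ha : -1 <= a <= 1) by (split; nra).
  assert (Hs : sqrt (1 - a²) = Rabs b).
  { rewrite <- sqrt_Rsqr_abs. f_equal. unfold Rsqr. lra. }
  destruct (Rle_dec 0 b) as [p|n].
  - exists (acos a). unfold cis. rewrite cos_acos, sin_acos, Hs, Rabs_pos_eq by lra. reflexivity.
  - exists (- acos a). unfold cis. rewrite cos_neg, sin_neg, cos_acos, sin_acos, Hs, Rabs_left by lra. f_equal; ring.
Qed.

Lemma polar_form (w : C) : w <> 0%C -> exists t, w = (Cmod w * cis t)%C.
Proof.
  intros H. assert (P : 0 < Cmod w) by (apply Cmod_gt_0; exact H).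
  destruct (unit_cis (w / Cmod w)%C) as [t Ht].
  - rewrite Cmod_div, Cmod_R, Rabs_pos_eq by (try lra; intro E; apply RtoC_inj in E; lra). field; lra.
  - exists t. rewrite <- Ht. field. intro E; apply RtoC_inj in E; lra.
Qed.

Lemma cis_eq_1 t : - PI <= t <= PI -> cis t = 1%C -> t = 0.
Proof.
  intros Ht E. assert (Hc : cos t = 1) by (exact (f_equal fst E)).
  assert (Hp := PI_RGT_0).
  destruct (Rle_dec 0 t).
  - apply cos_inj; [lra|lra|]. rewrite cos_0; exact Hc.
  - assert (- t = 0); [|lra]. apply cos_inj; [lra|lra|]. rewrite cos_0, cos_neg; exact Hc.
Qed.

(** The window of arguments starts at [t0 - PI], so the exceptional point has exactly one preimage
    in the rectangle ([Hinj]), and it is an interior one, as [goursat_except] requires. *)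
Lemma circle_mean_const_except r1 r2 w M del : 0 < r1 -> r1 < Cmod w -> Cmod w < r2 -> 0 < del ->
  (forall z, r1 <= Cmod z <= r2 -> z <> w -> exists l, cder q z l) ->
  (forall z, Cmod (z - w) < del -> z <> w -> Cmod (q z) <= M) ->
  mean (fun t => q (r1 * cis t)%C) = mean (fun t => q (r2 * cis t)%C).
Proof.
  intros h1 h2 h2' Hdel H HM.
  rewrite (mean_ext _ (fun t => q (polar (ln r1) t))) by (intros; rewrite polar_ln; auto).
  rewrite (mean_ext (fun t => q (r2 * cis t)%C) (fun t => q (polar (ln r2) t))) by (intros; rewrite polar_ln; [auto|lra]).
  assert (P := two_PI_pos).
  destruct (polar_form w) as [t0 Hw]; [apply Cmod_gt_0; lra|].
  set (s0 := ln (Cmod w)).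
  assert (Hw' : w = polar s0 t0) by (unfold s0; rewrite polar_ln by lra; exact Hw).
  assert (Hln1 : ln r1 < s0) by (apply ln_increasing; lra).
  assert (Hln2 : s0 < ln r2) by (apply ln_increasing; lra).
  assert (Hmod : forall s t, Cmod (polar s t) = exp s).
  { intros. unfold polar. apply Cmod_circle. left; apply exp_pos. }
  assert (Hinj : forall s t, t0 - PI <= t <= t0 - PI + 2 * PI -> polar s t = w -> s = s0 /\ t = t0).
  { intros s t Ht E. assert (Es : s = s0).
    { unfold s0. rewrite <- E, Hmod, ln_exp. reflexivity. }
    split; [exact Es|]. rewrite Hw', Es in E. unfold polar in E.
    assert (Ec : cis (t - t0) = 1%C).
    { replace (t - t0) with (t + - t0) by ring. rewrite cis_plus.
      replace (cis t) with (cis t0).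
      - rewrite <- cis_plus. replace (t0 + - t0) with 0 by ring. apply cis_0.
      - assert (N : RtoC (exp s0) <> 0%C) by (intro N; apply RtoC_inj in N; generalize (exp_pos s0); lra).
        replace (cis t0) with (/ exp s0 * (exp s0 * cis t0))%C by (field; exact N).
        rewrite <- E. field; exact N. }
    apply cis_eq_1 in Ec; lra. }
  assert (Hc : forall s t, ln r1 <= s <= ln r2 -> t0 - PI <= t <= t0 - PI + 2 * PI -> s <> s0 \/ t <> t0 -> exists l, cder q (polar s t) l).
  { intros s t Hs Ht N. apply H.
    - rewrite Hmod. split; [rewrite <- (exp_ln r1) by lra|rewrite <- (exp_ln r2) by lra]; apply exp_le_compat; lra.
    - intro E. destruct (Hinj s t Ht E). lra. }
  assert (Cc : forall r t, r = r1 \/ r = r2 -> contC (fun t => q (polar (ln r) t)) t).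
  { intros r t Hr. apply contC_ext with (F := fun t => q (r * cis t)%C).
    - intros; rewrite polar_ln; [reflexivity|]. destruct Hr; lra.
    - apply contC_circle. destruct (H (r * cis t)%C) as [l Hl].
      + rewrite Cmod_circle; destruct Hr; lra.
      + intro E. apply (f_equal Cmod) in E. rewrite Cmod_circle in E; destruct Hr; lra.
      + eapply cder_cont; exact Hl. }
  destruct (proj1 (locally_Cmod _ _) (proj1 (contC_eps cexp (s0, t0)) (cder_cont _ _ _ (cder_cexp _)) del Hdel)) as [d [Hd Hcd]].
  (* The bound d / 2 in each coordinate keeps the image within [del] of w; the bound PI keeps t in
     the window where the preimage of w is unique. *)
  assert (Bnd : forall s t, Rabs (s - s0) < Rmin (d / 2) PI -> Rabs (t - t0) < Rmin (d / 2) PI -> s <> s0 \/ t <> t0 ->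
      Cmod (q (polar s t)) <= M).
  { intros s t Hs Ht N. apply HM.
    - change (polar s t) with (cexp (s, t)). rewrite Hw'. change (polar s0 t0) with (cexp (s0, t0)).
      apply Hcd. eapply Rle_lt_trans; [apply Cmod_le_abs|]. simpl.
      generalize (Rmin_l (d / 2) PI). unfold Rminus in *. lra.
    - intro E. assert (t0 - PI <= t <= t0 - PI + 2 * PI).
      { generalize (Rmin_r (d / 2) PI). apply Rabs_def2 in Ht. lra. }
      destruct (Hinj s t H0 E). lra. }
  assert (Pp := PI_RGT_0).
  assert (Hmin : 0 < Rmin (d / 2) PI) by (apply Rmin_pos; lra).
  apply (mean_of_circulation _ _ (t0 - PI)).
  - intros; apply Cc; auto.
  - intros; apply Cc; auto.
  - apply (goursat_except _ _ s0 t0 M (Rmin (d / 2) PI)); try lra.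
    + intros s t Hs Ht N. destruct (Hc s t Hs Ht N) as [l Hl]. eapply polar_closed; exact Hl.
    + intros s t Hs Ht N. generalize (Bnd s t Hs Ht N). rewrite Rabs_Ropp.
      generalize (re_le_Cmod (q (polar s t))) (im_le_Cmod (q (polar s t))). lra.
  - apply (goursat_except _ _ s0 t0 M (Rmin (d / 2) PI)); try lra.
    + intros s t Hs Ht N. destruct (Hc s t Hs Ht N) as [l Hl]. eapply polar_closed; exact Hl.
    + intros s t Hs Ht N. generalize (Bnd s t Hs Ht N).
      generalize (re_le_Cmod (q (polar s t))) (im_le_Cmod (q (polar s t))). lra.
Qed.

End CircleMeans.

(** * Complex series *)

Fixpoint Csum (c : nat -> C) (n : nat) : C :=
  match n with O => 0%C | S n => (Csum c n + c n)%C end.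

Definition Clim (u : nat -> C) (l : C) : Prop :=
  forall eps, 0 < eps -> exists N, forall n, (N <= n)%nat -> Cmod (u n - l) < eps.

Lemma Csum_ext c d n : (forall k, (k < n)%nat -> c k = d k) -> Csum c n = Csum d n.
Proof. intros H; induction n; simpl; [reflexivity|]. rewrite IHn, H; auto. Qed.

Lemma Csum_plus c d n : Csum (fun k => c k + d k)%C n = (Csum c n + Csum d n)%C.
Proof. induction n; simpl; [ring|]. rewrite IHn; ring. Qed.

Lemma Csum_scal a c n : Csum (fun k => a * c k)%C n = (a * Csum c n)%C.
Proof. induction n; simpl; [ring|]. rewrite IHn; ring. Qed.

Lemma Csum_S c n : Csum c (S n) = (c 0%nat + Csum (fun k => c (S k)) n)%C.
Proof. induction n as [|n IH]; [simpl; ring|]. simpl in *. rewrite IH. ring. Qed.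

Lemma Clim_ext u v l : (forall n, u n = v n) -> Clim u l -> Clim v l.
Proof. intros E H eps Heps. destruct (H eps Heps) as [N HN]. exists N. intros; rewrite <- E; auto. Qed.

Lemma Clim_const c : Clim (fun _ => c) c.
Proof. intros eps Heps. exists 0%nat. intros _ _. replace (c - c)%C with (RtoC 0) by ring. rewrite Cmod_0; exact Heps. Qed.

Lemma Clim_plus u v l m : Clim u l -> Clim v m -> Clim (fun n => u n + v n)%C (l + m)%C.
Proof.
  intros H K eps Heps. destruct (H (eps / 2)) as [N HN]; [lra|]. destruct (K (eps / 2)) as [N' HN']; [lra|].
  exists (max N N'). intros n Hn. replace (u n + v n - (l + m))%C with ((u n - l) + (v n - m))%C by ring.
  eapply Rle_lt_trans; [apply Cmod_triangle|]. specialize (HN n ltac:(lia)). specialize (HN' n ltac:(lia)). lra.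
Qed.

Lemma Clim_scal a u l : Clim u l -> Clim (fun n => a * u n)%C (a * l)%C.
Proof.
  intros H eps Heps. assert (Ha := Cmod_ge_0 a). destruct (H (eps / (Cmod a + 1))) as [N HN].
  - apply Rdiv_lt_0_compat; lra.
  - exists N. intros n Hn. replace (a * u n - a * l)%C with (a * (u n - l))%C by ring.
    rewrite Cmod_mult. specialize (HN n Hn). apply Rlt_div_r in HN; [|lra].
    assert (Hp := Cmod_ge_0 (u n - l)). nra.
Qed.

Lemma Clim_minus u v l m : Clim u l -> Clim v m -> Clim (fun n => u n - v n)%C (l - m)%C.
Proof.
  intros H K. apply (Clim_ext (fun n => u n + (-1) * v n)%C); [intros; ring|].
  replace (l - m)%C with (l + (-1) * m)%C by ring. apply Clim_plus; [exact H|apply Clim_scal; exact K].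
Qed.

Lemma Clim_incr u l k : Clim (fun n => u (k + n)%nat) l -> Clim u l.
Proof.
  intros H eps Heps. destruct (H eps Heps) as [N HN]. exists (k + N)%nat.
  intros n Hn. replace n with (k + (n - k))%nat by lia. apply HN; lia.
Qed.

Lemma Clim_decr u l k : Clim u l -> Clim (fun n => u (k + n)%nat) l.
Proof.
  intros H eps Heps. destruct (H eps Heps) as [N HN]. exists N. intros; apply HN; lia.
Qed.

Lemma Clim_Cmod_le u l a M N : Clim u l -> (forall n, (N <= n)%nat -> Cmod (u n - a) <= M) -> Cmod (l - a) <= M.
Proof.
  intros H B. apply Rnot_lt_le. intros L.
  destruct (H (Cmod (l - a) - M)) as [K HK]; [lra|].
  specialize (HK (max N K) ltac:(lia)). specialize (B (max N K) ltac:(lia)).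
  set (x := u (max N K)) in *.
  generalize (Cmod_triangle (l - x) (x - a)). replace (l - x + (x - a))%C with (l - a)%C by ring.
  rewrite (Cmod_minus_sym l x). lra.
Qed.

Lemma Clim_unique u l m : Clim u l -> Clim u m -> l = m.
Proof.
  intros H K. assert (E : (l - m = 0)%C).
  { apply Cmod_eq_0. apply Rle_antisym; [|apply Cmod_ge_0].
    apply Rnot_lt_le. intros L. destruct (K (Cmod (l - m) / 2)) as [N HN]; [lra|].
    assert (Cmod (l - m) <= Cmod (l - m) / 2); [|lra].
    apply (Clim_Cmod_le u l m _ N H). intros n Hn. left; apply HN; exact Hn. }
  replace l with (l - m + m)%C by ring. rewrite E; ring.
Qed.

Lemma Clim_geom u l M x : 0 <= x < 1 -> (forall n, Cmod (u n - l) <= M * x ^ n) -> Clim u l.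
Proof.
  intros Hx H eps Heps.
  assert (M0 : 0 <= M). { generalize (H 0%nat) (Cmod_ge_0 (u 0%nat - l)). simpl. lra. }
  destruct (pow_lt_1_zero x) with (y := eps / (M + 1)) as [N HN].
  - rewrite Rabs_pos_eq; lra.
  - apply Rdiv_lt_0_compat; lra.
  - exists N. intros n Hn. eapply Rle_lt_trans; [apply H|].
    specialize (HN n Hn). rewrite Rabs_pos_eq in HN by (apply pow_le; lra).
    apply Rlt_div_r in HN; [|lra]. assert (0 <= x ^ n) by (apply pow_le; lra). nra.
Qed.

Lemma Csum_geom_tail c M x : 0 <= x < 1 -> (forall n, Cmod (c n) <= M * x ^ n) ->
  forall n k, Cmod (Csum c (n + k)%nat - Csum c n) <= M * x ^ n / (1 - x).
Proof.
  intros Hx H n k.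
  assert (M0 : 0 <= M). { generalize (H 0%nat) (Cmod_ge_0 (c 0%nat)). simpl. lra. }
  assert (K : Cmod (Csum c (n + k)%nat - Csum c n) <= M * x ^ n * (1 - x ^ k) / (1 - x)).
  { induction k as [|k IH].
    - rewrite Nat.add_0_r. replace (Csum c n - Csum c n)%C with (RtoC 0) by ring. rewrite Cmod_0.
      simpl. right; field; lra.
    - rewrite Nat.add_succ_r. simpl Csum.
      replace (Csum c (n + k)%nat + c (n + k)%nat - Csum c n)%C with ((Csum c (n + k)%nat - Csum c n) + c (n + k)%nat)%C by ring.
      eapply Rle_trans; [apply Cmod_triangle|].
      eapply Rle_trans; [apply Rplus_le_compat; [exact IH|apply H]|].
      rewrite pow_add. simpl. right. field. lra. }
  eapply Rle_trans; [exact K|]. unfold Rdiv. apply Rmult_le_compat_r.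
  - left. apply Rinv_0_lt_compat; lra.
  - assert (0 <= x ^ n) by (apply pow_le; lra). assert (0 <= x ^ k) by (apply pow_le; lra).
    assert (0 <= M * x ^ n) by (apply Rmult_le_pos; lra). nra.
Qed.

Lemma Csum_geom_bound c M x n : 0 <= x < 1 -> (forall n, Cmod (c n) <= M * x ^ n) ->
  Cmod (Csum c n) <= M / (1 - x).
Proof.
  intros Hx H. generalize (Csum_geom_tail c M x Hx H 0 n). simpl.
  replace (Csum c n - 0)%C with (Csum c n) by ring. rewrite Rmult_1_r. auto.
Qed.

Definition Cseries (c : nat -> C) : C := (Series (fun n => Re (c n)), Series (fun n => Im (c n))).

Lemma Csum_sum_n c n : Csum c (S n) = (sum_n (fun k => Re (c k)) n, sum_n (fun k => Im (c k)) n).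
Proof.
  induction n as [|n IH].
  - simpl. rewrite !sum_O. apply Ceq_ReIm; unfold Re, Im; simpl; ring.
  - change (Csum c (S (S n))) with (Csum c (S n) + c (S n))%C. rewrite IH, !sum_Sn. apply Ceq_ReIm; reflexivity.
Qed.

Lemma Cseries_correct c M x : 0 <= x < 1 -> (forall n, Cmod (c n) <= M * x ^ n) -> Clim (Csum c) (Cseries c).
Proof.
  intros Hx H.
  assert (G : ex_series (fun n => M * x ^ n)).
  { apply (ex_series_scal (V := R_NormedModule)). apply ex_series_geom. rewrite Rabs_pos_eq; lra. }
  assert (SR : ex_series (fun n => Re (c n))).
  { apply (ex_series_le (V := R_CompleteNormedModule) _ (fun n => M * x ^ n)); [|exact G].
    intros n. eapply Rle_trans; [apply re_le_Cmod|apply H]. }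
  assert (SI : ex_series (fun n => Im (c n))).
  { apply (ex_series_le (V := R_CompleteNormedModule) _ (fun n => M * x ^ n)); [|exact G].
    intros n. eapply Rle_trans; [apply im_le_Cmod|apply H]. }
  assert (LR : is_lim_seq (sum_n (fun n => Re (c n))) (Series (fun n => Re (c n)))) by exact (Series_correct _ SR).
  assert (LI : is_lim_seq (sum_n (fun n => Im (c n))) (Series (fun n => Im (c n)))) by exact (Series_correct _ SI).
  apply is_lim_seq_spec in LR. apply is_lim_seq_spec in LI.
  intros eps Heps. assert (He : 0 < eps / 2) by lra.
  destruct (LR (mkposreal _ He)) as [N1 H1]. destruct (LI (mkposreal _ He)) as [N2 H2]. simpl in H1, H2.
  exists (S (max N1 N2)). intros n Hn. destruct n as [|n]; [lia|]. rewrite Csum_sum_n.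
  eapply Rle_lt_trans; [apply Cmod_le_abs|]. rewrite re_minus, im_minus. simpl.
  specialize (H1 n ltac:(lia)). specialize (H2 n ltac:(lia)). lra.
Qed.

Lemma pow_quot a r n : r <> 0 -> (a / r) ^ n = a ^ n / r ^ n.
Proof. intros H. unfold Rdiv. rewrite Rpow_mult_distr, pow_inv. reflexivity. Qed.

Lemma INR_geom x n : 0 <= x < 1 -> INR n * x ^ n <= / (1 - x).
Proof.
  intros Hx. apply Rmult_le_reg_l with (1 - x); [lra|]. rewrite Rinv_r by lra.
  induction n as [|n IH]; [simpl; lra|].
  rewrite S_INR. simpl.
  assert (x ^ n <= 1) by (rewrite <- (pow1 n); apply pow_incr; lra).
  assert (0 <= x ^ n) by (apply pow_le; lra).
  replace ((1 - x) * ((INR n + 1) * (x * x ^ n)))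
    with (x * ((1 - x) * (INR n * x ^ n)) + (1 - x) * (x * x ^ n)) by ring.
  assert (x * ((1 - x) * (INR n * x ^ n)) <= x * 1) by (apply Rmult_le_compat_l; lra).
  assert ((1 - x) * (x * x ^ n) <= (1 - x) * 1) by (apply Rmult_le_compat_l; nra). lra.
Qed.

(** With x = y^2 and y = v^2, two factors v^n absorb n^2 and the remaining y^n keeps a geometric
    decay. *)
Lemma INR2_geom x : 0 <= x < 1 -> exists K y, 0 <= K /\ 0 <= y < 1 /\
  forall n, INR n ^ 2 * x ^ n <= K * y ^ n.
Proof.
  intros Hx. set (y := sqrt x). set (v := sqrt y).
  assert (Ey : x = y * y) by (unfold y; rewrite sqrt_sqrt; lra).
  assert (Hy : 0 <= y < 1).
  { split; [apply sqrt_pos|]. unfold y. rewrite <- sqrt_1. apply sqrt_lt_1_alt; lra. }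
  assert (Ev : y = v * v) by (unfold v; rewrite sqrt_sqrt; lra).
  assert (Hv : 0 <= v < 1).
  { split; [apply sqrt_pos|]. unfold v. rewrite <- sqrt_1. apply sqrt_lt_1_alt; lra. }
  exists (/ (1 - v) * / (1 - v)), y. split; [|split; [exact Hy|]].
  - assert (0 < / (1 - v)) by (apply Rinv_0_lt_compat; lra). nra.
  - intros n. rewrite Ey, Rpow_mult_distr.
    assert (E2 : y ^ n = v ^ n * v ^ n) by (rewrite Ev at 1; apply Rpow_mult_distr).
    replace (INR n ^ 2 * (y ^ n * y ^ n)) with ((INR n * v ^ n) * (INR n * v ^ n) * y ^ n) by (rewrite E2; ring).
    apply Rmult_le_compat_r; [apply pow_le; lra|].
    assert (B := INR_geom v n Hv).
    assert (0 <= INR n * v ^ n) by (apply Rmult_le_pos; [apply pos_INR|apply pow_le; lra]).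
    apply Rmult_le_compat; assumption.
Qed.

(** * Power series *)

Definition ps_deriv_coef (a : nat -> C) (n : nat) : C := (INR (S n) * a (S n))%C.

(** Radius of convergence at least 1, in the shape in which Cauchy's estimates on circles deliver
    it. *)
Definition radius_ge1 (a : nat -> C) : Prop :=
  forall r, 0 < r < 1 -> exists M, 0 <= M /\ forall n, Cmod (a n) * r ^ n <= M.

(** Induction on n. Writing s^n / s^2 avoids the exponent n - 2, and for n = 0 the truncated
    exponent n - 1 is multiplied by INR 0. *)
Lemma pow_remainder (w h : C) s n : 0 < s -> Cmod w <= s -> Cmod (w + h) <= s ->
  Cmod ((w + h) ^ n - w ^ n - INR n * w ^ (n - 1) * h) <= INR n ^ 2 * s ^ n * (Cmod h ^ 2 / s ^ 2).
Proof.
  intros Hs Hw Hwh. assert (P := Cmod_ge_0 h).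
  induction n as [|n IH].
  - simpl. replace (1 - 1 - 0 * 1 * h)%C with (RtoC 0) by ring. rewrite Cmod_0. lra.
  - replace ((w + h) ^ S n - w ^ S n - INR (S n) * w ^ (S n - 1) * h)%C with
      ((w + h) * ((w + h) ^ n - w ^ n - INR n * w ^ (n - 1) * h) + INR n * w ^ (n - 1) * (h * h))%C.
    2: { rewrite S_INR, RtoC_plus. destruct n as [|n].
         - simpl. ring.
         - replace (S (S n) - 1)%nat with (S n) by lia. replace (S n - 1)%nat with n by lia. simpl. ring. }
    eapply Rle_trans; [apply Cmod_triangle|]. rewrite !Cmod_mult, Cmod_R, Cmod_pow, Rabs_pos_eq by apply pos_INR.
    assert (B1 : Cmod (w + h) * Cmod ((w + h) ^ n - w ^ n - INR n * w ^ (n - 1) * h) <=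
      s * (INR n ^ 2 * s ^ n * (Cmod h ^ 2 / s ^ 2))).
    { apply Rmult_le_compat; try apply Cmod_ge_0; assumption. }
    assert (B2 : INR n * Cmod w ^ (n - 1) * (Cmod h * Cmod h) <= INR n * (s ^ S n * (Cmod h ^ 2 / s ^ 2))).
    { rewrite Rmult_assoc. destruct n as [|n]; [simpl; lra|].
      apply Rmult_le_compat_l; [apply pos_INR|].
      replace (S n - 1)%nat with n by lia.
      replace (s ^ S (S n) * (Cmod h ^ 2 / s ^ 2)) with (s ^ n * (Cmod h * Cmod h)) by (simpl; field; lra).
      apply Rmult_le_compat_r; [nra|]. apply pow_incr; split; [apply Cmod_ge_0|assumption]. }
    rewrite S_INR.
    assert (Q : 0 <= s ^ S n * (Cmod h ^ 2 / s ^ 2)).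
    { apply Rmult_le_pos; [apply pow_le; lra|]. apply Rmult_le_pos; [apply pow_le; exact P|].
      left; apply Rinv_0_lt_compat, pow_lt; exact Hs. }
    replace (s * (INR n ^ 2 * s ^ n * (Cmod h ^ 2 / s ^ 2))) with (INR n ^ 2 * (s ^ S n * (Cmod h ^ 2 / s ^ 2))) in B1 by (simpl; ring).
    generalize (pos_INR n). intros Hn. rewrite (Rmult_assoc ((INR n + 1) ^ 2)).
    set (T := s ^ S n * (Cmod h ^ 2 / s ^ 2)) in *.
    assert (0 <= INR n * T) by (apply Rmult_le_pos; assumption).
    replace ((INR n + 1) ^ 2 * T) with (INR n ^ 2 * T + INR n * T + (INR n * T + T)) by ring. lra.
Qed.

Lemma ps_term_bound a r w : radius_ge1 a -> Cmod w < r -> r < 1 ->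
  exists M, 0 <= M /\ forall n, Cmod (a n * w ^ n) <= M * (Cmod w / r) ^ n.
Proof.
  intros H Hw Hr. assert (P := Cmod_ge_0 w). destruct (H r) as [M [M0 HM]]; [lra|].
  exists M; split; [exact M0|]. intros n. rewrite Cmod_mult, Cmod_pow, pow_quot by lra.
  assert (0 < r ^ n) by (apply pow_lt; lra). assert (0 <= Cmod w ^ n) by (apply pow_le; lra).
  replace (M * (Cmod w ^ n / r ^ n)) with (M / r ^ n * Cmod w ^ n) by (field; lra).
  apply Rmult_le_compat_r; [assumption|]. apply Rle_div_r; [assumption|apply HM].
Qed.

Lemma ps_converges a w : radius_ge1 a -> Cmod w < 1 ->
  Clim (Csum (fun n => a n * w ^ n)%C) (Cseries (fun n => a n * w ^ n)%C).
Proof.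
  intros H Hw. assert (P := Cmod_ge_0 w).
  destruct (ps_term_bound a ((Cmod w + 1) / 2) w H) as [M [M0 HM]]; try lra.
  apply Cseries_correct with (M := M) (x := Cmod w / ((Cmod w + 1) / 2)); [|exact HM].
  split; [apply Rdiv_le_0_compat; lra|]. apply Rlt_div_l; lra.
Qed.

Lemma radius_ge1_deriv a : radius_ge1 a -> radius_ge1 (ps_deriv_coef a).
Proof.
  intros H r Hr. set (s := (r + 1) / 2). destruct (H s) as [M [M0 HM]]; [unfold s; lra|].
  assert (Hx : 0 <= r / s < 1).
  { split; [apply Rdiv_le_0_compat; unfold s; lra|]. apply Rlt_div_l; unfold s; lra. }
  exists (/ (1 - r / s) * M / r).
  assert (0 < / (1 - r / s)) by (apply Rinv_0_lt_compat; lra).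
  split.
  - apply Rdiv_le_0_compat; [|lra]. apply Rmult_le_pos; lra.
  - intros n. unfold ps_deriv_coef. rewrite Cmod_mult, Cmod_R, Rabs_pos_eq by apply pos_INR.
    apply (proj1 (Rle_div_r _ (/ (1 - r / s) * M) r ltac:(lra))).
    assert (B := INR_geom (r / s) (S n) Hx). specialize (HM (S n)).
    assert (0 < s) by (unfold s; lra). assert (0 < s ^ S n) by (apply pow_lt; assumption).
    replace (INR (S n) * Cmod (a (S n)) * r ^ n * r) with ((INR (S n) * (r / s) ^ S n) * (Cmod (a (S n)) * s ^ S n)).
    + apply Rmult_le_compat; try assumption.
      * apply Rmult_le_pos; [apply pos_INR|apply pow_le; lra].
      * apply Rmult_le_pos; [apply Cmod_ge_0|lra].
    + rewrite pow_quot by lra. simpl pow in *. field. split; [apply pow_nonzero; lra|lra].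
Qed.

(** Summing the second-order remainders of the powers bounds the error of the termwise derivative by
    a constant times |h|^2. *)
Lemma ps_cder a w : radius_ge1 a -> Cmod w < 1 ->
  cder (fun z => Cseries (fun n => a n * z ^ n)%C) w (Cseries (fun n => ps_deriv_coef a n * w ^ n)%C).
Proof.
  intros H Hw. assert (P := Cmod_ge_0 w).
  set (s := (1 + Cmod w) / 2). set (r := (1 + s) / 2).
  assert (Hs : Cmod w < s < 1) by (unfold s; lra). assert (Hr : s < r < 1) by (unfold r; lra).
  destruct (H r) as [M [M0 HM]]; [lra|].
  destruct (INR2_geom (s / r)) as [K [y [K0 [Hy HK]]]].
  { split; [apply Rdiv_le_0_compat; lra|]. apply Rlt_div_l; lra. }
  (* M bounds |a_n| r^n, and n^2 (s / r)^n <= K y^n sums to at most K / (1 - y). *)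
  set (B := M * K / s ^ 2 / (1 - y)).
  assert (HB : 0 <= B).
  { unfold B. apply Rdiv_le_0_compat; [|lra]. apply Rdiv_le_0_compat; [|apply pow_lt; lra]. apply Rmult_le_pos; assumption. }
  assert (Q : forall h, Cmod (w + h) < s ->
    Cmod (Cseries (fun n => a n * (w + h) ^ n)%C - Cseries (fun n => a n * w ^ n)%C
      - Cseries (fun n => ps_deriv_coef a n * w ^ n)%C * h) <= B * Cmod h ^ 2).
  { intros h Hh.
    assert (L1 := ps_converges a (w + h) H ltac:(lra)).
    assert (L2 := ps_converges a w H ltac:(lra)).
    assert (L3 := ps_converges (ps_deriv_coef a) w (radius_ge1_deriv a H) ltac:(lra)).
    assert (L4 : Clim (Csum (fun n => a n * (INR n * w ^ (n - 1)))%C) (Cseries (fun n => ps_deriv_coef a n * w ^ n)%C)).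
    { apply (Clim_incr _ _ 1). eapply Clim_ext; [|exact L3]. intros n.
      change (1 + n)%nat with (S n). rewrite Csum_S. change (INR 0) with 0%R.
      replace (a 0%nat * (0%R * w ^ (0 - 1)))%C with (RtoC 0) by ring. rewrite Cplus_0_l.
      apply Csum_ext. intros k _. unfold ps_deriv_coef. replace (S k - 1)%nat with k by lia. ring. }
    assert (L := Clim_minus _ _ _ _ (Clim_minus _ _ _ _ L1 L2) (Clim_scal h _ _ L4)).
    rewrite (Cmult_comm h) in L.
    match goal with |- Cmod ?X <= _ => replace X with (X - 0)%C by ring end.
    apply (Clim_Cmod_le _ _ _ _ 0%nat L). intros n _.
    match goal with |- Cmod ?X <= _ => replace X with
      (Csum (fun k => a k * ((w + h) ^ k - w ^ k - INR k * w ^ (k - 1) * h))%C n) end.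
    2: { rewrite (Csum_ext _ (fun k => (a k * (w + h) ^ k + (-1) * (a k * w ^ k)) + (- h) * (a k * (INR k * w ^ (k - 1))))%C)
           by (intros; ring).
         rewrite !Csum_plus, !Csum_scal. ring. }
    replace (B * Cmod h ^ 2) with ((M * K / s ^ 2 * Cmod h ^ 2) / (1 - y)) by (unfold B; field; lra).
    apply Csum_geom_bound; [exact Hy|]. intros k. rewrite Cmod_mult.
    eapply Rle_trans; [apply Rmult_le_compat_l; [apply Cmod_ge_0|apply (pow_remainder w h s k); lra]|].
    specialize (HM k). specialize (HK k). rewrite pow_quot in HK by lra.
    assert (0 < r ^ k) by (apply pow_lt; lra). assert (0 < s ^ 2) by (apply pow_lt; lra).
    replace (Cmod (a k) * (INR k ^ 2 * s ^ k * (Cmod h ^ 2 / s ^ 2))) with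
      ((Cmod (a k) * r ^ k) * (INR k ^ 2 * (s ^ k / r ^ k)) * (Cmod h ^ 2 / s ^ 2)) by (field; lra).
    replace (M * K / s ^ 2 * Cmod h ^ 2 * y ^ k) with (M * (K * y ^ k) * (Cmod h ^ 2 / s ^ 2)) by (field; lra).
    apply Rmult_le_compat_r.
    - apply Rdiv_le_0_compat; [apply pow_le, Cmod_ge_0|assumption].
    - apply Rmult_le_compat; try assumption.
      + apply Rmult_le_pos; [apply Cmod_ge_0|lra].
      + apply Rmult_le_pos; [apply pow_le, pos_INR|]. apply Rdiv_le_0_compat; [apply pow_le; lra|assumption]. }
  intros eps Heps. exists (Rmin (s - Cmod w) (eps / (B + 1))). split.
  - apply Rmin_pos; [lra|]. apply Rdiv_lt_0_compat; lra.
  - intros z Hz.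
    assert (Hz1 := Rlt_le_trans _ _ _ Hz (Rmin_l _ _)). assert (Hz2 := Rlt_le_trans _ _ _ Hz (Rmin_r _ _)).
    apply Rlt_div_r in Hz2; [|lra].
    specialize (Q (z - w)%C). replace (w + (z - w))%C with z in Q by ring.
    eapply Rle_trans; [apply Q|].
    + generalize (Cmod_triangle w (z - w)). replace (w + (z - w))%C with z by ring. lra.
    + generalize (Cmod_ge_0 (z - w)). intros. simpl. nra.
Qed.

(** * Taylor coefficients of holomorphic functions on the unit disk *)

Lemma RtoC_neq0 r : r <> 0 -> RtoC r <> 0%C.
Proof. intros H E. apply RtoC_inj in E. exact (H E). Qed.

Lemma circle_neq0 r t : 0 < r -> (r * cis t)%C <> 0%C.
Proof. intros H. apply Cmult_neq_0; [apply RtoC_neq0; lra|apply cis_neq0]. Qed.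

Lemma Cminus_neq0 (z w : C) : z <> w -> (z - w)%C <> 0%C.
Proof. intros N E. apply N. replace z with (z - w + w)%C by ring. rewrite E; ring. Qed.

Lemma Cmod_eq0_of_small (z : C) : (forall eps, 0 < eps -> Cmod z <= eps) -> z = 0%C.
Proof.
  intros H. apply Cmod_eq_0. apply Rle_antisym; [|apply Cmod_ge_0].
  apply Rnot_lt_le. intros L. specialize (H (Cmod z / 2) ltac:(lra)). lra.
Qed.

(** Shrinking the circle does not change the mean, and q tends to 0 at the centre. One point w
    inside may be exceptional if q stays bounded near it; for w = 0 the condition at the centre
    already covers it. *)
Lemma circle_mean_zero (q : C -> C) (w : C) r : 0 < r -> Cmod w < r ->
  (forall z, 0 < Cmod z <= r -> z <> w -> exists l, cder q z l) ->
  (w <> 0%C -> exists M del, 0 < del /\ forall z, Cmod (z - w) < del -> z <> w -> Cmod (q z) <= M) ->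
  (forall eps, 0 < eps -> exists d, 0 < d /\ forall z, 0 < Cmod z < d -> Cmod (q z) < eps) ->
  mean (fun t => q (r * cis t)%C) = 0%C.
Proof.
  intros Hr Hw H HM H0. apply Cmod_eq0_of_small. intros eps Heps.
  destruct (H0 eps Heps) as [d [Hd Hq]].
  (* For w <> 0 the small circle must have radius below |w|, so that w lies strictly between the two
     circles. *)
  set (r1 := Rmin (d / 2) (if Ceq_dec w 0 then r / 2 else Rmin (r / 2) (Cmod w / 2))).
  assert (Hr1 : 0 < r1 /\ r1 < d /\ r1 < r /\ (w <> 0%C -> r1 < Cmod w)).
  { unfold r1. generalize (Rmin_l (d / 2) (if Ceq_dec w 0 then r / 2 else Rmin (r / 2) (Cmod w / 2)))
      (Rmin_r (d / 2) (if Ceq_dec w 0 then r / 2 else Rmin (r / 2) (Cmod w / 2))).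
    destruct (Ceq_dec w 0) as [e|n]; intros A B.
    - split; [apply Rmin_pos; lra|]. split; [lra|]. split; [lra|]. intros N; contradiction.
    - assert (0 < Cmod w) by (apply Cmod_gt_0; exact n).
      generalize (Rmin_l (r / 2) (Cmod w / 2)) (Rmin_r (r / 2) (Cmod w / 2)). intros.
      split; [repeat apply Rmin_pos; lra|]. lra. }
  destruct Hr1 as [R1 [R2 [R3 R4]]].
  assert (E : mean (fun t => q (r1 * cis t)%C) = mean (fun t => q (r * cis t)%C)).
  { destruct (Ceq_dec w 0) as [e|n].
    - apply circle_mean_const; [exact R1|exact R3|]. intros z Hz. apply H; [lra|].
      intro E. subst. rewrite Cmod_0 in Hz. lra.
    - destruct (HM n) as [M [del [Hdel HB]]].
      apply (circle_mean_const_except q r1 r w M del); auto. intros z Hz. apply H. lra. }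
  rewrite <- E. apply Cmod_mean_le.
  - intros t. apply contC_circle. destruct (H (r1 * cis t)%C) as [l Hl].
    + rewrite Cmod_circle; lra.
    + intro E'. destruct (Ceq_dec w 0) as [e|n].
      * rewrite e in E'. revert E'. apply circle_neq0; exact R1.
      * specialize (R4 n). rewrite <- E', Cmod_circle in R4; lra.
    + eapply cder_cont; exact Hl.
  - intros t _. left. apply Hq. rewrite Cmod_circle; lra.
Qed.

Lemma Ccontinuous_circle R0 (f : C -> C) r : hol R0 f -> 0 <= r < R0 -> Ccontinuous (fun t => f (r * cis t)%C).
Proof.
  intros H Hr t. apply contC_circle. apply (hol_cont R0); [exact H|]. rewrite Cmod_circle; lra.
Qed.

Lemma Ccontinuous_cis r : Ccontinuous (fun t => r * cis t)%C.
Proof. intros t. apply contC_mult; [apply contC_const|apply contC_cis]. Qed.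

Lemma Ccontinuous_bounded F : Ccontinuous F -> exists M, forall t, 0 <= t <= 2 * PI -> Cmod (F t) <= M.
Proof.
  intros H. destruct (continuity_ab_maj (fun t => Cmod (F t)) 0 (2 * PI)) as [Mx [HM _]].
  - generalize two_PI_pos; lra.
  - intros c _. apply continuity_pt_filterlim. apply continuous_Cmod, H.
  - exists (Cmod (F Mx)). exact HM.
Qed.

Lemma mean_hol_pow (f : C -> C) r n : hol 1 f -> 0 < r < 1 ->
  mean (fun t => f (r * cis t) * (r * cis t) ^ S n)%C = 0%C.
Proof.
  intros H Hr. apply (circle_mean_zero (fun z => f z * z ^ S n)%C 0 r).
  - lra.
  - rewrite Cmod_0; lra.
  - intros z Hz _. apply (hol_mult 1 f (fun z => z ^ S n)%C); [exact H| |lra].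
    apply (hol_pow 1 (fun z => z)), hol_id.
  - intros N; exfalso; apply N; reflexivity.
  - intros eps Heps.
    assert (K : contC (fun z => f z * z ^ S n)%C (RtoC 0)).
    { apply (hol_cont 1); [|rewrite Cmod_0; lra]. apply hol_mult; [exact H|]. apply (hol_pow 1 (fun z => z)), hol_id. }
    destruct (proj1 (locally_Cmod _ _) (proj1 (contC_eps _ _) K eps Heps)) as [d [Hd Hq]].
    exists d; split; [exact Hd|]. intros z Hz. specialize (Hq z).
    replace (z - 0)%C with z in Hq by ring.
    replace (f z * z ^ S n - f 0 * 0 ^ S n)%C with (f z * z ^ S n)%C in Hq by (simpl; ring).
    apply Hq; lra.
Qed.

Lemma mean_hol_value (f : C -> C) r : hol 1 f -> 0 < r < 1 -> mean (fun t => f (r * cis t)%C) = f 0%C.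
Proof.
  intros H Hr.
  assert (E : mean (fun t => f (r * cis t)%C - f 0)%C = 0%C).
  { apply (circle_mean_zero (fun z => f z - f 0)%C 0 r).
    - lra.
    - rewrite Cmod_0; lra.
    - intros z Hz _. apply (hol_minus 1 f (fun _ => f 0%C)); [exact H|apply hol_const|lra].
    - intros N; exfalso; apply N; reflexivity.
    - intros eps Heps.
      assert (K : contC f (RtoC 0)) by (apply (hol_cont 1); [exact H|rewrite Cmod_0; lra]).
      destruct (proj1 (locally_Cmod _ _) (proj1 (contC_eps _ _) K eps Heps)) as [d [Hd Hq]].
      exists d; split; [exact Hd|]. intros z Hz. apply Hq. replace (z - 0)%C with z by ring. lra. }
  rewrite mean_minus, mean_const in E.
  - replace (mean (fun t => f (r * cis t)%C)) with (mean (fun t => f (r * cis t)%C) - f 0 + f 0)%C by ring.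
    rewrite E; ring.
  - apply (Ccontinuous_circle 1); [exact H|lra].
  - intros t; apply contC_const.
Qed.

(** The constant function 2^(n+1) compensates the radius 1/2 in [mean_hol_pow]. *)
Lemma mean_cis_pow n : mean (fun t => cis t ^ S n)%C = 0%C.
Proof.
  assert (E := mean_hol_pow (fun _ => RtoC 2 ^ S n)%C (/ 2) n (hol_const 1 _) ltac:(lra)).
  rewrite <- E. apply mean_ext. intros t. rewrite <- Cpow_mult_l. f_equal.
  rewrite RtoC_inv by lra. field.
Qed.

Lemma mean_cis_pow_inv n : mean (fun t => / cis t ^ S n)%C = 0%C.
Proof.
  rewrite (mean_ext _ (fun t => Cconj (cis t ^ S n)))%C.
  - rewrite mean_conj, mean_cis_pow. { apply Ceq_ReIm; simpl; ring. }
    intros t. apply contC_pow, contC_cis.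
  - intros t. rewrite Cpow_conj, <- cis_inv, Cpow_inv; [reflexivity|apply cis_neq0].
Qed.

(** Cauchy's integral for the Taylor coefficient. The radius 1/2 is an arbitrary choice, by
    [coef_circle]. *)
Definition coef (f : C -> C) (n : nat) : C := mean (fun t => f ((/ 2)%R * cis t) / ((/ 2)%R * cis t) ^ n)%C.

Lemma coef_circle f r n : hol 1 f -> 0 < r < 1 -> mean (fun t => f (r * cis t) / (r * cis t) ^ n)%C = coef f n.
Proof.
  intros H Hr. unfold coef.
  assert (K : forall z, 0 < Cmod z < 1 -> exists l, cder (fun z => f z / z ^ n)%C z l).
  { intros z Hz. destruct (H z) as [l Hl]; [lra|].
    destruct (hol_pow 1 (fun z => z) n (hol_id 1) z) as [m Hm]; [lra|].
    eexists. apply cder_mult; [exact Hl|]. apply cder_inv; [|exact Hm].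
    apply Cpow_nz. apply Cmod_gt_0; lra. }
  destruct (Rtotal_order r (/ 2)) as [L|[E|L]].
  - apply (circle_mean_const (fun z => f z / z ^ n)%C); try lra. intros z Hz. apply K. lra.
  - rewrite E; reflexivity.
  - symmetry. apply (circle_mean_const (fun z => f z / z ^ n)%C); try lra. intros z Hz. apply K. lra.
Qed.

Lemma Ccontinuous_quot f r n : hol 1 f -> 0 < r < 1 -> Ccontinuous (fun t => f (r * cis t) / (r * cis t) ^ n)%C.
Proof.
  intros H Hr t. apply contC_div.
  - apply Cpow_nz, circle_neq0; lra.
  - apply (Ccontinuous_circle 1); [exact H|lra].
  - apply contC_pow, Ccontinuous_cis.
Qed.

Lemma coef_radius f : hol 1 f -> radius_ge1 (coef f).
Proof.
  intros H r Hr. destruct (Ccontinuous_bounded (fun t => f (r * cis t)%C)) as [M HM].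
  { apply (Ccontinuous_circle 1); [exact H|lra]. }
  assert (M0 : 0 <= M).
  { eapply Rle_trans; [|apply (HM 0)]; [apply Cmod_ge_0|generalize two_PI_pos; lra]. }
  exists M; split; [exact M0|]. intros n. rewrite <- (coef_circle f r n H Hr).
  assert (P : 0 < r ^ n) by (apply pow_lt; lra).
  apply (Rle_div_r _ _ _ P). apply Cmod_mean_le; [apply Ccontinuous_quot; assumption|].
  intros t Ht. rewrite Cmod_div, Cmod_pow, Cmod_circle by (try lra; apply Cpow_nz, circle_neq0; lra).
  apply Rmult_le_compat_r; [left; apply Rinv_0_lt_compat; exact P|apply HM; exact Ht].
Qed.

(** Since z / (z - w) = 1 + w / (z - w), it remains to see that the last term has mean 0: its mean
    does not depend on the radius and tends to 0 as the radius grows. *)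
Lemma cauchy_kernel_mean (w : C) r : Cmod w < r -> 0 < r ->
  mean (fun t => (r * cis t) / (r * cis t - w))%C = 1%C.
Proof.
  intros Hw Hr.
  assert (Nz : forall r' z, Cmod w < r' -> r' <= Cmod z -> (z - w)%C <> 0%C).
  { intros r' z A B. apply Cminus_neq0. intro E. subst. lra. }
  assert (Ct : forall r', Cmod w < r' -> 0 < r' -> Ccontinuous (fun t => w / (r' * cis t - w))%C).
  { intros r' A B t. apply contC_div; [|apply contC_const|].
    - apply (Nz r' _ A). rewrite Cmod_circle; lra.
    - apply contC_minus; [apply Ccontinuous_cis|apply contC_const]. }
  assert (E : mean (fun t => w / (r * cis t - w))%C = 0%C).
  { apply Cmod_eq0_of_small. intros eps Heps.
    (* Chosen so that r' - |w| >= |w| / eps, which makes the integrand at most eps. *)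
    set (r' := r + Cmod w + Cmod w / eps). assert (P := Cmod_ge_0 w).
    assert (0 <= Cmod w / eps) by (apply Rdiv_le_0_compat; lra).
    destruct (Req_dec (Cmod w) 0) as [Z|NZ].
    - apply Cmod_mean_le; [apply Ct; assumption|]. intros t _. apply Cmod_eq_0 in Z. subst w.
      replace (0 / (r * cis t - 0))%C with (RtoC 0) by (unfold Cdiv; ring). rewrite Cmod_0; lra.
    - rewrite (circle_mean_const (fun z => w / (z - w))%C r r').
      + apply Cmod_mean_le; [apply Ct; unfold r'; lra|]. intros t _.
        assert (N : (r' * cis t - w)%C <> 0%C) by (apply (Nz r'); [unfold r'; lra|rewrite Cmod_circle; unfold r'; lra]).
        rewrite Cmod_div by exact N.
        assert (L : r' - Cmod w <= Cmod (r' * cis t - w)).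
        { generalize (Cmod_triangle' (r' * cis t) w). rewrite Cmod_circle by (unfold r'; lra). lra. }
        assert (0 < Cmod (r' * cis t - w)) by (apply Cmod_gt_0; exact N).
        apply Rle_div_l; [lra|]. apply Rle_trans with (eps * (Cmod w / eps)).
        * right; field; lra.
        * apply Rmult_le_compat_l; [lra|]. unfold r' in *. lra.
      + exact Hr.
      + unfold r'; lra.
      + intros z Hz. eexists. apply cder_mult; [apply cder_const|]. apply cder_inv.
        * apply (Nz r); lra.
        * apply cder_minus; [apply cder_id|apply cder_const]. }
  rewrite (mean_ext _ (fun t => 1 + w / (r * cis t - w))%C).
  - rewrite mean_plus, mean_const, E; [ring|intros t; apply contC_const|apply Ct; assumption].
  - intros t. field. apply (Nz r); [exact Hw|rewrite Cmod_circle; lra].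
Qed.

(** After subtracting f w the integrand (f z - f w) z / (z - w) is bounded near w and tends to 0 at
    the centre, so [circle_mean_zero] applies; the rest is the mean of the kernel. *)
Theorem cauchy_formula f (w : C) r : hol 1 f -> Cmod w < r -> 0 < r < 1 ->
  mean (fun t => f (r * cis t) * ((r * cis t) / (r * cis t - w)))%C = f w.
Proof.
  intros H Hw Hr.
  assert (Nz : forall t, (r * cis t - w)%C <> 0%C).
  { intros t. apply Cminus_neq0. intro E. rewrite <- E, Cmod_circle in Hw; lra. }
  assert (E : mean (fun t => (f (r * cis t) - f w) * ((r * cis t) / (r * cis t - w)))%C = 0%C).
  { apply (circle_mean_zero (fun z => (f z - f w) * (z / (z - w)))%C w r).
    - lra.
    - exact Hw.
    - intros z Hz N. destruct (H z) as [l Hl]; [lra|]. eexists.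
      apply cder_mult; [apply cder_minus; [exact Hl|apply cder_const]|].
      apply cder_mult; [apply cder_id|]. apply cder_inv; [apply Cminus_neq0; exact N|].
      apply cder_minus; [apply cder_id|apply cder_const].
    - intros N. destruct (H w) as [l Hl]; [lra|]. destruct (Hl 1) as [d [Hd HB]]; [lra|].
      exists ((Cmod l + 1) * (Cmod w + 1)), (Rmin d 1). split; [apply Rmin_pos; lra|].
      intros z Hz Nz'. assert (Hz1 := Rlt_le_trans _ _ _ Hz (Rmin_l _ _)). assert (Hz2 := Rlt_le_trans _ _ _ Hz (Rmin_r _ _)).
      specialize (HB z Hz1). apply Cminus_neq0 in Nz'.
      replace ((f z - f w) * (z / (z - w)))%C with ((f z - f w) / (z - w) * z)%C by (field; exact Nz').
      rewrite Cmod_mult. apply Rmult_le_compat; try apply Cmod_ge_0.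
      + rewrite Cmod_div by exact Nz'. apply Rle_div_l; [apply Cmod_gt_0; exact Nz'|].
        generalize (Cmod_triangle (f z - f w - l * (z - w)) (l * (z - w))).
        replace (f z - f w - l * (z - w) + l * (z - w))%C with (f z - f w)%C by ring.
        rewrite (Cmod_mult l). lra.
      + generalize (Cmod_triangle' z w). lra.
    - intros eps Heps. destruct (Ceq_dec w 0) as [e|n].
      + assert (K : contC f (RtoC 0)) by (apply (hol_cont 1); [exact H|rewrite Cmod_0; lra]).
        destruct (proj1 (locally_Cmod _ _) (proj1 (contC_eps _ _) K eps Heps)) as [d [Hd Hq]].
        exists d; split; [exact Hd|]. intros z Hz. subst w.
        replace ((f z - f 0) * (z / (z - 0)))%C with (f z - f 0)%C.
        * apply Hq. replace (z - 0)%C with z by ring. lra.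
        * field. apply Cmod_gt_0. replace (z - 0)%C with z by ring. lra.
      + assert (K : contC (fun z => (f z - f w) * (z / (z - w)))%C (RtoC 0)).
        { apply contC_mult.
          - apply contC_minus; [|apply contC_const]. apply (hol_cont 1); [exact H|rewrite Cmod_0; lra].
          - apply contC_div; [|apply contC_id|apply contC_minus; [apply contC_id|apply contC_const]].
            apply Cminus_neq0. intro E; apply n; rewrite E; reflexivity. }
        destruct (proj1 (locally_Cmod _ _) (proj1 (contC_eps _ _) K eps Heps)) as [d [Hd Hq]].
        exists d; split; [exact Hd|]. intros z Hz. specialize (Hq z).
        replace (z - 0)%C with z in Hq by ring.
        replace ((f z - f w) * (z / (z - w)) - (f 0 - f w) * (0 / (0 - w)))%C with ((f z - f w) * (z / (z - w)))%C in Hq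
          by (unfold Cdiv; ring).
        apply Hq; lra. }
  rewrite (mean_ext _ (fun t => f (r * cis t) * ((r * cis t) / (r * cis t - w)) - f w * ((r * cis t) / (r * cis t - w)))%C) in E
    by (intros; ring).
  assert (Ck : Ccontinuous (fun t => (r * cis t) / (r * cis t - w))%C).
  { intros t. apply contC_div; [apply Nz|apply Ccontinuous_cis|].
    apply contC_minus; [apply Ccontinuous_cis|apply contC_const]. }
  assert (Cf := Ccontinuous_circle 1 f r H ltac:(lra)).
  rewrite mean_minus, mean_scal, cauchy_kernel_mean in E; try assumption; try lra.
  - match goal with |- ?X = _ => replace X with (X - f w * 1 + f w)%C by ring end. rewrite E; ring.
  - intros t. apply contC_mult; [apply Cf|apply Ck].
  - intros t. apply contC_mult; [apply contC_const|apply Ck].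
Qed.

Lemma geom_kernel (z w : C) N : z <> 0%C -> (z - w)%C <> 0%C ->
  (z / (z - w) = Csum (fun n => w ^ n / z ^ n) N + w ^ N / z ^ N * (z / (z - w)))%C.
Proof.
  intros Hz Hw. induction N as [|N IH].
  - simpl. field. exact Hw.
  - rewrite IH at 1. simpl. field. repeat split; try assumption. apply Cpow_nz; exact Hz.
Qed.

Lemma Ccontinuous_Csum (F : nat -> R -> C) N : (forall n, Ccontinuous (F n)) -> Ccontinuous (fun t => Csum (fun n => F n t) N).
Proof.
  intros H. induction N as [|N IH]; intros t; simpl; [apply contC_const|].
  apply contC_plus; [apply IH|apply H].
Qed.

Lemma mean_Csum (F : nat -> R -> C) N : (forall n, Ccontinuous (F n)) ->
  mean (fun t => Csum (fun n => F n t) N) = Csum (fun n => mean (F n)) N.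
Proof.
  intros H. induction N as [|N IH]; simpl; [apply mean_const|].
  rewrite mean_plus, IH; [reflexivity|apply Ccontinuous_Csum; exact H|apply H].
Qed.

Theorem taylor f (w : C) : hol 1 f -> Cmod w < 1 -> Clim (Csum (fun n => coef f n * w ^ n)%C) (f w).
Proof.
  intros H Hw. assert (P := Cmod_ge_0 w). set (r := (1 + Cmod w) / 2).
  assert (Hr : Cmod w < r < 1) by (unfold r; lra).
  assert (Nz : forall t, (r * cis t - w)%C <> 0%C).
  { intros t. apply Cminus_neq0. intro E.
    assert (Cmod w = r) by (rewrite <- E; apply Cmod_circle; lra). lra. }
  assert (Cf := Ccontinuous_circle 1 f r H ltac:(lra)).
  destruct (Ccontinuous_bounded _ Cf) as [M HM].
  assert (M0 : 0 <= M).
  { eapply Rle_trans; [|apply (HM 0)]; [apply Cmod_ge_0|generalize two_PI_pos; lra]. }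
  apply (Clim_geom _ _ (M * (r / (r - Cmod w))) (Cmod w / r)).
  { split; [apply Rdiv_le_0_compat; lra|]. apply Rlt_div_l; lra. }
  intros N. rewrite <- (cauchy_formula f w r) by (try assumption; lra).
  assert (Ck : Ccontinuous (fun t => (r * cis t) / (r * cis t - w))%C).
  { intros t. apply contC_div; [apply Nz|apply Ccontinuous_cis|].
    apply contC_minus; [apply Ccontinuous_cis|apply contC_const]. }
  assert (Cq : forall n, Ccontinuous (fun t => w ^ n * (f (r * cis t) / (r * cis t) ^ n))%C).
  { intros n t. apply contC_mult; [apply contC_const|]. apply Ccontinuous_quot; [exact H|lra]. }
  assert (Cr : Ccontinuous (fun t => f (r * cis t) * (w ^ N / (r * cis t) ^ N * ((r * cis t) / (r * cis t - w))))%C).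
  { intros t. apply contC_mult; [apply Cf|]. apply contC_mult; [|apply Ck].
    apply contC_div; [apply Cpow_nz, circle_neq0; lra|apply contC_const|apply contC_pow, Ccontinuous_cis]. }
  rewrite (mean_ext _ (fun t => Csum (fun n => w ^ n * (f (r * cis t) / (r * cis t) ^ n)) N
     + f (r * cis t) * (w ^ N / (r * cis t) ^ N * ((r * cis t) / (r * cis t - w))))%C).
  2: { intros t. rewrite (geom_kernel (r * cis t) w N) at 1 by (try apply Nz; apply circle_neq0; lra).
       rewrite Cmult_plus_distr_l. f_equal. rewrite <- Csum_scal. apply Csum_ext. intros n _. unfold Cdiv. ring. }
  rewrite mean_plus by (try assumption; apply (Ccontinuous_Csum (fun n t => w ^ n * (f (r * cis t) / (r * cis t) ^ n))%C), Cq).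
  rewrite (mean_Csum (fun n t => w ^ n * (f (r * cis t) / (r * cis t) ^ n))%C) by exact Cq.
  rewrite (Csum_ext (fun n => mean (fun t => w ^ n * (f (r * cis t) / (r * cis t) ^ n))%C) (fun n => coef f n * w ^ n)%C).
  2: { intros n _. rewrite mean_scal by (apply Ccontinuous_quot; [exact H|lra]). rewrite coef_circle by (try assumption; lra). ring. }
  match goal with |- Cmod (?A - (?A + ?B)) <= _ => replace (A - (A + B))%C with (- B)%C by ring end.
  rewrite Cmod_opp. apply Cmod_mean_le; [exact Cr|]. intros t Ht.
  rewrite (Cmod_mult (f _)), (Cmod_mult (_ / _)), Cmod_div by (apply Cpow_nz, circle_neq0; lra).
  rewrite Cmod_div by apply Nz. rewrite !Cmod_pow, !Cmod_circle, pow_quot by lra.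
  assert (Q : 0 < Cmod (r * cis t - w)) by (apply Cmod_gt_0, Nz).
  assert (Q1 : 0 <= Cmod w ^ N / r ^ N) by (apply Rdiv_le_0_compat; [apply pow_le|apply pow_lt]; lra).
  rewrite (Rmult_assoc M). apply Rmult_le_compat; try apply Cmod_ge_0.
  - apply Rmult_le_pos; [exact Q1|]. apply Rdiv_le_0_compat; lra.
  - apply HM; exact Ht.
  - rewrite (Rmult_comm (r / _)). apply Rmult_le_compat_l; [exact Q1|].
    apply Rmult_le_compat_l; [lra|]. apply Rinv_le_contravar; [lra|].
    generalize (Cmod_triangle' (r * cis t) w). rewrite Cmod_circle; lra.
Qed.

Lemma taylor_series f (w : C) : hol 1 f -> Cmod w < 1 -> f w = Cseries (fun n => coef f n * w ^ n)%C.
Proof.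
  intros H Hw. eapply Clim_unique; [apply taylor; assumption|].
  apply ps_converges; [apply coef_radius; exact H|exact Hw].
Qed.

Lemma ps_hol a : radius_ge1 a -> hol 1 (fun z => Cseries (fun n => a n * z ^ n)%C).
Proof. intros H z Hz. eexists. apply ps_cder; assumption. Qed.

Lemma mean_circle_pow_quot r k n : 0 < r -> mean (fun t => (r * cis t) ^ k / (r * cis t) ^ n)%C = if Nat.eq_dec k n then 1%C else 0%C.
Proof.
  intros Hr. destruct (Nat.eq_dec k n) as [e|ne].
  - rewrite <- (mean_const 1). apply mean_ext. intros t. subst. field. apply Cpow_nz, circle_neq0; exact Hr.
  - destruct (Nat.le_gt_cases k n) as [L|L].
    + assert (E : exists m, n = (k + S m)%nat) by (exists (n - k - 1)%nat; lia). destruct E as [m Em].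
      rewrite (mean_ext _ (fun t => / r ^ S m * / cis t ^ S m)%C).
      * rewrite mean_scal, mean_cis_pow_inv; [ring|]. intros t. apply contC_inv; [apply Cpow_nz, cis_neq0|apply contC_pow, contC_cis].
      * intros t. rewrite Em, Cpow_add_r, !Cpow_mult_l. field.
        repeat split; try apply Cpow_nz; try apply cis_neq0; apply RtoC_neq0; lra.
    + assert (E : exists m, k = (n + S m)%nat) by (exists (k - n - 1)%nat; lia). destruct E as [m Em].
      rewrite (mean_ext _ (fun t => r ^ S m * cis t ^ S m)%C).
      * rewrite mean_scal, mean_cis_pow; [ring|]. intros t. apply contC_pow, contC_cis.
      * intros t. rewrite Em, Cpow_add_r, !Cpow_mult_l. field.
        repeat split; try apply Cpow_nz; try apply cis_neq0; apply RtoC_neq0; lra.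
Qed.

Lemma Csum_delta a n N : (n < N)%nat -> Csum (fun k => a k * (if Nat.eq_dec k n then 1%C else 0%C))%C N = a n.
Proof.
  induction N as [|N IH]; intros L; [lia|]. simpl.
  destruct (Nat.eq_dec N n) as [e|ne].
  - subst. rewrite (Csum_ext _ (fun k => 0 * 0)%C).
    + rewrite Csum_scal. ring.
    + intros k Hk. destruct (Nat.eq_dec k n); [lia|ring].
  - rewrite IH by lia. ring.
Qed.

(** The partial sums converge uniformly on |z| = 1/2, hence their coefficients converge. The bound
    at radius 3/4 gives the ratio 2/3, as 1/2 = 3/4 * 2/3. *)
Lemma coef_ps a n : radius_ge1 a -> coef (fun z => Cseries (fun n => a n * z ^ n)%C) n = a n.
Proof.
  intros H. set (f := fun z => Cseries (fun n => a n * z ^ n)%C).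
  assert (Hf : hol 1 f) by (apply ps_hol; exact H).
  destruct (H (3 / 4)) as [M [M0 HM]]; [lra|].
  set (r := / 2).
  assert (T : forall z, Cmod z = r -> forall k, Cmod (a k * z ^ k) <= M * (2 / 3) ^ k).
  { intros z Hz k. rewrite Cmod_mult, Cmod_pow, Hz. unfold r. specialize (HM k).
    replace ((/ 2) ^ k) with ((3 / 4) ^ k * (2 / 3) ^ k) by (rewrite <- Rpow_mult_distr; f_equal; field).
    rewrite <- Rmult_assoc. apply Rmult_le_compat_r; [apply pow_le; lra|exact HM]. }
  (* Only partial sums of length at least n + 1 are considered: these contain the term of index n,
     so the sequence is constantly a n. *)
  assert (L : Clim (fun N => Csum (fun k => a k * (if Nat.eq_dec k n then 1%C else 0%C))%C (S n + N)) (coef f n)).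
  { apply (Clim_geom _ _ (M * (2 / 3) ^ S n / (1 - 2 / 3) / r ^ n) (2 / 3)); [lra|]. intros N.
    assert (Ct : forall k, Ccontinuous (fun t => a k * ((r * cis t) ^ k / (r * cis t) ^ n))%C).
    { intros k t. apply contC_mult; [apply contC_const|]. apply contC_div;
      [apply Cpow_nz, circle_neq0; unfold r; lra|apply contC_pow, Ccontinuous_cis|apply contC_pow, Ccontinuous_cis]. }
    assert (Cq : Ccontinuous (fun t => f (r * cis t) / (r * cis t) ^ n)%C) by (apply Ccontinuous_quot; [exact Hf|unfold r; lra]).
    rewrite (Csum_ext _ (fun k => mean (fun t => a k * ((r * cis t) ^ k / (r * cis t) ^ n))%C)).
    2: { intros k _. rewrite mean_scal, mean_circle_pow_quot; [reflexivity|unfold r; lra|].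
         intros t. apply contC_div;
         [apply Cpow_nz, circle_neq0; unfold r; lra|apply contC_pow, Ccontinuous_cis|apply contC_pow, Ccontinuous_cis]. }
    rewrite <- (mean_Csum (fun k t => a k * ((r * cis t) ^ k / (r * cis t) ^ n))%C) by exact Ct.
    change (coef f n) with (mean (fun t => f (r * cis t) / (r * cis t) ^ n)%C).
    rewrite <- mean_minus by (try exact Cq; apply (Ccontinuous_Csum (fun k t => a k * ((r * cis t) ^ k / (r * cis t) ^ n))%C), Ct).
    assert (Rp : 0 < r ^ n) by (apply pow_lt; unfold r; lra).
    apply Cmod_mean_le.
    - intros t. apply contC_minus; [apply (Ccontinuous_Csum (fun k t => a k * ((r * cis t) ^ k / (r * cis t) ^ n))%C), Ct|apply Cq].
    - intros t _.
      rewrite (Csum_ext _ (fun k => / (r * cis t) ^ n * (a k * (r * cis t) ^ k))%C) by (intros; unfold Cdiv; ring).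
      rewrite Csum_scal.
      match goal with |- Cmod (?A * ?B - ?D / _) <= _ => replace (A * B - D / (r * cis t) ^ n)%C with (A * (B - D))%C by (unfold Cdiv; ring) end.
      rewrite Cmod_mult, Cmod_inv, Cmod_pow, Cmod_circle by (try apply Cpow_nz, circle_neq0; unfold r; lra).
      replace (M * (2 / 3) ^ S n / (1 - 2 / 3) / r ^ n * (2 / 3) ^ N) with (/ r ^ n * (M * (2 / 3) ^ (S n + N) / (1 - 2 / 3)))
        by (rewrite pow_add; field; lra).
      apply Rmult_le_compat_l; [left; apply Rinv_0_lt_compat; exact Rp|].
      rewrite Cmod_minus_sym.
      assert (Hm : Cmod (r * cis t) = r) by (apply Cmod_circle; unfold r; lra).
      apply (Clim_Cmod_le (fun k => Csum (fun n => a n * (r * cis t) ^ n)%C (S n + N + k)) _ _ _ 0).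
      + apply Clim_decr. apply ps_converges; [exact H|rewrite Hm; unfold r; lra].
      + intros k _. apply Csum_geom_tail; [lra|]. apply T. exact Hm. }
  eapply Clim_unique; [exact L|]. eapply Clim_ext; [|apply Clim_const].
  intros N. symmetry. apply Csum_delta. lia.
Qed.

Lemma coef_ext f g n : (forall z, Cmod z < 1 -> f z = g z) -> coef f n = coef g n.
Proof. intros H. unfold coef. apply mean_ext. intros t. rewrite H; [reflexivity|]. rewrite Cmod_circle; lra. Qed.

Lemma hol_C_derive R0 f z : hol R0 f -> Cmod z < R0 -> cder f z (C_derive f z).
Proof. intros H Hz. destruct (H z Hz) as [l Hl]. rewrite (C_derive_cder f z l Hl). exact Hl. Qed.

Lemma C_derive_series f z : hol 1 f -> Cmod z < 1 ->
  C_derive f z = Cseries (fun n => ps_deriv_coef (coef f) n * z ^ n)%C.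
Proof.
  intros H Hz. apply C_derive_cder.
  apply (cder_ext_loc (fun z => Cseries (fun n => coef f n * z ^ n)%C)).
  - generalize (locally_disk 1 z Hz). apply filter_imp. intros w Hw. symmetry. apply taylor_series; assumption.
  - apply ps_cder; [apply coef_radius; exact H|exact Hz].
Qed.

Theorem hol_derive f : hol 1 f -> hol 1 (C_derive f).
Proof.
  intros H. apply (hol_ext 1 (fun z => Cseries (fun n => ps_deriv_coef (coef f) n * z ^ n)%C)).
  - intros z Hz. symmetry. apply C_derive_series; assumption.
  - apply ps_hol, radius_ge1_deriv, coef_radius, H.
Qed.

Lemma coef_derive f n : hol 1 f -> coef (C_derive f) n = (INR (S n) * coef f (S n))%C.
Proof.
  intros H. rewrite (coef_ext _ (fun z => Cseries (fun n => ps_deriv_coef (coef f) n * z ^ n)%C)).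
  - rewrite coef_ps; [reflexivity|]. apply radius_ge1_deriv, coef_radius, H.
  - intros z Hz. apply C_derive_series; assumption.
Qed.

Lemma coef_0 f : hol 1 f -> coef f 0 = f 0%C.
Proof.
  intros H. rewrite <- (mean_hol_value f (/ 2) H) by lra.
  apply mean_ext. intros t. simpl. field.
Qed.

Lemma coef_1 f : hol 1 f -> coef f 1 = C_derive f 0%C.
Proof.
  intros H. rewrite <- coef_0 by (apply hol_derive; exact H).
  rewrite coef_derive by exact H. simpl. ring.
Qed.

Lemma coef_plus f g n : hol 1 f -> hol 1 g -> coef (fun z => f z + g z)%C n = (coef f n + coef g n)%C.
Proof.
  intros H K. unfold coef. rewrite <- mean_plus by (apply Ccontinuous_quot; try assumption; lra).
  apply mean_ext. intros t. unfold Cdiv. ring.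
Qed.

Lemma coef_scal a f n : hol 1 f -> coef (fun z => a * f z)%C n = (a * coef f n)%C.
Proof.
  intros H. unfold coef. rewrite <- mean_scal by (apply Ccontinuous_quot; try assumption; lra).
  apply mean_ext. intros t. unfold Cdiv. ring.
Qed.

Lemma coef_mul_id_S f n : coef (fun z => z * f z)%C (S n) = coef f n.
Proof.
  unfold coef. apply mean_ext. intros t. simpl. field.
  assert (N := circle_neq0 (/ 2) t ltac:(lra)).
  split; [apply Cpow_nz; exact N|]. split; [apply cis_neq0|apply RtoC_neq0; lra].
Qed.

(** The quotient (f z - f 0) / z with its singularity at 0 removed, as [shift_eq] shows; on
    coefficients it is the left shift. *)
Definition shift (f : C -> C) (z : C) : C := Cseries (fun n => coef f (S n) * z ^ n)%C.

Lemma radius_ge1_shift a : radius_ge1 a -> radius_ge1 (fun n => a (S n)).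
Proof.
  intros H r Hr. destruct (H r Hr) as [M [M0 HM]]. exists (M / r). split; [apply Rdiv_le_0_compat; lra|].
  intros n. specialize (HM (S n)). simpl in HM. apply (Rle_div_r _ M r ltac:(lra)). lra.
Qed.

Lemma shift_hol f : hol 1 f -> hol 1 (shift f).
Proof. intros H. apply ps_hol, radius_ge1_shift, coef_radius, H. Qed.

Lemma coef_shift f n : hol 1 f -> coef (shift f) n = coef f (S n).
Proof. intros H. apply (coef_ps (fun n => coef f (S n))), radius_ge1_shift, coef_radius, H. Qed.

Lemma shift_eq f z : hol 1 f -> Cmod z < 1 -> f z = (f 0 + z * shift f z)%C.
Proof.
  intros H Hz. eapply Clim_unique; [apply taylor; assumption|].
  apply (Clim_incr _ _ 1).
  apply (Clim_ext (fun n => f 0 + z * Csum (fun k => coef f (S k) * z ^ k) n)%C).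
  - intros n. change (1 + n)%nat with (S n). rewrite Csum_S, coef_0 by exact H.
    rewrite <- Csum_scal. f_equal; [simpl; ring|]. apply Csum_ext. intros; simpl; ring.
  - apply Clim_plus; [apply Clim_const|]. apply Clim_scal.
    apply (ps_converges (fun k => coef f (S k))); [|exact Hz]. apply radius_ge1_shift, coef_radius, H.
Qed.

Lemma shift_0 f : hol 1 f -> shift f 0 = C_derive f 0.
Proof. intros H. rewrite <- coef_0, coef_shift, coef_1 by (try apply shift_hol; exact H). reflexivity. Qed.

(** The Cauchy product without double series: split f = f 0 + z * shift f and induct on n, with f
    generalized and g fixed. *)
Lemma coef_mult f g n : hol 1 f -> hol 1 g ->
  coef (fun z => f z * g z)%C n = Csum (fun j => coef f j * coef g (n - j))%C (S n).
Proof.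
  intros H K. revert f H. induction n as [|n IH]; intros f H.
  - simpl. rewrite !coef_0 by (try apply hol_mult; assumption). ring.
  - rewrite (coef_ext _ (fun z => f 0 * g z + z * (shift f z * g z))%C).
    2: { intros z Hz. rewrite (shift_eq f z) at 1 by assumption. ring. }
    assert (Hs := shift_hol f H).
    rewrite coef_plus, coef_scal, coef_mul_id_S, (IH (shift f)) by
      (try assumption; repeat apply hol_mult; try assumption; try apply hol_const; apply hol_id).
    rewrite (Csum_S _ (S n)). rewrite coef_0 by exact H. f_equal.
    apply Csum_ext. intros k _. rewrite coef_shift by exact H. reflexivity.
Qed.

(** * Logarithms of nonvanishing holomorphic functions *)

Lemma is_derive_ray (f : C -> C) (z a l : C) (s : R) : cder f (a + s * z) l ->
  is_derive (fun s : R => Re (f (a + s * z)%C)) s (Re (z * l)) /\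
  is_derive (fun s : R => Im (f (a + s * z)%C)) s (Im (z * l)).
Proof.
  intros H.
  assert (K : forall eps, 0 < eps -> exists d, 0 < d /\ forall h, Rabs h < d ->
     Cmod (f (a + (s + h)%R * z) - f (a + s * z) - h * (z * l))%C <= eps * Rabs h).
  { intros eps Heps. assert (P := Cmod_ge_0 z).
    destruct (H (eps / (Cmod z + 1))) as [d [Hd Hw]]; [apply Rdiv_lt_0_compat; lra|].
    exists (d / (Cmod z + 1)). split; [apply Rdiv_lt_0_compat; lra|]. intros h Hh.
    apply Rlt_div_r in Hh; [|lra]. assert (Ph := Rabs_pos h).
    assert (Em : Cmod (a + (s + h)%R * z - (a + s * z)) = Rabs h * Cmod z).
    { replace (a + (s + h)%R * z - (a + s * z))%C with (h * z)%C by (rewrite RtoC_plus; ring). rewrite Cmod_mult, Cmod_R; reflexivity. }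
    specialize (Hw (a + (s + h)%R * z)%C). rewrite Em in Hw.
    replace (h * (z * l))%C with (l * (a + (s + h)%R * z - (a + s * z)))%C by (rewrite RtoC_plus; ring).
    eapply Rle_trans; [apply Hw; nra|].
    replace (eps * Rabs h) with (eps / (Cmod z + 1) * (Rabs h * (Cmod z + 1))) by (field; lra).
    apply Rmult_le_compat_l; [left; apply Rdiv_lt_0_compat; lra|]. nra. }
  split; apply is_derive_Reals; intros eps Heps.
  - destruct (K (eps / 2)) as [d [Hd HK]]; [lra|]. exists (mkposreal d Hd). intros h Hn Hh. specialize (HK h Hh).
    assert (Q : 0 < Rabs h) by (apply Rabs_pos_lt; exact Hn).
    replace ((Re (f (a + (s + h)%R * z)%C) - Re (f (a + s * z)%C)) / h - Re (z * l)) with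
      (Re (f (a + (s + h)%R * z) - f (a + s * z) - h * (z * l))%C / h).
    2: { rewrite !re_minus, re_scal_l. field; exact Hn. }
    unfold Rdiv. rewrite Rabs_mult, Rabs_inv. apply Rle_lt_trans with (eps / 2); [|lra].
    apply Rle_div_l; [exact Q|]. eapply Rle_trans; [apply re_le_Cmod|exact HK].
  - destruct (K (eps / 2)) as [d [Hd HK]]; [lra|]. exists (mkposreal d Hd). intros h Hn Hh. specialize (HK h Hh).
    assert (Q : 0 < Rabs h) by (apply Rabs_pos_lt; exact Hn).
    replace ((Im (f (a + (s + h)%R * z)%C) - Im (f (a + s * z)%C)) / h - Im (z * l)) with
      (Im (f (a + (s + h)%R * z) - f (a + s * z) - h * (z * l))%C / h).
    2: { rewrite !im_minus, im_scal_l. field; exact Hn. }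
    unfold Rdiv. rewrite Rabs_mult, Rabs_inv. apply Rle_lt_trans with (eps / 2); [|lra].
    apply Rle_div_l; [exact Q|]. eapply Rle_trans; [apply im_le_Cmod|exact HK].
Qed.

Definition primitive (m : C -> C) (z : C) : C :=
  Cseries (fun n => (match n with O => 0 | S k => coef m k / INR (S k) end) * z ^ n)%C.

Lemma primitive_radius m : hol 1 m -> radius_ge1 (fun n => match n with O => 0 | S k => coef m k / INR (S k) end)%C.
Proof.
  intros H r Hr. destruct (coef_radius m H r Hr) as [M [M0 HM]]. exists M; split; [exact M0|].
  intros [|k].
  - rewrite Cmod_0. lra.
  - assert (P := lt_0_INR (S k) ltac:(lia)). assert (P1 : 1 <= INR (S k)) by (apply (le_INR 1); lia).
    rewrite Cmod_div by (apply RtoC_neq0; lra). rewrite Cmod_R, Rabs_pos_eq by lra.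
    eapply Rle_trans; [|apply (HM k)]. simpl pow.
    assert (0 < r ^ k) by (apply pow_lt; lra). assert (Q := Cmod_ge_0 (coef m k)).
    apply Rmult_le_compat; try nra.
    + apply Rdiv_le_0_compat; lra.
    + apply Rle_div_l; [lra|]. nra.
Qed.

Lemma primitive_cder m z : hol 1 m -> Cmod z < 1 -> cder (primitive m) z (m z).
Proof.
  intros H Hz. assert (K := ps_cder _ z (primitive_radius m H) Hz).
  replace (m z) with (Cseries (fun n => ps_deriv_coef (fun n => match n with O => 0 | S k => coef m k / INR (S k) end)%C n * z ^ n)%C); [exact K|].
  rewrite (taylor_series m z H Hz). unfold Cseries.
  f_equal; apply Series_ext; intros n; f_equal; f_equal; unfold ps_deriv_coef;
    field; apply RtoC_neq0, not_0_INR; lia.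
Qed.

Lemma primitive_hol m : hol 1 m -> hol 1 (primitive m).
Proof. intros H z Hz. eexists. apply primitive_cder; assumption. Qed.

Lemma primitive_0 m : hol 1 m -> primitive m 0 = 0%C.
Proof.
  intros H. rewrite <- coef_0 by (apply primitive_hol; exact H).
  apply (coef_ps (fun n => match n with O => 0 | S k => coef m k / INR (S k) end)%C 0), primitive_radius, H.
Qed.

Lemma coef_primitive m n : hol 1 m -> coef (primitive m) (S n) = (coef m n / INR (S n))%C.
Proof.
  intros H. apply (coef_ps (fun n => match n with O => 0 | S k => coef m k / INR (S k) end)%C (S n)), primitive_radius, H.
Qed.

Lemma is_derive_ln_sumsq (u v w : R -> R) s du dv dw :
  is_derive u s du -> is_derive v s dv -> is_derive w s dw -> 0 < u s ^ 2 + v s ^ 2 ->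
  is_derive (fun s => ln (u s ^ 2 + v s ^ 2) - 2 * w s) s
    ((2 * u s * du + 2 * v s * dv) / (u s ^ 2 + v s ^ 2) - 2 * dw).
Proof.
  intros D1 D2 D3 N. auto_derive.
  - simpl in N. repeat split; try (eexists; eassumption). exact N.
  - replace (Derive (fun x => u x) s) with du by (symmetry; apply is_derive_unique; exact D1).
    replace (Derive (fun x => v x) s) with dv by (symmetry; apply is_derive_unique; exact D2).
    replace (Derive (fun x => w x) s) with dw by (symmetry; apply is_derive_unique; exact D3).
    field. simpl in *; lra.
Qed.

Section LogModulus.
Variable q : C -> C.
Hypotheses (Hq : hol 1 q) (Nq : forall z, Cmod z < 1 -> q z <> 0%C).

Let m (z : C) : C := (C_derive q z / q z)%C.

Lemma log_deriv_hol : hol 1 m.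
Proof. apply hol_div; [exact Nq|apply hol_derive, Hq|exact Hq]. Qed.

(** In place of a branch of log q: ln |q|^2 and twice the real part of a primitive of q' / q have
    equal derivatives along every ray from 0. *)
Lemma ln_Cmod_series z : Cmod z < 1 -> ln (Cmod (q z) ^ 2) = ln (Cmod (q 0) ^ 2) + 2 * Re (primitive m z).
Proof.
  intros Hz.
  assert (Hs : forall s : R, 0 <= s <= 1 -> Cmod (0 + s * z) < 1).
  { intros s Hs. rewrite Cplus_0_l, Cmod_mult, Cmod_R, Rabs_pos_eq by lra. generalize (Cmod_ge_0 z); nra. }
  set (Phi := fun s : R => ln (Re (q (0 + s * z)%C) ^ 2 + Im (q (0 + s * z)%C) ^ 2) - 2 * Re (primitive m (0 + s * z)%C)).
  assert (K : Phi 0 = Phi 1).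
  { apply (eq_is_derive (V := R_NormedModule) Phi); [|lra]. intros s Hs1. specialize (Hs s Hs1).
    assert (D1 := is_derive_ray q z 0 _ s (hol_C_derive 1 q _ Hq Hs)).
    assert (D2 := is_derive_ray (primitive m) z 0 _ s (primitive_cder m _ log_deriv_hol Hs)).
    destruct D1 as [D1 D1'], D2 as [D2 _].
    assert (N := Nq _ Hs). apply Cmod_gt_0 in N.
    assert (N2 : 0 < Re (q (0 + s * z)%C) ^ 2 + Im (q (0 + s * z)%C) ^ 2) by (rewrite <- Cmod2_alt; apply pow_lt; exact N).
    assert (D := is_derive_ln_sumsq _ _ _ _ _ _ _ D1 D1' D2 N2).
    evar_last; [exact D|]. unfold zero; simpl.
    unfold m. cbv beta. set (Q := q (0 + s * z)%C) in *. set (Q' := C_derive q (0 + s * z)%C).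
    destruct Q as [a b], Q' as [c d], z as [x y]. unfold Cdiv, Cmult, Cinv, Re, Im in *; simpl in *. field. lra. }
  unfold Phi in K. rewrite <- !Cmod2_alt in K.
  replace (0 + 0%R * z)%C with (RtoC 0) in K by ring. replace (0 + 1%R * z)%C with z in K by ring.
  rewrite (primitive_0 m log_deriv_hol) in K. rewrite re_RtoC in K. lra.
Qed.

Let L (t : R) (r : R) : C := RtoC (ln (Cmod (q (r * cis t)%C) ^ 2)).

Let L_split r t : 0 < r < 1 -> L t r = (ln (Cmod (q 0) ^ 2) + (primitive m (r * cis t) + Cconj (primitive m (r * cis t))))%C.
Proof.
  intros Hr. unfold L. rewrite ln_Cmod_series by (rewrite Cmod_circle; lra).
  set (p := primitive m (r * cis t)). destruct p as [a b]. apply Ceq_ReIm; simpl; ring.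
Qed.

Lemma contC_ln_Cmod r : 0 < r < 1 -> Ccontinuous (fun t => RtoC (ln (Cmod (q (r * cis t)%C) ^ 2))).
Proof.
  intros Hr t. assert (Hp := primitive_hol m log_deriv_hol).
  assert (Cp := Ccontinuous_circle 1 _ r Hp ltac:(lra) t).
  apply (contC_ext (fun t => ln (Cmod (q 0) ^ 2) + (primitive m (r * cis t) + Cconj (primitive m (r * cis t))))%C).
  - intros y. symmetry. apply (L_split r y Hr).
  - apply contC_plus; [apply contC_const|]. apply contC_plus; [exact Cp|apply contC_conj; exact Cp].
Qed.

Lemma mean_ln_Cmod r : 0 < r < 1 -> mean (fun t => RtoC (ln (Cmod (q (r * cis t)%C) ^ 2))) = RtoC (ln (Cmod (q 0) ^ 2)).
Proof.
  intros Hr. assert (Hp := primitive_hol m log_deriv_hol).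
  assert (Cp := Ccontinuous_circle 1 _ r Hp ltac:(lra)).
  assert (Cc : Ccontinuous (fun t => Cconj (primitive m (r * cis t)))) by (intros t; apply contC_conj, Cp).
  rewrite (mean_ext _ (fun t => ln (Cmod (q 0) ^ 2) + (primitive m (r * cis t) + Cconj (primitive m (r * cis t))))%C)
    by (intros t; apply (L_split r t Hr)).
  rewrite mean_plus, mean_const, mean_plus, mean_conj, mean_hol_value; try assumption.
  - rewrite primitive_0 by apply log_deriv_hol. apply Ceq_ReIm; simpl; ring.
  - intros t; apply contC_const.
  - intros t; apply contC_plus; [apply Cp|apply Cc].
Qed.

(** ln |q|^2 is a constant plus P plus its conjugate, with P the primitive of q' / q vanishing at 0.
    Against a negative power of e^(it) the constant and the conjugate have mean 0, and P gives its
    Taylor coefficient. *)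
Lemma mean_ln_Cmod_pow_inv r n : 0 < r < 1 ->
  mean (fun t => RtoC (ln (Cmod (q (r * cis t)%C) ^ 2)) * / cis t ^ S n)%C = (r ^ S n * (coef m n / INR (S n)))%C.
Proof.
  intros Hr. assert (Hp := primitive_hol m log_deriv_hol).
  assert (Cp := Ccontinuous_circle 1 _ r Hp ltac:(lra)).
  assert (Ci : Ccontinuous (fun t => / cis t ^ S n)%C).
  { intros t; apply contC_inv; [apply Cpow_nz, cis_neq0|apply contC_pow, contC_cis]. }
  assert (Cc : Ccontinuous (fun t => Cconj (primitive m (r * cis t) * (r * cis t) ^ S n))).
  { intros t. apply contC_conj, contC_mult; [apply Cp|apply contC_pow, Ccontinuous_cis]. }
  assert (Cq := Ccontinuous_quot _ r (S n) Hp Hr).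
  rewrite (mean_ext _ (fun t => ln (Cmod (q 0) ^ 2) * / cis t ^ S n + (r ^ S n * (primitive m (r * cis t) / (r * cis t) ^ S n)
     + / r ^ S n * Cconj (primitive m (r * cis t) * (r * cis t) ^ S n)))%C).
  2: { intros t. fold (L t r). rewrite (L_split r t Hr).
       rewrite Cmult_conj, Cpow_conj, Cmult_conj, <- cis_inv, !Cpow_mult_l, Cpow_inv by apply cis_neq0.
       replace (Cconj r) with (RtoC r) by (apply Ceq_ReIm; simpl; ring).
       field. split; apply Cpow_nz; first [apply cis_neq0|apply RtoC_neq0; lra]. }
  rewrite mean_plus, mean_scal, mean_cis_pow_inv, mean_plus, !mean_scal, mean_conj, mean_hol_pow, coef_circle, coef_primitive;
    try assumption; try apply log_deriv_hol.
  - replace (Cconj 0) with (RtoC 0) by (apply Ceq_ReIm; simpl; ring). rewrite <- RtoC_pow. ring.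
  - intros t. apply contC_mult; [apply Cp|apply contC_pow, Ccontinuous_cis].
  - intros t. apply contC_mult; [apply contC_const|apply Cq].
  - intros t. apply contC_mult; [apply contC_const|apply Cc].
  - intros t. apply contC_mult; [apply contC_const|apply Ci].
  - intros t. apply contC_plus; (apply contC_mult; [apply contC_const|]); [apply Cq|apply Cc].
Qed.

Lemma mean_ln_Cmod_pow r n : 0 < r < 1 ->
  mean (fun t => RtoC (ln (Cmod (q (r * cis t)%C) ^ 2)) * cis t ^ S n)%C = Cconj (r ^ S n * (coef m n / INR (S n)))%C.
Proof.
  intros Hr. rewrite <- mean_ln_Cmod_pow_inv by exact Hr. rewrite <- mean_conj.
  - apply mean_ext. intros t. rewrite Cmult_conj, Cinv_conj by (apply Cpow_nz, cis_neq0).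
    rewrite Cpow_conj, <- cis_inv, Cpow_inv by apply cis_neq0.
    replace (/ / cis t ^ S n)%C with (cis t ^ S n)%C by (field; apply Cpow_nz, cis_neq0).
    f_equal. apply Ceq_ReIm; simpl; ring.
  - intros t. apply contC_mult; [apply contC_ln_Cmod; exact Hr|].
    apply contC_inv; [apply Cpow_nz, cis_neq0|apply contC_pow, contC_cis].
Qed.

End LogModulus.

(** * Divided differences of univalent functions *)

Definition ddiff (g : C -> C) (w z : C) : C :=
  if Ceq_dec z w then C_derive g w else ((g z - g w) / (z - w))%C.

Lemma ddiff_sym g w z : ddiff g w z = ddiff g z w.
Proof.
  unfold ddiff. destruct (Ceq_dec z w) as [e|n], (Ceq_dec w z) as [e'|n']; subst; try congruence.
  field. split; apply Cminus_neq0; congruence.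
Qed.

Lemma ddiff_eq g w z : (g z - g w = ddiff g w z * (z - w))%C.
Proof.
  unfold ddiff. destruct (Ceq_dec z w) as [e|n]; [subst; ring|].
  field. apply Cminus_neq0, n.
Qed.

Lemma ddiff_diag g w : ddiff g w w = C_derive g w.
Proof. unfold ddiff. destruct (Ceq_dec w w); congruence. Qed.

Lemma hol_affine g (a : C) (d : R) : hol 1 g -> 0 < d -> Cmod a + d <= 1 -> hol 1 (fun u => g (a + d * u)%C).
Proof.
  intros H Hd Ha u Hu. destruct (H (a + d * u)%C) as [l Hl].
  - generalize (Cmod_triangle a (d * u)). rewrite Cmod_mult, Cmod_R, Rabs_pos_eq by lra. nra.
  - eexists. apply (cder_comp g (fun u => a + d * u)%C u l (0 + d * 1)%C); [|exact Hl].
    apply cder_plus; [apply cder_const|]. apply cder_scal, cder_id.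
Qed.

(** Only the point z = w is delicate. The disk of radius d = 1 - |w| about w is rescaled to the unit
    disk, where the divided difference becomes a [shift] divided by d. *)
Lemma ddiff_hol g w : hol 1 g -> Cmod w < 1 -> hol 1 (ddiff g w).
Proof.
  intros H Hw z Hz. destruct (Ceq_dec z w) as [e|n].
  - subst z. set (d := 1 - Cmod w). set (F := fun u => g (w + d * u)%C).
    assert (Hd : 0 < d) by (unfold d; lra).
    assert (HF : hol 1 F) by (apply hol_affine; [exact H|lra|unfold d; lra]).
    assert (Nd : RtoC d <> 0%C) by (apply RtoC_neq0; lra).
    assert (Hs := shift_hol F HF).
    destruct (Hs 0%C) as [l Hl]; [rewrite Cmod_0; lra|].
    exists (l * (/ d * (1 - 0)) * (/ d) + shift F (/ d * (w - w)) * 0)%C.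
    apply (cder_ext_loc (fun z => shift F (/ d * (z - w)) * / d)%C).
    + apply locally_Cmod. exists d; split; [exact Hd|]. intros z Hzd.
      set (u := (/ d * (z - w))%C).
      assert (Hu : Cmod u < 1).
      { unfold u. rewrite Cmod_mult, Cmod_inv, Cmod_R, Rabs_pos_eq by (try lra; exact Nd).
        apply Rmult_lt_reg_l with d; [exact Hd|]. rewrite <- Rmult_assoc, Rinv_r by lra. lra. }
      unfold ddiff. destruct (Ceq_dec z w) as [e|n].
      * subst z. unfold u. replace (/ d * (w - w))%C with (RtoC 0) by ring.
        rewrite shift_0 by exact HF.
        assert (K : cder F 0 (C_derive g w * (0 + d * 1))%C).
        { apply (cder_comp g (fun u => w + d * u)%C).
          - apply cder_plus; [apply cder_const|]. apply cder_scal, cder_id.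
          - replace (w + d * 0)%C with w by ring. apply (hol_C_derive 1); assumption. }
        rewrite (C_derive_cder _ _ _ K). field. exact Nd.
      * assert (E := shift_eq F u HF Hu). unfold F at 1 2 in E.
        replace (w + d * u)%C with z in E by (unfold u; field; exact Nd).
        replace (w + d * 0)%C with w in E by ring. rewrite E. unfold u at 2. field.
        split; [exact Nd|apply Cminus_neq0; exact n].
    + apply (cder_mult (fun z => shift F (/ d * (z - w)))%C (fun _ => / d)%C); [|apply cder_const].
      apply (cder_comp (shift F) (fun z => / d * (z - w))%C).
      * apply cder_scal, cder_minus; [apply cder_id|apply cder_const].
      * replace (/ d * (w - w))%C with (RtoC 0) by ring. exact Hl.
  - destruct (H z Hz) as [l Hl]. eexists.
    apply (cder_ext_loc (fun z => (g z - g w) / (z - w))%C).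
    + apply locally_Cmod. exists (Cmod (z - w)). split; [apply Cmod_gt_0, Cminus_neq0, n|].
      intros y Hy. unfold ddiff. destruct (Ceq_dec y w) as [e|]; [|reflexivity].
      subst y. rewrite Cmod_minus_sym in Hy. lra.
    + apply cder_mult; [apply cder_minus; [exact Hl|apply cder_const]|].
      apply cder_inv; [apply Cminus_neq0, n|]. apply cder_minus; [apply cder_id|apply cder_const].
Qed.

(** The mean value theorem is applied to the real and imaginary parts separately, hence the factor
    2. *)
Lemma ray_bound f (a z : C) M : (forall s : R, 0 <= s <= 1 -> exists l, cder f (a + s * z) l /\ Cmod l <= M) ->
  Cmod (f (a + z) - f a)%C <= 2 * (M * Cmod z).
Proof.
  intros H.
  assert (D : forall s : R, 0 <= s <= 1 -> cder f (a + s * z) (C_derive f (a + s * z)%C) /\ Cmod (z * C_derive f (a + s * z)%C) <= M * Cmod z).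
  { intros s Hs. destruct (H s Hs) as [l [Hl HM]]. rewrite (C_derive_cder _ _ _ Hl). split; [exact Hl|].
    rewrite Cmod_mult, Rmult_comm. apply Rmult_le_compat_r; [apply Cmod_ge_0|exact HM]. }
  assert (E0 : (a + 0%R * z)%C = a) by ring. assert (E1 : (a + 1%R * z)%C = (a + z)%C) by ring.
  eapply Rle_trans; [apply Cmod_le_abs|]. rewrite re_minus, im_minus, <- E1. rewrite <- E0 at 2 4.
  replace (2 * (M * Cmod z)) with (M * Cmod z * (1 - 0) + M * Cmod z * (1 - 0)) by ring.
  assert (K : forall h dh : R -> R, (forall s, 0 <= s <= 1 -> is_derive h s (dh s) /\ Rabs (dh s) <= M * Cmod z) ->
    Rabs (h 1 - h 0) <= M * Cmod z * (1 - 0)).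
  { intros h dh Hh. destruct (MVT_gen h 0 1 dh) as [c [Hc E]].
    - rewrite Rmin_left, Rmax_right by lra. intros s Hs. apply Hh; lra.
    - rewrite Rmin_left, Rmax_right by lra. intros s Hs. destruct (Hh s Hs) as [K _].
      apply derivable_continuous_pt. exists (dh s). apply is_derive_Reals, K.
    - rewrite Rmin_left, Rmax_right in Hc by lra. rewrite E, Rabs_mult, (Rabs_pos_eq (1 - 0)) by lra.
      apply Rmult_le_compat_r; [lra|]. apply Hh; exact Hc. }
  apply Rplus_le_compat.
  - apply (K (fun s : R => Re (f (a + s * z)%C)) (fun s : R => Re (z * C_derive f (a + s * z)%C))).
    intros s Hs. destruct (D s Hs) as [D1 D2]. split; [apply (is_derive_ray f z a _ s D1)|].
    eapply Rle_trans; [apply re_le_Cmod|exact D2].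
  - apply (K (fun s : R => Im (f (a + s * z)%C)) (fun s : R => Im (z * C_derive f (a + s * z)%C))).
    intros s Hs. destruct (D s Hs) as [D1 D2]. split; [apply (is_derive_ray f z a _ s D1)|].
    eapply Rle_trans; [apply im_le_Cmod|exact D2].
Qed.

Lemma Cmod_segment (a z c : C) s d : 0 <= s <= 1 -> Cmod (a - c) < d -> Cmod (a + z - c) < d -> Cmod (a + s * z - c) < d.
Proof.
  intros Hs H1 H2.
  replace (a + s * z - c)%C with ((1 - s)%R * (a - c) + s * (a + z - c))%C by (rewrite RtoC_minus; ring).
  eapply Rle_lt_trans; [apply Cmod_triangle|]. rewrite !Cmod_mult, !Cmod_R, !Rabs_pos_eq by lra.
  destruct (Req_dec s 0) as [->|]; nra.
Qed.

(** On the diagonal, [ray_bound] is applied to g y - g'(w0) y, whose derivative is small near w0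
    because g' is continuous. Off the diagonal the quotient is continuous by the usual rules. *)
Lemma ddiff_joint g (w0 z0 : C) : hol 1 g -> Cmod w0 < 1 -> Cmod z0 < 1 ->
  forall eps, 0 < eps -> exists d, 0 < d /\ forall w z, Cmod (w - w0) < d -> Cmod (z - z0) < d ->
    Cmod (ddiff g w z - ddiff g w0 z0) < eps.
Proof.
  intros H Hw Hz eps Heps. assert (H' := hol_derive g H).
  destruct (Ceq_dec z0 w0) as [e|n].
  - subst z0. rewrite ddiff_diag.
    destruct (proj1 (locally_Cmod _ _) (proj1 (contC_eps _ _) (hol_cont 1 _ w0 H' Hw) (eps / 4) ltac:(lra))) as [d [Hd Hq]].
    exists (Rmin d (1 - Cmod w0)). split; [apply Rmin_pos; lra|].
    assert (In : forall y, Cmod (y - w0) < Rmin d (1 - Cmod w0) -> Cmod (y - w0) < d /\ Cmod y < 1).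
    { intros y Hy. generalize (Rmin_l d (1 - Cmod w0)) (Rmin_r d (1 - Cmod w0)) (Cmod_triangle' y w0). lra. }
    intros w z Aw Az. destruct (Ceq_dec z w) as [e|n].
    + subst z. rewrite ddiff_diag. specialize (Hq w ltac:(apply In, Aw)). lra.
    + assert (Nz := Cminus_neq0 _ _ n). assert (Pz : 0 < Cmod (z - w)) by (apply Cmod_gt_0, Nz).
      set (F := fun y => (g y - C_derive g w0 * y)%C).
      assert (B : Cmod (F (w + (z - w)) - F w)%C <= 2 * (eps / 4 * Cmod (z - w))).
      { apply ray_bound. intros s Hs.
        assert (Hy : Cmod (w + s * (z - w) - w0) < Rmin d (1 - Cmod w0)).
        { apply Cmod_segment; [exact Hs|exact Aw|]. replace (w + (z - w) - w0)%C with (z - w0)%C by ring. exact Az. }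
        destruct (In _ Hy) as [Y1 Y2]. exists (C_derive g (w + s * (z - w))%C - C_derive g w0 * 1)%C. split.
        - apply cder_minus; [apply (hol_C_derive 1); assumption|apply cder_scal, cder_id].
        - rewrite Cmult_1_r. left. apply Hq, Y1. }
      replace (w + (z - w))%C with z in B by ring.
      replace (F z - F w)%C with ((ddiff g w z - C_derive g w0) * (z - w))%C in B.
      * rewrite Cmod_mult in B. apply Rle_lt_trans with (eps / 2); [|lra].
        apply Rmult_le_reg_r with (Cmod (z - w)); [exact Pz|]. lra.
      * unfold F. replace ((ddiff g w z - C_derive g w0) * (z - w))%C with
          (ddiff g w z * (z - w) - C_derive g w0 * (z - w))%C by ring. rewrite <- ddiff_eq. ring.
  - assert (P : 0 < Cmod (z0 - w0)) by (apply Cmod_gt_0, Cminus_neq0, n).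
    set (D := fun p : C * C => ((g (snd p) - g (fst p)) / (snd p - fst p))%C).
    assert (K : contC (U := prod_UniformSpace C_UniformSpace C_UniformSpace) D (w0, z0)).
    { assert (K1 : contC (U := prod_UniformSpace C_UniformSpace C_UniformSpace) fst (w0, z0)).
      { split; apply (continuous_comp fst); [apply continuous_fst|apply (contC_id w0)|apply continuous_fst|apply (contC_id w0)]. }
      assert (K2 : contC (U := prod_UniformSpace C_UniformSpace C_UniformSpace) snd (w0, z0)).
      { split; apply (continuous_comp snd); [apply continuous_snd|apply (contC_id z0)|apply continuous_snd|apply (contC_id z0)]. }
      apply contC_div.
      - apply Cminus_neq0, n.
      - apply contC_minus; (apply contC_comp; [assumption|]); apply (hol_cont 1); assumption.
      - apply contC_minus; assumption. }
    destruct (proj1 (contC_eps _ _) K eps Heps) as [d Hd].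
    exists (Rmin d (Cmod (z0 - w0) / 2)). split; [apply Rmin_pos; [apply cond_pos|lra]|].
    intros w z Aw Az.
    assert (N : z <> w).
    { intros E. subst z. generalize (Rmin_r d (Cmod (z0 - w0) / 2)) (Cmod_triangle (z0 - w) (w - w0)).
      replace (z0 - w + (w - w0))%C with (z0 - w0)%C by ring. rewrite (Cmod_minus_sym z0 w). lra. }
    unfold ddiff. destruct (Ceq_dec z w) as [|_]; [contradiction|]. destruct (Ceq_dec z0 w0) as [|_]; [contradiction|].
    apply (Hd (w, z)). split; apply C_NormedModule_mixin_compat1; simpl.
    + eapply Rlt_le_trans; [exact Aw|apply Rmin_l].
    + eapply Rlt_le_trans; [exact Az|apply Rmin_l].
Qed.

Lemma Ccontinuous_bounded_below F : Ccontinuous F -> (forall t, F t <> 0%C) ->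
  exists m, 0 < m /\ forall t, 0 <= t <= 2 * PI -> m <= Cmod (F t).
Proof.
  intros H N. destruct (Ccontinuous_bounded (fun t => / F t)%C) as [M HM].
  { intros t. apply contC_inv; [apply N|apply H]. }
  assert (P : forall t, 0 < Cmod (F t)) by (intros t; apply Cmod_gt_0, N).
  assert (M0 : 0 < M).
  { eapply Rlt_le_trans; [|apply (HM 0); generalize two_PI_pos; lra]. rewrite Cmod_inv by apply N.
    apply Rinv_0_lt_compat, P. }
  exists (/ M). split; [apply Rinv_0_lt_compat; exact M0|]. intros t Ht. specialize (HM t Ht).
  rewrite Cmod_inv in HM by apply N. rewrite <- (Rinv_inv (Cmod (F t))).
  apply Rinv_le_contravar; [apply Rinv_0_lt_compat, P|exact HM].
Qed.

Section Univalent.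
Variable g : C -> C.
Hypotheses (Hg : hol 1 g) (Inj : forall z w, Cmod z < 1 -> Cmod w < 1 -> g z = g w -> z = w).

(** Otherwise g' would vanish on a punctured disk about z0. Then g would be constant on a segment of
    that disk away from z0, against injectivity. *)
Lemma univalent_not_locally_constant (z0 : C) d : Cmod z0 < 1 -> 0 < d ->
  exists w, w <> z0 /\ Cmod (w - z0) < d /\ Cmod w < 1 /\ C_derive g w <> 0%C.
Proof.
  intros Hz Hd. apply Classical_Prop.NNPP. intros N.
  set (e := Rmin (d / 2) ((1 - Cmod z0) / 2)).
  assert (He : 0 < e) by (unfold e; apply Rmin_pos; lra).
  assert (He1 : e <= d / 2) by apply Rmin_l. assert (He2 : e <= (1 - Cmod z0) / 2) by apply Rmin_r.
  assert (Z : forall w, w <> z0 -> Cmod (w - z0) <= e -> C_derive g w = 0%C).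
  { intros w Hw Hwe. destruct (Ceq_dec (C_derive g w) 0) as [E|NE]; [exact E|exfalso]. apply N. exists w.
    repeat split; try assumption; try lra. generalize (Cmod_triangle' w z0). lra. }
  assert (Em : Cmod e = e) by (rewrite Cmod_R, Rabs_pos_eq; lra).
  set (a := (z0 + (e / 2)%R)%C).
  assert (B : Cmod (g (a + (e / 2)%R) - g a)%C <= 2 * (0 * Cmod (e / 2)%R)).
  { apply ray_bound. intros s Hs.
    assert (E : (a + s * (e / 2)%R = z0 + (e / 2 + s * (e / 2))%R)%C) by (unfold a; rewrite !RtoC_plus, RtoC_mult; ring).
    rewrite E. assert (Q : e / 2 <= e / 2 + s * (e / 2) <= e) by nra.
    set (k := e / 2 + s * (e / 2)) in *.
    assert (Ek : Cmod (z0 + k - z0) = k).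
    { replace (z0 + k - z0)%C with (RtoC k) by ring. rewrite Cmod_R, Rabs_pos_eq; lra. }
    assert (Hin : Cmod (z0 + k) < 1) by (generalize (Cmod_triangle' (z0 + k) z0); lra).
    exists 0%C. split; [|rewrite Cmod_0; lra].
    assert (Zk : C_derive g (z0 + k)%C = 0%C).
    { apply Z; [|lra]. intros E'. rewrite E' in Ek. replace (z0 - z0)%C with (RtoC 0) in Ek by ring. rewrite Cmod_0 in Ek. lra. }
    rewrite <- Zk. apply (hol_C_derive 1); assumption. }
  rewrite Rmult_0_l, Rmult_0_r in B.
  assert (Ia : Cmod (e / 2)%R = e / 2) by (rewrite Cmod_R, Rabs_pos_eq; lra).
  assert (C1 : Cmod a < 1) by (unfold a; generalize (Cmod_triangle z0 (e / 2)%R); lra).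
  assert (C2 : Cmod (a + (e / 2)%R) < 1) by (generalize (Cmod_triangle a (e / 2)%R) (Cmod_triangle z0 (e / 2)%R); fold a; lra).
  assert (E0 : (g (a + (e / 2)%R) - g a = 0)%C).
  { apply Cmod_eq_0. apply Rle_antisym; [exact B|apply Cmod_ge_0]. }
  assert (E1 : (a + (e / 2)%R)%C = a).
  { apply Inj; try assumption. replace (g (a + (e / 2)%R)%C) with (g (a + (e / 2)%R) - g a + g a)%C by ring. rewrite E0; ring. }
  assert (E2 : RtoC (e / 2) = 0%C).
  { replace (RtoC (e / 2)) with (a + (e / 2)%R - a)%C by ring. rewrite E1; ring. }
  apply RtoC_inj in E2. lra.
Qed.

Lemma ddiff_neq0_of_deriv (w z : C) : Cmod w < 1 -> C_derive g w <> 0%C -> Cmod z < 1 -> ddiff g w z <> 0%C.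
Proof.
  intros Hw N Hz. unfold ddiff. destruct (Ceq_dec z w) as [e|n]; [exact N|].
  intros E. apply n, Inj; try assumption. assert (Nz := Cminus_neq0 _ _ n).
  replace (g z) with ((g z - g w) / (z - w) * (z - w) + g w)%C by (field; exact Nz). rewrite E; ring.
Qed.

(* Hurwitz: for [w] near a zero [z0] of [g'] with [g' w <> 0], the function [1 / ddiff g w] is
   holomorphic, and its mean over a small circle about [z0] bounds its value at [z0]. *)
Lemma univalent_deriv_neq0 (z0 : C) : Cmod z0 < 1 -> C_derive g z0 <> 0%C.
Proof.
  intros Hz0 E0.
  set (d := 1 - Cmod z0). assert (Hd : 0 < d <= 1) by (unfold d; generalize (Cmod_ge_0 z0); lra).
  set (F := fun u => g (z0 + d * u)%C).
  assert (HF : hol 1 F) by (apply hol_affine; [exact Hg|lra|unfold d; lra]).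
  assert (Hin : forall u, Cmod u < 1 -> Cmod (z0 + d * u) < 1).
  { intros u Hu. generalize (Cmod_triangle z0 (d * u)). rewrite Cmod_mult, Cmod_R, Rabs_pos_eq by lra.
    unfold d in *. nra. }
  assert (Hc : forall t, Cmod ((/ 2)%R * cis t) = / 2) by (intros; apply Cmod_circle; lra).
  (* By injectivity g - g z0 has a positive lower bound m on the circle of radius d / 2 about z0. *)
  destruct (Ccontinuous_bounded_below (fun t => F ((/ 2)%R * cis t) - g z0)%C) as [m [Hm Bm]].
  { intros t. apply contC_minus; [|apply contC_const]. apply (Ccontinuous_circle 1); [exact HF|lra]. }
  { intros t E. assert (E1 : (z0 + d * ((/ 2)%R * cis t))%C = z0).
    { apply Inj; [apply Hin; rewrite Hc; lra|exact Hz0|].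
      change (F ((/ 2)%R * cis t)%C = g z0). replace (F ((/ 2)%R * cis t)%C) with (F ((/ 2)%R * cis t)%C - g z0 + g z0)%C by ring.
      rewrite E; ring. }
    assert (E2 : (d * ((/ 2)%R * cis t))%C = 0%C).
    { replace (d * ((/ 2)%R * cis t))%C with (z0 + d * ((/ 2)%R * cis t) - z0)%C by ring. rewrite E1; ring. }
    revert E2. apply Cmult_neq_0; [apply RtoC_neq0; lra|apply circle_neq0; lra]. }
  destruct (proj1 (locally_Cmod _ _) (proj1 (contC_eps _ _) (hol_cont 1 _ z0 Hg Hz0) (m / 2) ltac:(lra))) as [d1 [Hd1 C1]].
  destruct (hol_C_derive 1 g z0 Hg Hz0 (m / 8) ltac:(lra)) as [d2 [Hd2 C2]].
  set (e := Rmin (Rmin d1 d2) (d / 4)).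
  assert (He : 0 < e) by (unfold e; repeat apply Rmin_pos; lra).
  assert (e1 : e <= d1) by (unfold e; eapply Rle_trans; [apply Rmin_l|apply Rmin_l]).
  assert (e2 : e <= d2) by (unfold e; eapply Rle_trans; [apply Rmin_l|apply Rmin_r]).
  assert (e3 : e <= d / 4) by (unfold e; apply Rmin_r).
  destruct (univalent_not_locally_constant z0 e Hz0 He) as [w [Nw [Hwe [Hw N']]]].
  assert (Nq : forall u, Cmod u < 1 -> ddiff g w (z0 + d * u) <> 0%C).
  { intros u Hu. apply ddiff_neq0_of_deriv; try assumption. apply Hin, Hu. }
  assert (Hq : hol 1 (fun u => / ddiff g w (z0 + d * u))%C).
  { apply hol_inv; [exact Nq|]. apply (hol_affine (ddiff g w)); [apply ddiff_hol; assumption|lra|unfold d; lra]. }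
  assert (MV := mean_hol_value _ (/ 2) Hq ltac:(lra)). cbv beta in MV.
  replace (z0 + d * 0)%C with z0 in MV by ring.
  (* On the circle |ddiff g w| >= (m / 2) / d, since |z - w| <= d; the mean value property of the
     reciprocal carries this bound to z0. But g' z0 = 0 makes |ddiff g w z0| at most m / 8, while m
     / (2 d) >= m / 2. *)
  assert (BV : Cmod (/ ddiff g w z0) <= 2 * d / m).
  { rewrite <- MV. apply Cmod_mean_le; [apply (Ccontinuous_circle 1 _ _ Hq); lra|]. intros t Ht.
    set (z := (z0 + d * ((/ 2)%R * cis t))%C).
    assert (Hz : Cmod z < 1) by (apply Hin; rewrite Hc; lra).
    assert (Nz : ddiff g w z <> 0%C) by (apply Nq; rewrite Hc; lra).
    rewrite Cmod_inv by exact Nz. assert (Pz : 0 < Cmod (ddiff g w z)) by (apply Cmod_gt_0, Nz).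
    assert (D : Cmod (z - z0) = d / 2).
    { unfold z. replace (z0 + d * ((/ 2)%R * cis t) - z0)%C with (d * ((/ 2)%R * cis t))%C by ring.
      rewrite Cmod_mult, Hc, Cmod_R, Rabs_pos_eq by lra. field. }
    assert (Dw : Cmod (z - w) <= d).
    { generalize (Cmod_triangle (z - z0) (z0 - w)). replace (z - z0 + (z0 - w))%C with (z - w)%C by ring.
      rewrite (Cmod_minus_sym z0 w). lra. }
    assert (Lg : m / 2 <= Cmod (g z - g w)).
    { specialize (Bm t Ht). specialize (C1 w ltac:(lra)).
      generalize (Cmod_triangle (g z - g w) (g w - g z0)). replace (g z - g w + (g w - g z0))%C with (g z - g z0)%C by ring.
      change (F ((/ 2)%R * cis t)%C) with (g z) in Bm. lra. }
    rewrite ddiff_eq, Cmod_mult in Lg.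
    assert (L2 : m / (2 * d) <= Cmod (ddiff g w z)).
    { apply Rle_div_l; [lra|]. assert (Cmod (ddiff g w z) * Cmod (z - w) <= Cmod (ddiff g w z) * d) by (apply Rmult_le_compat_l; lra). lra. }
    replace (2 * d / m) with (/ (m / (2 * d))) by (field; lra).
    apply Rinv_le_contravar; [apply Rdiv_lt_0_compat; lra|exact L2]. }
  rewrite Cmod_inv in BV by (replace z0 with (z0 + d * 0)%C by ring; apply Nq; rewrite Cmod_0; lra).
  assert (Pq : 0 < Cmod (ddiff g w z0)).
  { apply Cmod_gt_0. replace z0 with (z0 + d * 0)%C by ring. apply Nq; rewrite Cmod_0; lra. }
  assert (Lq : m / (2 * d) <= Cmod (ddiff g w z0)).
  { rewrite <- (Rinv_inv (Cmod (ddiff g w z0))). replace (m / (2 * d)) with (/ (2 * d / m)) by (field; lra).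
    apply Rinv_le_contravar; [apply Rinv_0_lt_compat; exact Pq|exact BV]. }
  specialize (C2 w ltac:(lra)). rewrite E0, ddiff_sym in *.
  assert (Pw : 0 < Cmod (w - z0)) by (apply Cmod_gt_0, Cminus_neq0, Nw).
  replace (g w - g z0 - 0 * (w - z0))%C with (ddiff g z0 w * (w - z0))%C in C2 by (rewrite <- ddiff_eq; ring).
  rewrite Cmod_mult in C2. apply Rmult_le_reg_r in C2; [|exact Pw].
  assert (m / 2 <= m / (2 * d)).
  { unfold Rdiv. apply Rmult_le_compat_l; [lra|]. apply Rinv_le_contravar; lra. }
  lra.
Qed.

Lemma ddiff_neq0 (w z : C) : Cmod w < 1 -> Cmod z < 1 -> ddiff g w z <> 0%C.
Proof. intros Hw Hz. apply ddiff_neq0_of_deriv; try assumption. apply univalent_deriv_neq0, Hw. Qed.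

End Univalent.

(** * Positive kernels and logarithmic energy *)

Definition jointC (K : R -> R -> C) : Prop :=
  forall p : prod_UniformSpace R_UniformSpace R_UniformSpace, contC (fun p => K (fst p) (snd p)) p.

Lemma contC_real_comp {U : UniformSpace} (F : R -> C) (f : U -> R) x :
  continuous f x -> contC F (f x) -> contC (fun y => F (f y)) x.
Proof. intros H [A B]; split; [exact (continuous_comp f (fun t => Re (F t)) x H A)|exact (continuous_comp f (fun t => Im (F t)) x H B)]. Qed.

Lemma jointC_fst F : Ccontinuous F -> jointC (fun t _ => F t).
Proof. intros H p. apply (contC_real_comp F fst); [apply continuous_fst|apply H]. Qed.

Lemma jointC_snd F : Ccontinuous F -> jointC (fun _ u => F u).
Proof. intros H p. apply (contC_real_comp F snd); [apply continuous_snd|apply H]. Qed.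

Lemma jointC_const c : jointC (fun _ _ => c).
Proof. intros p. apply contC_const. Qed.

Lemma jointC_plus K L : jointC K -> jointC L -> jointC (fun t u => K t u + L t u)%C.
Proof. intros H H' p. apply contC_plus; [apply H|apply H']. Qed.

Lemma jointC_mult K L : jointC K -> jointC L -> jointC (fun t u => K t u * L t u)%C.
Proof. intros H H' p. apply contC_mult; [apply H|apply H']. Qed.

Lemma jointC_slice_fst K u : jointC K -> Ccontinuous (fun t => K t u).
Proof.
  intros H t. destruct (H (t, u)) as [A B].
  split; [apply (continuous_comp_2 (fun t : R => t) (fun _ : R => u) (fun t u => Re (K t u)))|
          apply (continuous_comp_2 (fun t : R => t) (fun _ : R => u) (fun t u => Im (K t u)))];
  try apply continuous_id; try apply continuous_const; assumption.
Qed.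

Lemma continuous_RInt_param (f : R -> R -> R) a b u0 : a <= b ->
  (forall p : R * R, continuous (fun p : R * R => f (fst p) (snd p)) p) ->
  continuous (fun u => RInt (fun t => f t u) a b) u0.
Proof.
  intros Lab H. apply filterlim_locally. intros eps.
  assert (He : 0 < eps / (2 * (b - a + 1))) by (apply Rdiv_lt_0_compat; [apply cond_pos|lra]).
  destruct (uniform_continuity_2d_1d f a b u0) with (eps := mkposreal _ He) as [d Hd].
  { intros t _. apply continuity_2d_pt_filterlim, (H (t, u0)). }
  exists d. intros u Hu. unfold ball in *; simpl in *. unfold AbsRing_ball, abs, minus, plus, opp in *; simpl in *.
  assert (Sl : forall u, ex_RInt (fun t => f t u) a b).
  { intros v. apply ex_RInt_cont. intros t.
    apply (continuous_comp_2 (fun t : R => t) (fun _ : R => v) f); [apply continuous_id|apply continuous_const|apply (H (t, v))]. }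
  change (Rabs (RInt (fun t => f t u) a b - RInt (fun t => f t u0) a b) < eps).
  rewrite <- (RInt_minus (V := R_CompleteNormedModule) (fun t => f t u) (fun t => f t u0)) by apply Sl.
  apply Rle_lt_trans with ((b - a) * (eps / (2 * (b - a + 1)))).
  - apply abs_RInt_le_const; [exact Lab|apply (ex_RInt_minus (V := R_NormedModule)); apply Sl|].
    intros t Ht. left. apply Rabs_def2 in Hu.
    assert (Pd := cond_pos d). apply (Hd t u0 t u); try lra; try exact Ht.
    replace (t - t) with 0 by ring. rewrite Rabs_R0. apply cond_pos.
  - assert (P := cond_pos eps). apply Rmult_lt_reg_r with (2 * (b - a + 1)); [lra|].
    replace ((b - a) * (eps / (2 * (b - a + 1))) * (2 * (b - a + 1))) with ((b - a) * eps) by (field; lra).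
    assert (0 <= (b - a) * eps) by (apply Rmult_le_pos; lra). lra.
Qed.

Lemma mean_param K : jointC K -> Ccontinuous (fun u => mean (fun t => K t u)).
Proof.
  intros H u. split; unfold mean; simpl.
  - apply (continuous_mult (K := R_AbsRing) (fun u => RInt (fun t => Re (K t u)) 0 (2 * PI)) (fun _ => / (2 * PI))); [|apply continuous_const].
    apply (continuous_RInt_param (fun t u => Re (K t u))); [generalize two_PI_pos; lra|]. intros p. apply H.
  - apply (continuous_mult (K := R_AbsRing) (fun u => RInt (fun t => Im (K t u)) 0 (2 * PI)) (fun _ => / (2 * PI))); [|apply continuous_const].
    apply (continuous_RInt_param (fun t u => Im (K t u))); [generalize two_PI_pos; lra|]. intros p. apply H.
Qed.

Lemma Re_mean_mono F G : Ccontinuous F -> Ccontinuous G -> (forall t, 0 <= t <= 2 * PI -> Re (F t) <= Re (G t)) ->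
  Re (mean F) <= Re (mean G).
Proof.
  intros H K L. unfold mean; simpl. generalize two_PI_pos; intros P.
  apply Rmult_le_compat_r; [left; apply Rinv_0_lt_compat; exact P|].
  apply RInt_le; [lra| | |intros; apply L; lra]; apply ex_RInt_cont; intros; [apply H|apply K].
Qed.

Lemma mean_real (f : R -> R) : mean (fun t => RtoC (f t)) = RtoC (Re (mean (fun t => RtoC (f t)))).
Proof.
  unfold mean. apply Ceq_ReIm; simpl; [reflexivity|].
  rewrite RInt_const. unfold scal; simpl; unfold mult; simpl. field. generalize PI_RGT_0; lra.
Qed.

Lemma Cmod_mean_le_fun F (G : R -> R) : Ccontinuous F -> Ccontinuous (fun t => RtoC (G t)) ->
  (forall t, 0 <= t <= 2 * PI -> Cmod (F t) <= G t) -> Cmod (mean F) <= Re (mean (fun t => RtoC (G t))).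
Proof.
  intros H HG B.
  assert (K : Re (Cconj (mean F) * mean F) <= Cmod (mean F) * Re (mean (fun t => RtoC (G t)))).
  { rewrite <- mean_scal by exact H. rewrite <- re_scal_l, <- mean_scal by exact HG. apply Re_mean_mono.
    - intros t; apply contC_mult; [apply contC_const|apply H].
    - intros t; apply contC_mult; [apply contC_const|apply HG].
    - intros t Ht. rewrite re_scal_l, re_RtoC. eapply Rle_trans; [apply Rle_abs|]. eapply Rle_trans; [apply re_le_Cmod|].
      rewrite Cmod_mult, Cmod_conj. apply Rmult_le_compat_l; [apply Cmod_ge_0|apply B; exact Ht]. }
  rewrite Cmult_comm, <- Cmod2_conj, re_RtoC in K.
  destruct (Rle_lt_or_eq_dec 0 (Cmod (mean F)) (Cmod_ge_0 _)) as [P|P].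
  - apply Rmult_le_reg_l with (Cmod (mean F)); [exact P|].
    replace (Cmod (mean F) * Cmod (mean F)) with (Cmod (mean F) ^ 2) by ring. exact K.
  - rewrite <- P. replace 0 with (Re (mean (fun _ => 0))) by (rewrite mean_const; reflexivity).
    apply Re_mean_mono; [intros t; apply contC_const|exact HG|]. intros t Ht. simpl.
    eapply Rle_trans; [apply Cmod_ge_0|apply B; exact Ht].
Qed.

(** * Sesquilinear forms of kernels and positivity *)

(** The inner mean runs over t alone, so that Fourier coefficients of a kernel in t can be inserted
    before the mean over u is taken. *)
Definition form (K : R -> R -> C) (s1 s2 : R -> C) : C :=
  mean (fun u => mean (fun t => K t u * s1 t) * Cconj (s2 u))%C.

Section Form.
Variables s1 s2 : R -> C.
Hypotheses (C1 : Ccontinuous s1) (C2 : Ccontinuous s2).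

Lemma form_inner_cont K : jointC K -> Ccontinuous (fun u => mean (fun t => K t u * s1 t))%C.
Proof. intros H. apply (mean_param (fun t u => K t u * s1 t)%C). apply jointC_mult; [exact H|apply jointC_fst, C1]. Qed.

Lemma form_outer_cont K : jointC K -> Ccontinuous (fun u => mean (fun t => K t u * s1 t) * Cconj (s2 u))%C.
Proof. intros H u. apply contC_mult; [apply form_inner_cont; exact H|apply contC_conj, C2]. Qed.

Lemma form_slice_cont K u : jointC K -> Ccontinuous (fun t => K t u * s1 t)%C.
Proof. intros H t. apply contC_mult; [apply jointC_slice_fst; exact H|apply C1]. Qed.

Lemma form_ext K L : (forall t u, K t u = L t u) -> form K s1 s2 = form L s1 s2.
Proof. intros H. unfold form. apply mean_ext. intros u. f_equal. apply mean_ext. intros t. rewrite H; reflexivity. Qed.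

Lemma form_plus K L : jointC K -> jointC L -> form (fun t u => K t u + L t u)%C s1 s2 = (form K s1 s2 + form L s1 s2)%C.
Proof.
  intros H H'. unfold form. rewrite <- mean_plus by (apply form_outer_cont; assumption).
  apply mean_ext. intros u. rewrite <- Cmult_plus_distr_r. f_equal.
  rewrite <- mean_plus by (apply form_slice_cont; assumption). apply mean_ext. intros t; ring.
Qed.

Lemma form_scal c K : jointC K -> form (fun t u => c * K t u)%C s1 s2 = (c * form K s1 s2)%C.
Proof.
  intros H. unfold form. rewrite <- mean_scal by (apply form_outer_cont; assumption).
  apply mean_ext. intros u. rewrite Cmult_assoc. f_equal.
  rewrite <- mean_scal by (apply form_slice_cont; assumption). apply mean_ext. intros t; ring.
Qed.

(** The majorant enters through its double mean and not its supremum: the regularization error is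
    small only in the mean. *)
Lemma form_bound K (G : R -> R -> R) S1 S2 : jointC K -> jointC (fun t u => RtoC (G t u)) ->
  (forall t, 0 <= t <= 2 * PI -> Cmod (s1 t) <= S1) -> (forall t, 0 <= t <= 2 * PI -> Cmod (s2 t) <= S2) ->
  (forall t u, 0 <= t <= 2 * PI -> 0 <= u <= 2 * PI -> Cmod (K t u) <= G t u) ->
  Cmod (form K s1 s2) <= S1 * S2 * Re (mean (fun u => mean (fun t => RtoC (G t u)))).
Proof.
  intros H HG B1 B2 B.
  assert (P := two_PI_pos).
  assert (S10 : 0 <= S1) by (eapply Rle_trans; [|apply (B1 0); lra]; apply Cmod_ge_0).
  assert (Cg := mean_param _ HG).
  assert (Cg' : forall c, Ccontinuous (fun u => RtoC (c * Re (mean (fun t => RtoC (G t u)))))).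
  { intros c u. apply (contC_ext (fun u => c * mean (fun t => RtoC (G t u)))%C).
    - intros v. rewrite (mean_real (fun t => G t v)) at 1. rewrite RtoC_mult; reflexivity.
    - apply contC_mult; [apply contC_const|apply Cg]. }
  replace (S1 * S2 * Re (mean (fun u => mean (fun t => RtoC (G t u)))))
    with (Re (mean (fun u => RtoC (S1 * S2 * Re (mean (fun t => RtoC (G t u))))))).
  2: { rewrite <- re_scal_l, <- mean_scal by exact Cg. f_equal. apply mean_ext. intros u.
       rewrite (mean_real (fun t => G t u)) at 2. rewrite <- RtoC_mult. reflexivity. }
  apply Cmod_mean_le_fun; [apply form_outer_cont; exact H|apply Cg'|].
  intros u Hu. rewrite Cmod_mult, Cmod_conj.
  replace (S1 * S2 * Re (mean (fun t => RtoC (G t u)))) with ((S1 * Re (mean (fun t => RtoC (G t u)))) * S2) by ring.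
  apply Rmult_le_compat; try apply Cmod_ge_0; [|apply B2; exact Hu].
  rewrite <- re_scal_l, <- mean_scal by (apply (jointC_slice_fst (fun t u => RtoC (G t u))), HG).
  rewrite (mean_ext (fun t => S1 * G t u)%C (fun t => RtoC (S1 * G t u))) by (intros; rewrite RtoC_mult; reflexivity).
  apply Cmod_mean_le_fun; [apply form_slice_cont; exact H| |].
  - intros t. apply (contC_ext (fun t => S1 * G t u)%C); [intros; rewrite RtoC_mult; reflexivity|].
    apply contC_mult; [apply contC_const|apply (jointC_slice_fst (fun t u => RtoC (G t u))), HG].
  - intros t Ht. rewrite Cmod_mult, Rmult_comm. apply Rmult_le_compat; try apply Cmod_ge_0; auto.
Qed.

End Form.

(* Cauchy-Schwarz in additive form; [s2 = 0] gives positive semidefiniteness. *)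
Definition positive_kernel (K : R -> R -> C) : Prop :=
  jointC K /\ forall s1 s2, Ccontinuous s1 -> Ccontinuous s2 ->
    2 * Re (form K s1 s2) <= Re (form K s1 s1) + Re (form K s2 s2).

Lemma positive_kernel_1 : positive_kernel (fun _ _ => 1%C).
Proof.
  split; [apply jointC_const|]. intros s1 s2 C1 C2.
  assert (E : forall a b, Ccontinuous a -> Ccontinuous b -> form (fun _ _ => 1%C) a b = (mean a * Cconj (mean b))%C).
  { intros a b Ca Cb. unfold form. rewrite <- mean_conj, <- mean_scal by (try exact Cb; intros t; apply contC_conj, Cb).
    apply mean_ext. intros u. f_equal. apply mean_ext. intros t; ring. }
  rewrite !E by assumption. destruct (mean s1) as [a b], (mean s2) as [c d]. simpl.
  generalize (pow2_ge_0 (a - c)) (pow2_ge_0 (b - d)). lra.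
Qed.

Lemma positive_kernel_plus K L : positive_kernel K -> positive_kernel L -> positive_kernel (fun t u => K t u + L t u)%C.
Proof.
  intros [JK PK] [JL PL]. split; [apply jointC_plus; assumption|]. intros s1 s2 C1 C2.
  rewrite !form_plus, !re_plus by assumption. specialize (PK s1 s2 C1 C2). specialize (PL s1 s2 C1 C2). lra.
Qed.

Lemma positive_kernel_scal (c : R) K : 0 <= c -> positive_kernel K -> positive_kernel (fun t u => c * K t u)%C.
Proof.
  intros Hc [JK PK]. split; [apply jointC_mult; [apply jointC_const|assumption]|]. intros s1 s2 C1 C2.
  rewrite !form_scal, !re_scal_l by assumption. specialize (PK s1 s2 C1 C2).
  rewrite <- Rmult_plus_distr_l, (Rmult_comm 2), Rmult_assoc, (Rmult_comm _ 2). apply Rmult_le_compat_l; assumption.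
Qed.

(** The factor v is absorbed into the densities. Summing such products gives the Schur product with
    a Gram kernel of finite rank. *)
Lemma positive_kernel_mult_rank1 v K : Ccontinuous v -> positive_kernel K ->
  positive_kernel (fun t u => K t u * (v t * Cconj (v u)))%C.
Proof.
  intros Cv [JK PK]. split.
  { apply jointC_mult; [exact JK|]. apply (jointC_mult (fun t _ => v t) (fun _ u => Cconj (v u))).
    - apply jointC_fst, Cv.
    - apply (jointC_snd (fun u => Cconj (v u))). intros u; apply contC_conj, Cv. }
  intros s1 s2 C1 C2.
  assert (Cvs : forall s, Ccontinuous s -> Ccontinuous (fun t => v t * s t)%C) by (intros s Cs t; apply contC_mult; auto).
  assert (E : forall a b, Ccontinuous a -> Ccontinuous b ->
    form (fun t u => K t u * (v t * Cconj (v u)))%C a b = form K (fun t => v t * a t)%C (fun t => v t * b t)%C).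
  { intros a b Ca Cb. unfold form. apply mean_ext. intros u. rewrite Cmult_conj, Cmult_assoc. f_equal.
    rewrite Cmult_comm, <- mean_scal by (apply form_slice_cont; auto). apply mean_ext. intros t; ring. }
  rewrite !E by assumption. apply PK; auto.
Qed.

Lemma positive_kernel_ext K L : (forall t u, K t u = L t u) -> positive_kernel K -> positive_kernel L.
Proof.
  intros E [JK PK]. split.
  - intros p. eapply contC_ext; [|apply (JK p)]. intros y. apply E.
  - intros s1 s2 C1 C2. rewrite <- !(form_ext _ _ K L E). apply PK; assumption.
Qed.

Lemma form_limit K (Kn : nat -> R -> R -> C) M x s1 s2 : jointC K -> (forall n, jointC (Kn n)) -> 0 <= x < 1 ->
  Ccontinuous s1 -> Ccontinuous s2 ->
  (forall n t u, 0 <= t <= 2 * PI -> 0 <= u <= 2 * PI -> Cmod (Kn n t u - K t u) <= M * x ^ n) ->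
  Clim (fun n => form (Kn n) s1 s2) (form K s1 s2).
Proof.
  intros JK JKn Hx C1 C2 B.
  destruct (Ccontinuous_bounded s1 C1) as [S1 B1]. destruct (Ccontinuous_bounded s2 C2) as [S2 B2].
  apply (Clim_geom _ _ (S1 * S2 * M) x Hx). intros n.
  assert (Jd : jointC (fun t u => Kn n t u + (-1) * K t u)%C).
  { apply jointC_plus; [apply JKn|]. apply (jointC_mult (fun _ _ => -1)%C K); [apply jointC_const|exact JK]. }
  replace (form (Kn n) s1 s2 - form K s1 s2)%C with (form (fun t u => Kn n t u + (-1) * K t u)%C s1 s2).
  - eapply Rle_trans; [apply (form_bound s1 s2 C1 C2 _ (fun _ _ => M * x ^ n) S1 S2 Jd)|].
    + apply jointC_const.
    + exact B1.
    + exact B2.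
    + intros t u Ht Hu. replace (Kn n t u + (-1) * K t u)%C with (Kn n t u - K t u)%C by ring. apply B; assumption.
    + rewrite !mean_const, re_RtoC. lra.
  - rewrite form_plus, form_scal; try assumption; [ring|apply JKn|].
    apply (jointC_mult (fun _ _ => -1)%C K); [apply jointC_const|exact JK].
Qed.

Lemma Clim_Re_nonneg u l : Clim u l -> (forall n, 0 <= Re (u n)) -> 0 <= Re l.
Proof.
  intros H P. apply Rnot_lt_le. intros L. destruct (H (- Re l)) as [N HN]; [lra|].
  specialize (HN N (Nat.le_refl N)). specialize (P N).
  generalize (re_le_Cmod (u N - l)). rewrite re_minus. intros A. generalize (Rle_abs (Re (u N) - Re l)). lra.
Qed.

Lemma positive_kernel_limit K Kn M x : jointC K -> 0 <= x < 1 -> (forall n, positive_kernel (Kn n)) ->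
  (forall n t u, 0 <= t <= 2 * PI -> 0 <= u <= 2 * PI -> Cmod (Kn n t u - K t u) <= M * x ^ n) ->
  positive_kernel K.
Proof.
  intros JK Hx HP B. split; [exact JK|]. intros s1 s2 C1 C2.
  assert (JKn : forall n, jointC (Kn n)) by (intros n; apply HP).
  assert (L12 := form_limit K Kn M x s1 s2 JK JKn Hx C1 C2 B).
  assert (L11 := form_limit K Kn M x s1 s1 JK JKn Hx C1 C1 B).
  assert (L22 := form_limit K Kn M x s2 s2 JK JKn Hx C2 C2 B).
  assert (L := Clim_minus _ _ _ _ (Clim_plus _ _ _ _ L11 L22) (Clim_scal 2 _ _ L12)).
  apply Clim_Re_nonneg in L.
  - rewrite re_minus, re_plus, re_scal_l in L. lra.
  - intros n. rewrite re_minus, re_plus, re_scal_l. destruct (HP n) as [_ HPn]. specialize (HPn s1 s2 C1 C2). lra.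
Qed.

(** Partial sums of - ln (1 - x); their nonnegative coefficients preserve positivity of kernels. *)
Fixpoint log_series (n : nat) (x : R) : R :=
  match n with O => 0 | S k => log_series k x + x ^ S k / INR (S k) end.

Lemma is_derive_log_series n x : is_derive (log_series n) x (sum_f_R0 (fun k => x ^ k) n - x ^ n).
Proof.
  induction n as [|n IH].
  - evar_last; [apply (is_derive_const (K := R_AbsRing) (V := R_NormedModule) 0)|]. unfold zero; simpl; ring.
  - evar_last.
    + apply (is_derive_plus (K := R_AbsRing) (V := R_NormedModule) (log_series n) (fun x => x ^ S n / INR (S n)) x _ (x ^ n) IH).
      auto_derive; [exact I|]. change (match n with 0%nat => 1 | S _ => INR n + 1 end) with (INR (S n)).
      simpl pred. field. apply not_0_INR; lia.
    + rewrite tech5. unfold plus; simpl. ring.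
Qed.

(** The remainder vanishes at 0 and has derivative y^n / (1 - y), so the mean value theorem bounds
    it. *)
Lemma log_series_bound n x q : Rabs x <= q -> 0 <= q < 1 -> Rabs (- ln (1 - x) - log_series n x) <= q ^ n / (1 - q).
Proof.
  intros Hx Hq.
  assert (D : forall y, Rabs y <= q -> is_derive (fun y => - ln (1 - y) - log_series n y) y (y ^ n / (1 - y))).
  { intros y Hy. apply Rabs_le_between in Hy.
    evar_last.
    - apply (is_derive_minus (K := R_AbsRing) (V := R_NormedModule) (fun y => - ln (1 - y)) (log_series n) y (/ (1 - y)) (sum_f_R0 (fun k => y ^ k) n - y ^ n)).
      + auto_derive; [lra|]. field. lra.
      + apply is_derive_log_series.
    - unfold minus, plus, opp; simpl.
      assert (G : sum_f_R0 (fun k => y ^ k) n = (1 - y ^ S n) / (1 - y)) by (apply tech3; lra).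
      rewrite G. simpl. field. lra. }
  destruct (MVT_gen (fun y => - ln (1 - y) - log_series n y) 0 x (fun y => y ^ n / (1 - y))) as [c [Hc E]].
  - intros y Hy. apply D. apply Rabs_le. apply Rabs_le_between in Hx. revert Hy. unfold Rmin, Rmax. destruct (Rle_dec 0 x); lra.
  - intros y Hy. apply derivable_continuous_pt. exists (y ^ n / (1 - y)). apply is_derive_Reals, D.
    apply Rabs_le. apply Rabs_le_between in Hx. revert Hy. unfold Rmin, Rmax. destruct (Rle_dec 0 x); lra.
  - assert (E0 : - ln (1 - 0) - log_series n 0 = 0).
    { rewrite Rminus_0_r, ln_1. clear. induction n as [|n IH]; simpl; [ring|]. simpl in IH. lra. }
    rewrite E0 in E. rewrite Rminus_0_r in E. rewrite E, Rminus_0_r.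
    assert (Hcq : Rabs c <= q).
    { apply Rabs_le. apply Rabs_le_between in Hx. revert Hc. unfold Rmin, Rmax. destruct (Rle_dec 0 x); lra. }
    rewrite Rabs_mult. unfold Rdiv. rewrite Rabs_mult, <- RPow_abs, Rabs_inv.
    assert (A1 : Rabs c ^ n <= q ^ n) by (apply pow_incr; split; [apply Rabs_pos|exact Hcq]).
    assert (A2 : / Rabs (1 - c) <= / (1 - q)).
    { apply Rinv_le_contravar; [lra|]. apply Rabs_le_between in Hcq. rewrite Rabs_pos_eq; lra. }
    assert (A0 : 0 <= / Rabs (1 - c)).
    { left. apply Rinv_0_lt_compat. apply Rabs_le_between in Hcq. rewrite Rabs_pos_eq; lra. }
    rewrite <- (Rmult_1_r (q ^ n * / (1 - q))). apply Rmult_le_compat; try apply Rabs_pos.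
    + apply Rmult_le_pos; [apply pow_le, Rabs_pos|exact A0].
    + apply Rmult_le_compat; try assumption. apply pow_le, Rabs_pos.
    + lra.
Qed.

Lemma continuous_ln_comp {U : UniformSpace} (f : U -> R) x : 0 < f x -> continuous f x -> continuous (fun y => ln (f y)) x.
Proof.
  intros P H. apply (continuous_comp f ln); [exact H|]. apply continuity_pt_filterlim.
  apply derivable_continuous_pt. exists (/ f x). apply derivable_pt_lim_ln, P.
Qed.

Lemma contC_Cmod2 {U : UniformSpace} (F : U -> C) x : contC F x -> continuous (fun y => Cmod (F y) ^ 2) x.
Proof.
  intros H. apply (continuous_comp (fun y => Cmod (F y)) (fun r => r ^ 2)); [apply continuous_Cmod, H|].
  apply continuity_pt_filterlim. apply derivable_continuous_pt, derivable_pt_pow.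
Qed.

Section LogKernel.
Variables (w : R -> C) (tau : R).
Hypotheses (Cw : Ccontinuous w) (Htau : 0 < tau).

Let a t := Cmod (w t) ^ 2 + tau.
(** The coordinates |w|^2 / a, sqrt tau w / a, sqrt tau conj w / a and tau / a form a unit vector, a
    stereographic lift of w, and two such vectors have inner product 1 - tau |w - w'|^2 / (a a').
    Dropping the last coordinate gives [kap] and keeps it away from 1. *)
Let kap t u := 1 - tau * (Cmod (w t - w u) ^ 2 + tau) / (a t * a u).

Let a_pos t : tau <= a t.
Proof. unfold a. generalize (pow2_ge_0 (Cmod (w t))). lra. Qed.

Let Ca : Ccontinuous (fun t => RtoC (a t)).
Proof.
  intros t. apply contC_RtoC. apply (continuous_plus (V := R_NormedModule) (fun t => Cmod (w t) ^ 2) (fun _ => tau));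
  [apply contC_Cmod2, Cw|apply continuous_const].
Qed.

Let Ra_neq0 t : RtoC (a t) <> 0%C.
Proof. apply RtoC_neq0. generalize (a_pos t). lra. Qed.

(* [1 - kap] is proportional to [|w t - w u|^2 + tau], and [kap] is a Gram kernel of rank three. *)
Let kap_rank3 t u : RtoC (kap t u) =
  (Cmod (w t) ^ 2 / a t * Cconj (Cmod (w u) ^ 2 / a u)
   + sqrt tau * w t / a t * Cconj (sqrt tau * w u / a u)
   + sqrt tau * Cconj (w t) / a t * Cconj (sqrt tau * Cconj (w u) / a u))%C.
Proof.
  assert (Cr : forall r : R, Cconj r = r) by (intros r; apply Ceq_ReIm; simpl; ring).
  assert (E : RtoC (kap t u) = ((a t * a u - tau * ((w t - w u) * Cconj (w t - w u) + tau)) / (a t * a u))%C).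
  { unfold kap. rewrite RtoC_minus, RtoC_div, !RtoC_mult, RtoC_plus, Cmod2_conj.
    - field. split; apply Ra_neq0.
    - apply Rmult_integral_contrapositive_currified; generalize (a_pos t) (a_pos u); lra. }
  assert (Es : (sqrt tau * sqrt tau = tau :> C)%C) by (rewrite <- RtoC_mult, sqrt_sqrt by lra; reflexivity).
  assert (Ea : forall t, (a t = w t * Cconj (w t) + tau :> C)%C).
  { intros v. unfold a. rewrite RtoC_plus, Cmod2_conj. reflexivity. }
  rewrite E, !Cdiv_conj by apply Ra_neq0.
  rewrite Cpow_conj, !Cmult_conj, Cconj_conj, !Cr, Cminus_conj, <- !RtoC_pow, !Cmod2_conj.
  transitivity (((w t * Cconj (w t)) * (w u * Cconj (w u)) + (sqrt tau * sqrt tau) * (w t * Cconj (w u)) +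
     (sqrt tau * sqrt tau) * (Cconj (w t) * w u)) / (a t * a u))%C.
  - rewrite Es. unfold Cdiv. f_equal. rewrite !Ea. ring.
  - field. split; apply Ra_neq0.
Qed.

Let jointC_kap : jointC (fun t u => RtoC (kap t u)).
Proof.
  intros p. apply contC_RtoC.
  assert (W1 := jointC_fst w Cw p). assert (W2 := jointC_snd w Cw p).
  assert (A1 := proj1 (jointC_fst _ Ca p)). assert (A2 := proj1 (jointC_snd _ Ca p)). simpl in A1, A2.
  assert (N1 := a_pos (fst p)). assert (N2 := a_pos (snd p)).
  apply (continuous_minus (V := R_NormedModule) (fun _ => 1) (fun p => tau * (Cmod (w (fst p) - w (snd p)) ^ 2 + tau) / (a (fst p) * a (snd p))));
    [apply continuous_const|].
  apply (continuous_mult (K := R_AbsRing)).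
  - apply (continuous_mult (K := R_AbsRing) (fun _ => tau)); [apply continuous_const|].
    apply (continuous_plus (V := R_NormedModule) (fun p => Cmod (w (fst p) - w (snd p)) ^ 2) (fun _ => tau)); [|apply continuous_const].
    apply contC_Cmod2, contC_minus; assumption.
  - apply (continuous_comp (fun p => a (fst p) * a (snd p)) Rinv).
    + apply (continuous_mult (K := R_AbsRing) (fun p => a (fst p)) (fun p => a (snd p))); assumption.
    + apply continuity_pt_filterlim, continuity_pt_inv; [apply derivable_continuous_pt, derivable_pt_id|].
      apply Rmult_integral_contrapositive_currified; lra.
Qed.

Let positive_kernel_pow n : positive_kernel (fun t u => RtoC (kap t u ^ n)).
Proof.
  induction n as [|n IH]; [exact positive_kernel_1|].
  assert (C1 : Ccontinuous (fun t => Cmod (w t) ^ 2 / a t)%C).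
  { intros t. apply contC_div; [apply Ra_neq0| |apply Ca].
    apply (contC_ext (fun t => RtoC (Cmod (w t) ^ 2))); [intros; apply RtoC_pow|]. apply contC_RtoC, contC_Cmod2, Cw. }
  assert (C2 : Ccontinuous (fun t => sqrt tau * w t / a t)%C).
  { intros t. apply contC_div; [apply Ra_neq0|apply contC_mult; [apply contC_const|apply Cw]|apply Ca]. }
  assert (C3 : Ccontinuous (fun t => sqrt tau * Cconj (w t) / a t)%C).
  { intros t. apply contC_div; [apply Ra_neq0|apply contC_mult; [apply contC_const|apply contC_conj, Cw]|apply Ca]. }
  eapply positive_kernel_ext; [|exact (positive_kernel_plus _ _ (positive_kernel_plus _ _
    (positive_kernel_mult_rank1 _ _ C1 IH) (positive_kernel_mult_rank1 _ _ C2 IH)) (positive_kernel_mult_rank1 _ _ C3 IH))].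
  intros t u. cbv beta. rewrite <- !Cmult_plus_distr_l, <- kap_rank3, <- RtoC_mult. f_equal. simpl. ring.
Qed.

Let positive_kernel_log_series n : positive_kernel (fun t u => RtoC (log_series n (kap t u))).
Proof.
  induction n as [|n IH].
  - apply (positive_kernel_ext (fun t u => 0%R * RtoC (kap t u ^ 0))%C); [intros; simpl; ring|].
    apply positive_kernel_scal; [lra|apply positive_kernel_pow].
  - eapply positive_kernel_ext; [|exact (positive_kernel_plus _ _ IH
      (positive_kernel_scal (/ INR (S n)) _ (Rlt_le _ _ (Rinv_0_lt_compat _ (lt_0_INR (S n) (Nat.lt_0_succ n)))) (positive_kernel_pow (S n))))].
    intros t u. cbv beta. rewrite <- RtoC_mult, <- RtoC_plus. f_equal.
    change (log_series (S n) (kap t u)) with (log_series n (kap t u) + kap t u ^ S n / INR (S n)). unfold Rdiv. ring.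
Qed.

(** Over one period a <= A for some A, and the dropped coordinate leaves |kap| <= 1 - tau^2 / A^2.
    This makes the logarithmic series converge uniformly. *)
Let kap_bound : exists q, 0 <= q < 1 /\ forall t u, 0 <= t <= 2 * PI -> 0 <= u <= 2 * PI -> Rabs (kap t u) <= q.
Proof.
  destruct (Ccontinuous_bounded _ Ca) as [A HA]. assert (P := two_PI_pos).
  assert (HA' : forall t, 0 <= t <= 2 * PI -> a t <= A).
  { intros t Ht. specialize (HA t Ht). rewrite Cmod_R, Rabs_pos_eq in HA by (generalize (a_pos t); lra). exact HA. }
  assert (A0 : tau <= A) by (generalize (a_pos 0) (HA' 0 ltac:(lra)); lra).
  assert (Q : 0 < tau ^ 2 / A ^ 2 <= 1).
  { assert (0 < A ^ 2) by (apply pow_lt; lra). split.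
    - apply Rdiv_lt_0_compat; [apply pow_lt; lra|assumption].
    - apply Rle_div_l; [assumption|]. rewrite Rmult_1_l. apply pow_incr; lra. }
  exists (1 - tau ^ 2 / A ^ 2). split; [lra|]. intros t u Ht Hu.
  assert (At := a_pos t). assert (Au := a_pos u). assert (Bt := HA' t Ht). assert (Bu := HA' u Hu).
  assert (Pa : 0 < a t * a u) by (apply Rmult_lt_0_compat; lra).
  assert (L : tau ^ 2 / A ^ 2 <= tau ^ 2 / (a t * a u)).
  { unfold Rdiv. apply Rmult_le_compat_l; [apply pow_le; lra|]. apply Rinv_le_contravar; [exact Pa|].
    simpl. rewrite Rmult_1_r. apply Rmult_le_compat; lra. }
  assert (Lo : tau ^ 2 / (a t * a u) <= tau * (Cmod (w t - w u) ^ 2 + tau) / (a t * a u)).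
  { unfold Rdiv. apply Rmult_le_compat_r; [left; apply Rinv_0_lt_compat, Pa|].
    generalize (pow2_ge_0 (Cmod (w t - w u))). nra. }
  assert (Up : tau * (Cmod (w t - w u) ^ 2 + tau) / (a t * a u) <= 2 - tau ^ 2 / (a t * a u)).
  { apply Rle_div_l; [exact Pa|].
    replace ((2 - tau ^ 2 / (a t * a u)) * (a t * a u)) with (2 * (a t * a u) - tau ^ 2) by (field; generalize (a_pos t) (a_pos u); lra).
    assert (X : Cmod (w t - w u) ^ 2 <= 2 * Cmod (w t) ^ 2 + 2 * Cmod (w u) ^ 2).
    { rewrite !Cmod2_alt, re_minus, im_minus.
      generalize (pow2_ge_0 (Re (w t) + Re (w u))) (pow2_ge_0 (Im (w t) + Im (w u))). nra. }
    unfold a. generalize (pow2_ge_0 (Cmod (w t))) (pow2_ge_0 (Cmod (w u))). intros X1 X2.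
    assert (0 <= Cmod (w t) ^ 2 * Cmod (w u) ^ 2) by (apply Rmult_le_pos; assumption). nra. }
  apply Rabs_le. unfold kap. lra.
Qed.

Let positive_kernel_neg_ln : positive_kernel (fun t u => RtoC (- ln (1 - kap t u))).
Proof.
  destruct kap_bound as [q [Hq B]].
  assert (P : forall t u, 0 < 1 - kap t u).
  { intros t u. unfold kap. ring_simplify (1 - (1 - tau * (Cmod (w t - w u) ^ 2 + tau) / (a t * a u))).
    generalize (a_pos t) (a_pos u) (pow2_ge_0 (Cmod (w t - w u))). intros.
    apply Rdiv_lt_0_compat; apply Rmult_lt_0_compat; lra. }
  apply (positive_kernel_limit _ (fun n t u => RtoC (log_series n (kap t u))) (/ (1 - q)) q).
  - intros p. apply contC_RtoC. apply (continuous_opp (V := R_NormedModule) (fun p => ln (1 - kap (fst p) (snd p)))).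
    apply continuous_ln_comp; [apply P|].
    apply (continuous_minus (V := R_NormedModule) (fun _ => 1) (fun p => kap (fst p) (snd p))); [apply continuous_const|apply (jointC_kap p)].
  - exact Hq.
  - exact positive_kernel_log_series.
  - intros n t u Ht Hu. rewrite Cmod_minus_sym, <- RtoC_minus, Cmod_R.
    eapply Rle_trans; [apply (log_series_bound n _ q); [apply B; assumption|exact Hq]|]. right; field; lra.
Qed.

Definition log_kernel (t u : R) : C := RtoC (- ln (Cmod (w t - w u) ^ 2 + tau)).

Lemma jointC_log_kernel : jointC log_kernel.
Proof.
  intros p. apply contC_RtoC. apply (continuous_opp (V := R_NormedModule) (fun p => ln (Cmod (w (fst p) - w (snd p)) ^ 2 + tau))).
  apply continuous_ln_comp; [generalize (pow2_ge_0 (Cmod (w (fst p) - w (snd p)))); lra|].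
  apply (continuous_plus (V := R_NormedModule) (fun p => Cmod (w (fst p) - w (snd p)) ^ 2) (fun _ => tau)); [|apply continuous_const].
  apply contC_Cmod2, contC_minus; [apply (jointC_fst w Cw p)|apply (jointC_snd w Cw p)].
Qed.

(** - ln (|w - w'|^2 + tau) equals - ln (1 - kap) + ln tau - ln a(t) - ln a(u). The terms in one
    variable vanish against densities of mean zero, and the first is a positive kernel. *)
Theorem log_energy_nonneg s1 s2 : Ccontinuous s1 -> Ccontinuous s2 -> mean s1 = 0%C -> mean s2 = 0%C ->
  2 * Re (form log_kernel s1 s2) <= Re (form log_kernel s1 s1) + Re (form log_kernel s2 s2).
Proof.
  intros C1 C2 M1 M2.
  assert (Cl : Ccontinuous (fun t => RtoC (- ln (a t)))).
  { intros t. apply contC_RtoC, (continuous_opp (V := R_NormedModule) (fun t => ln (a t))).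
    apply continuous_ln_comp; [generalize (a_pos t); lra|apply (Ca t)]. }
  assert (J1 : jointC (fun t _ => RtoC (- ln (a t)))) by (apply jointC_fst, Cl).
  assert (J2 : jointC (fun _ u => RtoC (- ln (a u) + ln tau))).
  { apply (jointC_snd (fun u => RtoC (- ln (a u) + ln tau))). intros u. apply contC_RtoC.
    apply (continuous_plus (V := R_NormedModule) (fun u => - ln (a u)) (fun _ => ln tau)); [apply (Cl u)|apply continuous_const]. }
  assert (J3 := proj1 positive_kernel_neg_ln).
  assert (Z1 : forall r s, Ccontinuous r -> Ccontinuous s -> mean s = 0%C -> form (fun t _ => RtoC (- ln (a t))) r s = 0%C).
  { intros r s Cr Cs Ms. unfold form.
    rewrite mean_scal, mean_conj by (try exact Cs; intros t; apply contC_conj, Cs). rewrite Ms. apply Ceq_ReIm; simpl; ring. }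
  assert (Z2 : forall r s, Ccontinuous r -> mean r = 0%C -> form (fun _ u => RtoC (- ln (a u) + ln tau)) r s = 0%C).
  { intros r s Cr Mr. unfold form. rewrite <- (mean_const 0). apply mean_ext. intros u.
    rewrite mean_scal by exact Cr. rewrite Mr. ring. }
  assert (E : forall r s, Ccontinuous r -> Ccontinuous s -> mean r = 0%C -> mean s = 0%C ->
    form log_kernel r s = form (fun t u => RtoC (- ln (1 - kap t u))) r s).
  { intros r s Cr Cs Mr Ms.
    rewrite (form_ext r s log_kernel (fun t u => RtoC (- ln (a t)) + RtoC (- ln (a u) + ln tau) + RtoC (- ln (1 - kap t u)))%C).
    - rewrite !form_plus by (try assumption; apply jointC_plus; assumption). rewrite Z1, Z2 by assumption. ring.
    - intros t u. unfold log_kernel. rewrite <- !RtoC_plus. f_equal.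
      generalize (a_pos t) (a_pos u) (pow2_ge_0 (Cmod (w t - w u))). intros At Au X.
      replace (1 - kap t u) with (tau * (Cmod (w t - w u) ^ 2 + tau) / (a t * a u)) by (unfold kap; ring).
      rewrite ln_div, !ln_mult by (try apply Rmult_lt_0_compat; lra). ring. }
  rewrite !E by assumption. apply positive_kernel_neg_ln; assumption.
Qed.

End LogKernel.

(** * The area theorem *)

Lemma coef_const c n : coef (fun _ => c) (S n) = 0%C.
Proof.
  unfold coef.
  rewrite (mean_ext _ (fun t => c * (((/ 2)%R * cis t) ^ 0 / ((/ 2)%R * cis t) ^ S n))%C) by (intros; unfold Cdiv; simpl; ring).
  rewrite mean_scal, mean_circle_pow_quot by
    first [lra|intros t; apply contC_div; [apply Cpow_nz, circle_neq0; lra|apply contC_const|apply contC_pow, Ccontinuous_cis]].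
  destruct (Nat.eq_dec 0 (S n)); [lia|ring].
Qed.

Lemma RtoC_Cconj (r : R) : Cconj r = r.
Proof. apply Ceq_ReIm; simpl; ring. Qed.

Lemma Cconj_0 : Cconj 0 = 0%C.
Proof. apply RtoC_Cconj. Qed.

Lemma Cconj_Csum c n : Cconj (Csum c n) = Csum (fun k => Cconj (c k)) n.
Proof. induction n as [|n IH]; simpl; [apply Cconj_0|]. rewrite Cplus_conj, IH. reflexivity. Qed.

Lemma Ccontinuous_cis_pow n : Ccontinuous (fun t => cis t ^ n)%C.
Proof. intros t; apply contC_pow, contC_cis. Qed.

Lemma Ccontinuous_cis_pow_inv n : Ccontinuous (fun t => / cis t ^ n)%C.
Proof. intros t; apply contC_inv; [apply Cpow_nz, cis_neq0|apply contC_pow, contC_cis]. Qed.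

Lemma Cconj_cis_pow_inv t n : Cconj (/ cis t ^ n)%C = (cis t ^ n)%C.
Proof.
  rewrite Cinv_conj, Cpow_conj, <- cis_inv, Cpow_inv by (try apply cis_neq0; apply Cpow_nz, cis_neq0).
  field. apply Cpow_nz, cis_neq0.
Qed.

Section Geometric.
Variable x : R.
Hypothesis Hx : 0 < x < 1.

Definition geom_kernel_ln (t u : R) : R := ln (Cmod (1 - x * (cis t * Cconj (cis u))) ^ 2).

(** The parameter x is split as sqrt x * sqrt x: one factor enters the function 1 - v z, zero-free
    on the unit disk, the other is the radius of evaluation. The Fourier coefficients of ln |q|^2
    computed above then apply. *)
Let v u : C := (sqrt x * Cconj (cis u))%C.
Let q u (z : C) : C := (1 - v u * z)%C.

Let Hs : 0 < sqrt x < 1.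
Proof. split; [apply sqrt_lt_R0; lra|]. rewrite <- sqrt_1. apply sqrt_lt_1_alt; lra. Qed.

Let Hv u : Cmod (v u) < 1.
Proof. unfold v. rewrite Cmod_mult, Cmod_conj, Cmod_cis, Cmod_R, Rabs_pos_eq; lra. Qed.

Let Eq t u : geom_kernel_ln t u = ln (Cmod (q u (sqrt x * cis t)) ^ 2).
Proof.
  unfold geom_kernel_ln, q, v. do 4 f_equal.
  transitivity ((sqrt x * sqrt x) * (cis t * Cconj (cis u)))%C; [|ring].
  rewrite <- RtoC_mult, sqrt_sqrt by lra. reflexivity.
Qed.

Let q_cder u z : cder (q u) z (- v u).
Proof.
  replace (- v u)%C with (0 - v u * 1)%C by ring.
  apply cder_minus; [apply cder_const|apply cder_scal, cder_id].
Qed.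

Let q_hol u : hol 1 (q u).
Proof. intros z _. eexists. apply q_cder. Qed.

Let q_neq0 u z : Cmod z < 1 -> q u z <> 0%C.
Proof.
  intros Hz E. assert (E1 : (v u * z)%C = 1%C).
  { replace (v u * z)%C with (1 - q u z)%C by (unfold q; ring). rewrite E; ring. }
  apply (f_equal Cmod) in E1. rewrite Cmod_mult, Cmod_1 in E1.
  generalize (Hv u) (Cmod_ge_0 (v u)) (Cmod_ge_0 z). nra.
Qed.

Let m u (z : C) : C := (C_derive (q u) z / q u z)%C.

(** Comparison of coefficients in (1 - v z) m = - v. *)
Let coef_m u n : coef (m u) n = (- v u ^ S n)%C.
Proof.
  assert (Hm : hol 1 (m u)) by (apply log_deriv_hol; [apply q_hol|apply q_neq0]).
  induction n as [|n IH].
  - rewrite coef_0 by exact Hm. unfold m. rewrite (C_derive_cder _ _ _ (q_cder u 0)).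
    replace (q u 0) with (RtoC 1) by (unfold q; ring). unfold Cdiv. simpl. field.
  - assert (E : coef (fun z => m u z + (- v u) * (z * m u z))%C (S n) = coef (fun _ => - v u)%C (S n)).
    { apply coef_ext. intros z Hz. unfold m. rewrite (C_derive_cder _ _ _ (q_cder u z)).
      assert (N := q_neq0 u z Hz). unfold q in *. field. exact N. }
    assert (Hzm : hol 1 (fun z => z * m u z)%C) by (apply hol_mult; [apply hol_id|exact Hm]).
    rewrite coef_const, coef_plus, coef_scal, coef_mul_id_S, IH in E;
      [|exact Hzm|exact Hm|apply (hol_mult 1 (fun _ => - v u)%C); [apply hol_const|exact Hzm]].
    replace (coef (m u) (S n)) with (coef (m u) (S n) + - v u * - v u ^ S n - v u ^ S (S n))%C by (simpl; ring).
    rewrite E. ring.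
Qed.

Lemma geom_kernel_mean u : mean (fun t => RtoC (geom_kernel_ln t u)) = 0%C.
Proof.
  rewrite (mean_ext _ (fun t => RtoC (ln (Cmod (q u (sqrt x * cis t)) ^ 2)))) by (intros; rewrite Eq; reflexivity).
  rewrite (mean_ln_Cmod (q u) (q_hol u) (q_neq0 u)) by exact Hs.
  unfold q. replace (1 - v u * 0)%C with (RtoC 1) by ring. rewrite Cmod_1, pow1, ln_1. reflexivity.
Qed.

Lemma geom_kernel_mean_pow_inv u n :
  mean (fun t => RtoC (geom_kernel_ln t u) * / cis t ^ S n)%C = (- (x ^ S n / INR (S n))%R * / cis u ^ S n)%C.
Proof.
  rewrite (mean_ext _ (fun t => RtoC (ln (Cmod (q u (sqrt x * cis t)) ^ 2)) * / cis t ^ S n)%C) by (intros; rewrite Eq; reflexivity).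
  rewrite (mean_ln_Cmod_pow_inv (q u) (q_hol u) (q_neq0 u)) by exact Hs.
  fold (m u). rewrite coef_m. unfold v. rewrite Cpow_mult_l, <- cis_inv, Cpow_inv by apply cis_neq0.
  rewrite RtoC_div, RtoC_pow by (apply not_0_INR; lia).
  replace (RtoC x) with (sqrt x * sqrt x)%C by (rewrite <- RtoC_mult, sqrt_sqrt by lra; reflexivity).
  rewrite Cpow_mult_l. field. split; [apply Cpow_nz, cis_neq0|apply RtoC_neq0, not_0_INR; lia].
Qed.

Lemma geom_kernel_mean_cis u : mean (fun t => RtoC (geom_kernel_ln t u) * cis t)%C = (- x * cis u)%C.
Proof.
  rewrite (mean_ext _ (fun t => RtoC (ln (Cmod (q u (sqrt x * cis t)) ^ 2)) * cis t ^ 1)%C)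
    by (intros; rewrite Eq, Cpow_1_r; reflexivity).
  rewrite (mean_ln_Cmod_pow (q u) (q_hol u) (q_neq0 u)) by exact Hs.
  fold (m u). rewrite coef_m. unfold v.
  replace (sqrt x ^ 1 * (- (sqrt x * Cconj (cis u)) ^ 1 / INR 1))%C with (- x * Cconj (cis u))%C.
  - rewrite Cmult_conj, Copp_conj, RtoC_Cconj, Cconj_conj. reflexivity.
  - replace (RtoC x) with (sqrt x * sqrt x)%C by (rewrite <- RtoC_mult, sqrt_sqrt by lra; reflexivity).
    simpl. field.
Qed.

Lemma geom_kernel_pos t u : 0 < Cmod (1 - x * (cis t * Cconj (cis u))) ^ 2.
Proof.
  apply pow_lt, Cmod_gt_0, Cminus_neq0. intros E. apply (f_equal Cmod) in E.
  rewrite !Cmod_mult, Cmod_conj, !Cmod_cis, Cmod_1, Cmod_R, Rabs_pos_eq in E; lra.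
Qed.

Lemma jointC_geom_kernel : jointC (fun t u => RtoC (geom_kernel_ln t u)).
Proof.
  intros p. apply contC_RtoC.
  apply (continuous_ln_comp (fun p => Cmod (1 - x * (cis (fst p) * Cconj (cis (snd p)))) ^ 2)); [apply geom_kernel_pos|].
  apply contC_Cmod2, contC_minus; [apply contC_const|]. apply contC_mult; [apply contC_const|].
  apply contC_mult; [apply (jointC_fst cis contC_cis p)|apply contC_conj, (jointC_snd cis contC_cis p)].
Qed.

End Geometric.

Section CircleKernel.
Variables rho eta : R.
Hypotheses (Hrho : 0 < rho < 1) (Heta : 0 < eta).

(** The identity rho^2 |e^(it) - e^(iu)|^2 + eta^2 = alpha^2 |1 - x e^(i(t-u))|^2 requires alpha^2 x
    = rho^2 and alpha (1 - x) = eta, so alpha is the positive root of alpha^2 - eta alpha - rho^2 =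
    0. The regularized kernel of the circle thus becomes a constant plus [geom_kernel_ln]. *)
Definition circle_alpha : R := (eta + sqrt (eta ^ 2 + 4 * rho ^ 2)) / 2.
Definition circle_ratio : R := rho ^ 2 / circle_alpha ^ 2.

Lemma circle_alpha_eq : circle_alpha ^ 2 - eta * circle_alpha - rho ^ 2 = 0.
Proof.
  unfold circle_alpha. assert (S := sqrt_sqrt (eta ^ 2 + 4 * rho ^ 2)).
  assert (0 <= eta ^ 2 + 4 * rho ^ 2) by nra. specialize (S H).
  set (s := sqrt (eta ^ 2 + 4 * rho ^ 2)) in *. nra.
Qed.

Lemma circle_alpha_bounds : rho < circle_alpha <= eta + rho.
Proof.
  unfold circle_alpha. split.
  - assert (2 * rho <= sqrt (eta ^ 2 + 4 * rho ^ 2)); [|lra].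
    rewrite <- (sqrt_pow2 (2 * rho)) by lra. apply sqrt_le_1_alt. nra.
  - assert (sqrt (eta ^ 2 + 4 * rho ^ 2) <= eta + 2 * rho); [|lra].
    rewrite <- (sqrt_pow2 (eta + 2 * rho)) by lra. apply sqrt_le_1_alt. nra.
Qed.

Lemma circle_ratio_bounds : 0 < circle_ratio < 1.
Proof.
  assert (B := circle_alpha_bounds). unfold circle_ratio.
  assert (0 < circle_alpha ^ 2) by (apply pow_lt; lra). split.
  - apply Rdiv_lt_0_compat; [apply pow_lt; lra|assumption].
  - apply Rlt_div_l; [assumption|]. nra.
Qed.

Lemma circle_kernel_split t u :
  ln (Cmod (rho * cis t - rho * cis u) ^ 2 + eta ^ 2) = ln (circle_alpha ^ 2) + geom_kernel_ln circle_ratio t u.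
Proof.
  assert (B := circle_alpha_bounds). assert (E := circle_alpha_eq). assert (X := circle_ratio_bounds).
  unfold geom_kernel_ln. rewrite <- ln_mult by (try apply geom_kernel_pos; try exact X; apply pow_lt; lra).
  f_equal. rewrite !Cmod2_alt. unfold cis; simpl Re; simpl Im. unfold circle_ratio.
  set (al := circle_alpha) in *.
  assert (T1 := sin2_cos2 t). assert (T2 := sin2_cos2 u). unfold Rsqr in T1, T2.
  assert (Ee : eta = al - rho ^ 2 / al) by (field_simplify_eq; lra).
  set (x := rho ^ 2 / al ^ 2). assert (Ex : x * al ^ 2 = rho ^ 2) by (unfold x; field; lra).
  replace (rho ^ 2 / al) with (x * al) in Ee by (unfold x; field; lra).
  rewrite Ee. unfold Re, Im. simpl.
  set (c := cos t) in *. set (s := sin t) in *. set (c' := cos u) in *. set (s' := sin u) in *.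
  assert (Q1 : c * c = 1 - s * s) by lra. assert (Q2 : c' * c' = 1 - s' * s') by lra.
  clearbody c s c' s' x al. clear T1 T2 Ee B E X.
  transitivity (2 * rho ^ 2 - 2 * rho ^ 2 * (c * c' + s * s') + (al - x * al) ^ 2).
  - transitivity (rho ^ 2 * ((c * c + s * s) + (c' * c' + s' * s')) - 2 * rho ^ 2 * (c * c' + s * s') + (al - x * al) ^ 2); [ring|].
    rewrite Q1, Q2. ring.
  - transitivity (al ^ 2 * (1 - 2 * x * (c * c' + s * s') + x ^ 2 * ((c * c + s * s) * (c' * c' + s' * s')))); [|ring].
    rewrite Q1, Q2, <- Ex. ring.
Qed.

Definition circle_kernel (t u : R) : C := RtoC (ln (Cmod (rho * cis t - rho * cis u) ^ 2 + eta ^ 2)).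

Let circle_kernel_eq t u : circle_kernel t u = (ln (circle_alpha ^ 2) + RtoC (geom_kernel_ln circle_ratio t u))%C.
Proof. unfold circle_kernel. rewrite circle_kernel_split, RtoC_plus. reflexivity. Qed.

Lemma jointC_circle_kernel : jointC circle_kernel.
Proof.
  intros p. eapply contC_ext; [intros y; symmetry; apply circle_kernel_eq|].
  apply (jointC_plus (fun _ _ => RtoC (ln (circle_alpha ^ 2))) (fun t u => RtoC (geom_kernel_ln circle_ratio t u)));
    [apply jointC_const|apply jointC_geom_kernel, circle_ratio_bounds].
Qed.

Let geom_slice u : Ccontinuous (fun t => RtoC (geom_kernel_ln circle_ratio t u)).
Proof. apply (jointC_slice_fst (fun t u => RtoC (geom_kernel_ln circle_ratio t u))), jointC_geom_kernel, circle_ratio_bounds. Qed.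

Let circle_kernel_mean_times F u : Ccontinuous F -> mean F = 0%C ->
  mean (fun t => circle_kernel t u * F t)%C = mean (fun t => RtoC (geom_kernel_ln circle_ratio t u) * F t)%C.
Proof.
  intros CF MF. rewrite (mean_ext _ (fun t => ln (circle_alpha ^ 2) * F t + RtoC (geom_kernel_ln circle_ratio t u) * F t)%C)
    by (intros; rewrite circle_kernel_eq; ring).
  rewrite mean_plus, mean_scal, MF by
    first [exact CF|intros t; apply contC_mult; [first [apply contC_const|apply geom_slice]|apply CF]].
  ring.
Qed.

Lemma circle_kernel_mean u : mean (fun t => circle_kernel t u) = RtoC (ln (circle_alpha ^ 2)).
Proof.
  rewrite (mean_ext _ (fun t => ln (circle_alpha ^ 2) + RtoC (geom_kernel_ln circle_ratio t u))%C) by (intros; apply circle_kernel_eq).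
  rewrite mean_plus, mean_const, geom_kernel_mean by (try apply circle_ratio_bounds; try apply geom_slice; intros t; apply contC_const).
  ring.
Qed.

Lemma circle_kernel_mean_cis u : mean (fun t => circle_kernel t u * cis t)%C = (- circle_ratio * cis u)%C.
Proof.
  rewrite circle_kernel_mean_times, geom_kernel_mean_cis; [reflexivity|apply circle_ratio_bounds|exact contC_cis|].
  rewrite <- (mean_cis_pow 0). apply mean_ext. intros; rewrite Cpow_1_r; reflexivity.
Qed.

Lemma circle_kernel_mean_pow_inv u n :
  mean (fun t => circle_kernel t u * / cis t ^ S n)%C = (- (circle_ratio ^ S n / INR (S n))%R * / cis u ^ S n)%C.
Proof.
  rewrite circle_kernel_mean_times, geom_kernel_mean_pow_inv; [reflexivity|apply circle_ratio_bounds|apply Ccontinuous_cis_pow_inv|].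
  apply mean_cis_pow_inv.
Qed.

End CircleKernel.

(** * Test polynomials and holomorphic dependence on the parameter *)

Definition test_poly (y : nat -> C) (N : nat) (t : R) : C := Csum (fun k => y k * / cis t ^ S k)%C N.

Lemma test_poly_cont y N : Ccontinuous (test_poly y N).
Proof.
  apply (Ccontinuous_Csum (fun k t => y k * / cis t ^ S k)%C). intros k t.
  apply contC_mult; [apply contC_const|apply Ccontinuous_cis_pow_inv].
Qed.

Lemma mean_mult_test_poly F y N : Ccontinuous F ->
  mean (fun t => F t * test_poly y N t)%C = Csum (fun k => y k * mean (fun t => F t * / cis t ^ S k))%C N.
Proof.
  intros CF.
  rewrite (mean_ext _ (fun t => Csum (fun k => y k * (F t * / cis t ^ S k)) N)%C).
  - rewrite (mean_Csum (fun k t => y k * (F t * / cis t ^ S k))%C).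
    + apply Csum_ext. intros k _. apply mean_scal. intros t. apply contC_mult; [apply CF|apply Ccontinuous_cis_pow_inv].
    + intros k t. apply contC_mult; [apply contC_const|]. apply contC_mult; [apply CF|apply Ccontinuous_cis_pow_inv].
  - intros t. unfold test_poly. rewrite <- Csum_scal. apply Csum_ext. intros; ring.
Qed.

Lemma mean_test_poly y N : mean (test_poly y N) = 0%C.
Proof.
  rewrite (mean_ext _ (fun t => 1 * test_poly y N t)%C) by (intros; ring).
  rewrite mean_mult_test_poly by (intros t; apply contC_const).
  rewrite (Csum_ext _ (fun k => 0 * 0)%C); [rewrite Csum_scal; ring|].
  intros k _. rewrite (mean_ext _ (fun t => / cis t ^ S k)%C) by (intros; ring). rewrite mean_cis_pow_inv. ring.
Qed.

Lemma mean_mult_conj_test_poly F y N : Ccontinuous F ->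
  mean (fun t => F t * Cconj (test_poly y N t))%C = Csum (fun k => Cconj (y k) * mean (fun t => F t * cis t ^ S k))%C N.
Proof.
  intros CF.
  rewrite (mean_ext _ (fun t => Csum (fun k => Cconj (y k) * (F t * cis t ^ S k)) N)%C).
  - rewrite (mean_Csum (fun k t => Cconj (y k) * (F t * cis t ^ S k))%C).
    + apply Csum_ext. intros k _. apply mean_scal. intros t. apply contC_mult; [apply CF|apply Ccontinuous_cis_pow].
    + intros k t. apply contC_mult; [apply contC_const|]. apply contC_mult; [apply CF|apply Ccontinuous_cis_pow].
  - intros t. unfold test_poly. rewrite Cconj_Csum, <- Csum_scal. apply Csum_ext. intros k _.
    rewrite Cmult_conj, Cconj_cis_pow_inv. ring.
Qed.

Lemma mean_cis_pow_mult_inv j k : mean (fun u => / cis u ^ S k * cis u ^ S j)%C = if Nat.eq_dec j k then 1%C else 0%C.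
Proof.
  rewrite (mean_ext _ (fun u => (1%R * cis u) ^ S j / (1%R * cis u) ^ S k)%C).
  - rewrite mean_circle_pow_quot by lra. destruct (Nat.eq_dec (S j) (S k)), (Nat.eq_dec j k); try lia; reflexivity.
  - intros u. rewrite !Cmult_1_l. unfold Cdiv. ring.
Qed.

(** The coefficients of z -> (g z - g w) / (z - w) are found by dividing by w, so they are
    identified with holomorphic functions of w only for w <> 0. On circles of positive radius this
    is enough. *)
Definition hol_off0 (F : C -> C) : Prop := exists M, hol 1 M /\ forall z, 0 < Cmod z < 1 -> F z = M z.

Lemma hol_off0_mult F G : hol_off0 F -> hol_off0 G -> hol_off0 (fun z => F z * G z)%C.
Proof.
  intros [M [HM EM]] [N [HN EN]]. exists (fun z => M z * N z)%C. split; [apply hol_mult; assumption|].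
  intros z Hz. rewrite EM, EN by exact Hz. reflexivity.
Qed.

Lemma hol_off0_minus F G : hol_off0 F -> hol_off0 G -> hol_off0 (fun z => F z - G z)%C.
Proof.
  intros [M [HM EM]] [N [HN EN]]. exists (fun z => M z - N z)%C. split; [apply hol_minus; assumption|].
  intros z Hz. rewrite EM, EN by exact Hz. reflexivity.
Qed.

Lemma hol_off0_ext F G : (forall z, 0 < Cmod z < 1 -> F z = G z) -> hol_off0 F -> hol_off0 G.
Proof. intros E [M [HM EM]]. exists M; split; [exact HM|]. intros z Hz. rewrite <- E; auto. Qed.

Lemma hol_off0_Csum F n : (forall j, (j < n)%nat -> hol_off0 (F j)) -> hol_off0 (fun z => Csum (fun j => F j z) n).
Proof.
  induction n as [|n IH]; intros H.
  - exists (fun _ => 0%C). split; [apply hol_const|reflexivity].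
  - destruct (IH ltac:(intros; apply H; lia)) as [M [HM EM]]. destruct (H n ltac:(lia)) as [N [HN EN]].
    exists (fun z => M z + N z)%C. split; [apply hol_plus; assumption|]. intros z Hz. simpl. rewrite EM, EN by exact Hz. reflexivity.
Qed.

Lemma hol_off0_hol F : hol 1 F -> hol_off0 F.
Proof. intros H. exists F. split; [exact H|reflexivity]. Qed.

Lemma mean_hol_off0_pow F r n : hol_off0 F -> 0 < r < 1 -> mean (fun t => F (r * cis t)%C * cis t ^ S n)%C = 0%C.
Proof.
  intros [M [HM EM]] Hr.
  assert (E := mean_hol_pow M r n HM Hr).
  rewrite (mean_ext _ (fun t => r ^ S n * (F (r * cis t) * cis t ^ S n))%C) in E.
  - assert (CF : Ccontinuous (fun t => F (r * cis t) * cis t ^ S n)%C).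
    { intros t. apply (contC_ext (fun t => M (r * cis t) * cis t ^ S n)%C).
      - intros s. rewrite EM by (rewrite Cmod_circle; lra). reflexivity.
      - apply contC_mult; [apply (Ccontinuous_circle 1 _ _ HM); lra|apply Ccontinuous_cis_pow]. }
    rewrite mean_scal in E by exact CF.
    assert (N : (r ^ S n)%C <> 0%C) by (apply Cpow_nz, RtoC_neq0; lra).
    replace (mean (fun t => F (r * cis t) * cis t ^ S n)%C) with (/ r ^ S n * (r ^ S n * mean (fun t => F (r * cis t) * cis t ^ S n)))%C
      by (field; exact N).
    rewrite E. ring.
  - intros t. rewrite EM, Cpow_mult_l by (rewrite Cmod_circle; lra). ring.
Qed.

(** What remains of f after its first n Taylor terms are removed, divided by z^n. *)
Fixpoint iter_shift (n : nat) (f : C -> C) : C -> C := match n with O => f | S n => iter_shift n (shift f) end.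

Lemma iter_shift_hol n f : hol 1 f -> hol 1 (iter_shift n f).
Proof. revert f; induction n as [|n IH]; intros f H; simpl; [exact H|]. apply IH, shift_hol, H. Qed.

Lemma iter_shift_eq n f z : hol 1 f -> Cmod z < 1 -> iter_shift n f z = (coef f n + z * iter_shift (S n) f z)%C.
Proof.
  intros H Hz. revert f H. induction n as [|n IH]; intros f H.
  - simpl. rewrite (shift_eq f z H Hz) at 1. rewrite coef_0 by exact H. reflexivity.
  - change (iter_shift (S n) f z) with (iter_shift n (shift f) z). rewrite IH by (apply shift_hol; exact H).
    rewrite coef_shift by exact H. reflexivity.
Qed.

Section AreaTheorem.
Variable g : C -> C.
Hypotheses (Hg : hol 1 g) (Inj : forall z w, Cmod z < 1 -> Cmod w < 1 -> g z = g w -> z = w).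
Hypotheses (G0 : g 0 = 0%C) (G1 : C_derive g 0 = 1%C).

(* [recip g] is [z / g z] with the singularity at 0 removed. *)
Definition recip (z : C) : C := (/ ddiff g 0 z)%C.

Let Z0 : Cmod 0 < 1.
Proof. rewrite Cmod_0; lra. Qed.

Let dd_neq0 := ddiff_neq0 g Hg Inj.

Lemma recip_hol : hol 1 recip.
Proof. apply hol_inv; [intros z Hz; apply dd_neq0; [exact Z0|exact Hz]|apply ddiff_hol; [exact Hg|exact Z0]]. Qed.

Lemma recip_neq0 z : Cmod z < 1 -> recip z <> 0%C.
Proof.
  intros Hz E. apply (dd_neq0 0 z Z0 Hz).
  replace (ddiff g 0 z) with (ddiff g 0 z * ddiff g 0 z * recip z)%C by (unfold recip; field; apply dd_neq0; assumption).
  rewrite E; ring.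
Qed.

Lemma recip_0 : recip 0 = 1%C.
Proof. unfold recip. rewrite ddiff_diag, G1. field. Qed.

Let q w := ddiff g w.
Let m w (z : C) : C := (C_derive (q w) z / q w z)%C.

Let q_hol w : Cmod w < 1 -> hol 1 (q w).
Proof. apply ddiff_hol, Hg. Qed.

Let m_hol w : Cmod w < 1 -> hol 1 (m w).
Proof. intros Hw. apply log_deriv_hol; [apply q_hol, Hw|intros z Hz; apply dd_neq0; assumption]. Qed.

(** Expanding (z^k - w^k) / (z - w), the coefficient of z^n collects g_k w^(k-1-n) over k > n, which
    is the (n+1)-fold shift of g at w. The proof compares coefficients in g z - g w = (z - w) q
    z. *)
Let coef_q w n : 0 < Cmod w < 1 -> coef (q w) n = iter_shift (S n) g w.
Proof.
  intros Hw. assert (Nw : w <> 0%C) by (apply Cmod_gt_0; lra). assert (Hq := q_hol w ltac:(lra)).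
  induction n as [|n IH].
  - rewrite coef_0 by exact Hq. unfold q. simpl.
    assert (E := shift_eq g w Hg ltac:(lra)). rewrite G0 in E.
    assert (D := ddiff_eq g w 0). rewrite G0, E in D.
    replace (ddiff g w 0) with (- (ddiff g w 0 * (0 - w)) / w)%C by (field; exact Nw). rewrite <- D. field. exact Nw.
  - assert (E : coef (fun z => g z + (-1) * g w)%C (S n) = coef (fun z => z * q w z + (- w) * q w z)%C (S n)).
    { apply coef_ext. intros z Hz. transitivity (g z - g w)%C; [ring|]. rewrite ddiff_eq. unfold q. ring. }
    rewrite coef_plus in E by (try exact Hg; apply hol_mult; apply hol_const).
    rewrite (coef_scal (-1) (fun _ => g w)), coef_const in E by apply hol_const.
    rewrite coef_plus in E by (apply hol_mult; [first [apply hol_id|apply hol_const]|exact Hq]).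
    rewrite coef_mul_id_S, coef_scal, IH in E by exact Hq.
    rewrite (iter_shift_eq (S n) g w Hg) in E by lra.
    assert (E2 : (w * coef (q w) (S n) = w * iter_shift (S (S n)) g w)%C).
    { transitivity (coef g (S n) + w * iter_shift (S (S n)) g w - (coef g (S n) + w * iter_shift (S (S n)) g w + - w * coef (q w) (S n)))%C; [ring|].
      rewrite <- E. ring. }
    replace (coef (q w) (S n)) with (/ w * (w * coef (q w) (S n)))%C by (field; exact Nw).
    rewrite E2. field. exact Nw.
Qed.

Let coef_q_0 w : Cmod w < 1 -> (coef (q w) 0 * recip w = 1)%C.
Proof.
  intros Hw. rewrite coef_0 by (apply q_hol, Hw). unfold q, recip. rewrite ddiff_sym. field. apply dd_neq0; assumption.
Qed.

(** Comparison of coefficients in m q = q', solved for the last coefficient of m: the constant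
    coefficient of q is g w / w, the inverse of [recip g w]. By this recursion all coefficients of m
    depend holomorphically on w. *)
Let coef_m w n : Cmod w < 1 ->
  coef (m w) n = ((INR (S n) * coef (q w) (S n) - Csum (fun j => coef (m w) j * coef (q w) (n - j)) n) * recip w)%C.
Proof.
  intros Hw. assert (Hq := q_hol w Hw). assert (Hm := m_hol w Hw).
  assert (E : coef (C_derive (q w)) n = coef (fun z => m w z * q w z)%C n).
  { apply coef_ext. intros z Hz. unfold m. field. apply dd_neq0; assumption. }
  rewrite coef_derive, coef_mult in E by assumption. rewrite E.
  change (Csum (fun j => coef (m w) j * coef (q w) (n - j))%C (S n)) with
    (Csum (fun j => coef (m w) j * coef (q w) (n - j)) n + coef (m w) n * coef (q w) (n - n))%C.
  rewrite Nat.sub_diag.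
  transitivity (coef (m w) n * (coef (q w) 0 * recip w))%C; [rewrite coef_q_0 by exact Hw; ring|ring].
Qed.

Let coef_q_off0 n : hol_off0 (fun w => coef (q w) n).
Proof.
  exists (iter_shift (S n) g). split; [apply iter_shift_hol, Hg|]. intros w Hw. apply coef_q, Hw.
Qed.

Let coef_m_off0 n : hol_off0 (fun w => coef (m w) n).
Proof.
  induction n as [n IH] using (well_founded_induction Wf_nat.lt_wf).
  apply (hol_off0_ext (fun w => (INR (S n) * coef (q w) (S n) - Csum (fun j => coef (m w) j * coef (q w) (n - j)) n) * recip w)%C).
  - intros w Hw. symmetry. apply coef_m. lra.
  - apply hol_off0_mult; [|apply hol_off0_hol, recip_hol]. apply hol_off0_minus.
    + apply (hol_off0_mult (fun _ => RtoC (INR (S n)))); [apply hol_off0_hol, hol_const|apply coef_q_off0].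
    + apply (hol_off0_Csum (fun j w => coef (m w) j * coef (q w) (n - j))%C). intros j Hj.
      apply hol_off0_mult; [apply IH, Hj|apply coef_q_off0].
Qed.

(** The place where z / g comes in: q'(0) / q(0) = ((g w / w - 1) / w) (w / g w) = (1 - w / g w) /
    w. *)
Let coef_m_0 w : 0 < Cmod w < 1 -> coef (m w) 0 = (- shift recip w)%C.
Proof.
  intros Hw. rewrite coef_m by lra. rewrite coef_q by exact Hw. simpl Csum.
  assert (Nw : w <> 0%C) by (apply Cmod_gt_0; lra).
  assert (E0 := iter_shift_eq 0 g w Hg ltac:(lra)). assert (E1 := iter_shift_eq 1 g w Hg ltac:(lra)).
  rewrite coef_0, G0 in E0 by exact Hg. rewrite coef_1, G1 in E1 by exact Hg. simpl (iter_shift 0 g w) in E0.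
  assert (Er := shift_eq recip w recip_hol ltac:(lra)). rewrite recip_0 in Er.
  assert (Q := coef_q_0 w ltac:(lra)). rewrite coef_q in Q by exact Hw.
  set (a := iter_shift 1 g w) in *. set (b := iter_shift 2 g w) in *. set (s := shift recip w) in *. set (k := recip w) in *.
  change (INR 1) with 1.
  assert (Es : s = ((k - 1) / w)%C) by (rewrite Er; field; exact Nw).
  rewrite Es.
  transitivity ((a * k - k) / w)%C.
  - rewrite E1. field. exact Nw.
  - rewrite Q. field. exact Nw.
Qed.

Section FixedRadius.
Variable rho : R.
Hypothesis Hrho : 0 < rho < 1.

Let zc t : C := (rho * cis t)%C.

Let Hzc t : Cmod (zc t) < 1.
Proof. unfold zc. rewrite Cmod_circle; lra. Qed.

Let Hzc' t : 0 < Cmod (zc t) < 1.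
Proof. unfold zc. rewrite Cmod_circle; lra. Qed.

Let Q t u : C := q (zc u) (zc t).

Let Q_neq0 t u : Q t u <> 0%C.
Proof. apply dd_neq0; apply Hzc. Qed.

Let jointC_Q : jointC Q.
Proof.
  intros p. apply contC_eps. intros eps Heps.
  destruct (ddiff_joint g (zc (snd p)) (zc (fst p)) Hg (Hzc _) (Hzc _) eps Heps) as [d [Hd B]].
  assert (C1 := jointC_fst zc (Ccontinuous_cis rho) p). assert (C2 := jointC_snd zc (Ccontinuous_cis rho) p).
  generalize (filter_and _ _ (proj1 (contC_eps _ _) C1 d Hd) (proj1 (contC_eps _ _) C2 d Hd)).
  apply filter_imp. intros y [Y1 Y2]. apply B; assumption.
Qed.

Let ln_kernel (t u : R) : C := RtoC (ln (Cmod (Q t u) ^ 2)).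

Let Q2_pos t u : 0 < Cmod (Q t u) ^ 2.
Proof. apply pow_lt, Cmod_gt_0, Q_neq0. Qed.

Let jointC_ln_kernel : jointC ln_kernel.
Proof.
  intros p. apply contC_RtoC. apply (continuous_ln_comp (fun p => Cmod (Q (fst p) (snd p)) ^ 2)); [apply Q2_pos|].
  apply contC_Cmod2, jointC_Q.
Qed.

Let ln_kernel_cis u : mean (fun t => ln_kernel t u * cis t)%C = Cconj (rho * coef (m (zc u)) 0)%C.
Proof.
  rewrite (mean_ext _ (fun t => ln_kernel t u * cis t ^ 1)%C) by (intros; rewrite Cpow_1_r; reflexivity).
  etransitivity; [exact (mean_ln_Cmod_pow (q (zc u)) (q_hol _ (Hzc u)) (fun z Hz => dd_neq0 _ _ (Hzc u) Hz) rho 0 Hrho)|].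
  f_equal. fold (m (zc u)). change (INR 1) with 1. simpl. field.
Qed.

Let ln_kernel_pow_inv u n : mean (fun t => ln_kernel t u * / cis t ^ S n)%C = (rho ^ S n * (coef (m (zc u)) n / INR (S n)))%C.
Proof.
  exact (mean_ln_Cmod_pow_inv (q (zc u)) (q_hol _ (Hzc u)) (fun z Hz => dd_neq0 _ _ (Hzc u) Hz) rho n Hrho).
Qed.

Variables (y : nat -> C) (N : nat).
Let s := test_poly y N.
Let Cs : Ccontinuous s := test_poly_cont y N.
Let Cc : Ccontinuous cis := contC_cis.

Let mean_cis : mean cis = 0%C.
Proof. rewrite <- (mean_cis_pow 0). apply mean_ext. intros; rewrite Cpow_1_r; reflexivity. Qed.

Let ln_kernel_inner_cont F : Ccontinuous F -> Ccontinuous (fun u => mean (fun t => ln_kernel t u * F t))%C.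
Proof. intros H. apply form_inner_cont; [exact H|exact jointC_ln_kernel]. Qed.

(** The inner mean is the conjugate of a holomorphic function of [zc u]; with the conjugate of
    e^(iu) it forms the conjugate of a holomorphic function times a positive power, which has mean
    0. *)
Let ln_kernel_form_cis : form ln_kernel cis cis = 0%C.
Proof.
  unfold form. rewrite (mean_ext _ (fun u => Cconj ((rho * coef (m (zc u)) 0) * cis u ^ 1))%C).
  - rewrite mean_conj.
    + unfold zc. rewrite (mean_hol_off0_pow (fun w => rho * coef (m w) 0)%C rho 0); [apply Cconj_0| |exact Hrho].
      apply (hol_off0_mult (fun _ => RtoC rho)); [apply hol_off0_hol, hol_const|apply coef_m_off0].
    + intros u. apply (contC_ext (fun u => Cconj (mean (fun t => ln_kernel t u * cis t)) * cis u ^ 1)%C).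
      * intros u'. rewrite ln_kernel_cis, Cconj_conj. reflexivity.
      * apply contC_mult; [apply contC_conj, ln_kernel_inner_cont, Cc|apply Ccontinuous_cis_pow].
  - intros u. rewrite ln_kernel_cis, Cpow_1_r, <- Cmult_conj. reflexivity.
Qed.

(** Here the inner mean is itself holomorphic in [zc u], and the conjugate of [s] contains only
    positive powers of e^(iu). *)
Let ln_kernel_form_poly : form ln_kernel s s = 0%C.
Proof.
  unfold form. unfold s at 2. rewrite mean_mult_conj_test_poly by (apply ln_kernel_inner_cont, Cs).
  rewrite (Csum_ext _ (fun k => 0 * 0)%C); [rewrite Csum_scal; ring|]. intros j _.
  rewrite (mean_ext _ (fun u => Csum (fun k => y k * (rho ^ S k * (coef (m (zc u)) k / INR (S k)))) N * cis u ^ S j)%C).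
  - unfold zc. rewrite (mean_hol_off0_pow (fun w => Csum (fun k => y k * (rho ^ S k * (coef (m w) k / INR (S k)))) N)%C rho j); [ring| |exact Hrho].
    apply (hol_off0_Csum (fun k w => y k * (rho ^ S k * (coef (m w) k / INR (S k))))%C). intros k _.
    apply (hol_off0_ext (fun w => (y k * rho ^ S k / INR (S k)) * coef (m w) k)%C); [intros; unfold Cdiv; ring|].
    apply (hol_off0_mult (fun _ => (y k * rho ^ S k / INR (S k))%C)); [apply hol_off0_hol, hol_const|apply coef_m_off0].
  - intros u. f_equal. unfold s. rewrite mean_mult_test_poly by (apply (jointC_slice_fst ln_kernel), jointC_ln_kernel).
    apply Csum_ext. intros k _. rewrite ln_kernel_pow_inv. reflexivity.
Qed.

Definition area_pairing : C := Csum (fun k => y k * rho ^ (k + 2) * coef recip (k + 2))%C N.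

(** The inner mean is the conjugate of - rho * shift recip at [zc u]. The power e^(i(k+1)u) picks
    out the coefficient of index k + 1 of the shift, that is of index k + 2 of [recip], with weight
    rho * rho^(k+1). *)
Let ln_kernel_form_mixed : form ln_kernel cis s = (- Cconj area_pairing)%C.
Proof.
  unfold form. unfold s. rewrite mean_mult_conj_test_poly by (apply ln_kernel_inner_cont, Cc).
  unfold area_pairing. rewrite Cconj_Csum.
  replace (- Csum (fun k => Cconj (y k * rho ^ (k + 2) * coef recip (k + 2))) N)%C
    with ((-1) * Csum (fun k => Cconj (y k * rho ^ (k + 2) * coef recip (k + 2))) N)%C by ring.
  rewrite <- Csum_scal. apply Csum_ext. intros k _.
  assert (Hs := shift_hol _ recip_hol).
  rewrite (mean_ext _ (fun u => Cconj ((- rho * rho ^ S k) * (shift recip (rho * cis u) / (rho * cis u) ^ S k)))%C).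
  - assert (Cq := Ccontinuous_quot _ rho (S k) Hs Hrho).
    rewrite mean_conj, mean_scal, coef_circle, coef_shift by
      first [assumption|apply recip_hol|intros t; apply contC_mult; [apply contC_const|apply Cq]].
    rewrite !Cmult_conj, !Cpow_conj, !Copp_conj, !RtoC_Cconj.
    replace (k + 2)%nat with (S (S k)) by lia. simpl. ring.
  - intros u. rewrite ln_kernel_cis, coef_m_0 by apply Hzc'. fold (zc u).
    rewrite Cmult_conj, !Cmult_conj, RtoC_Cconj, Copp_conj, !Copp_conj, !Cpow_conj, RtoC_Cconj.
    rewrite Cdiv_conj by (apply Cpow_nz, circle_neq0; lra). rewrite Cpow_conj. unfold zc at 3. rewrite Cmult_conj, RtoC_Cconj, <- cis_inv.
    rewrite Cpow_mult_l, Cpow_inv by apply cis_neq0. field.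
    split; apply Cpow_nz; first [apply cis_neq0|apply RtoC_neq0; lra].
Qed.

(** Compactness of the square, again through [bisection]: continuity gives local bounds, and the sum
    of four bounds, each at least 1, serves for their union. *)
Let Q_bounds : exists c, 1 <= c /\ forall t u, 0 <= t <= 2 * PI -> 0 <= u <= 2 * PI -> / c <= Cmod (Q t u) ^ 2 <= c.
Proof.
  assert (P := two_PI_pos).
  apply (bisection 0 (2 * PI) 0 (2 * PI) (fun a b c d => exists B, 1 <= B /\
    forall t u, a <= t <= b -> c <= u <= d -> / B <= Cmod (Q t u) ^ 2 <= B)); try lra.
  - intros a b c d _ _ _ _ _ _ [B1 [L1 H1]] [B2 [L2 H2]] [B3 [L3 H3]] [B4 [L4 H4]].
    exists (B1 + B2 + B3 + B4). split; [lra|]. intros t u Ht Hu.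
    assert (K : forall B, 1 <= B -> B <= B1 + B2 + B3 + B4 -> / B <= Cmod (Q t u) ^ 2 <= B ->
      / (B1 + B2 + B3 + B4) <= Cmod (Q t u) ^ 2 <= B1 + B2 + B3 + B4).
    { intros B LB LB' HB. split; [|lra]. eapply Rle_trans; [|apply HB]. apply Rinv_le_contravar; lra. }
    destruct (Rle_dec t ((a + b) / 2)); destruct (Rle_dec u ((c + d) / 2)).
    + apply (K B1); [lra|lra|apply H1; lra].
    + apply (K B3); [lra|lra|apply H3; lra].
    + apply (K B2); [lra|lra|apply H2; lra].
    + apply (K B4); [lra|lra|apply H4; lra].
  - intros t0 u0 _ _.
    assert (P0 := Q2_pos t0 u0). set (v := Cmod (Q t0 u0) ^ 2) in *.
    assert (K : continuous (fun p : R * R => Cmod (Q (fst p) (snd p)) ^ 2) (t0, u0)).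
    { apply (contC_Cmod2 (U := prod_UniformSpace R_UniformSpace R_UniformSpace) (fun p => Q (fst p) (snd p))), jointC_Q. }
    assert (Hv2 : 0 < v / 2) by lra.
    destruct (proj1 (filterlim_locally _ _) K (mkposreal _ Hv2)) as [d Hd].
    exists d. split; [apply cond_pos|]. intros a b a' b' _ Ha _ _ Hu _ _ _ Wd Wd' _.
    assert (Iv : 0 < / v) by (apply Rinv_0_lt_compat; exact P0).
    exists (2 * v + 2 * / v + 1). split; [lra|]. intros t u Ht Hu'.
    assert (B : Rabs (Cmod (Q t u) ^ 2 - v) < v / 2).
    { apply (Hd (t, u)). split; (apply Rabs_def1; unfold minus, plus, opp; simpl; lra). }
    apply Rabs_def2 in B. split; [|lra].
    apply Rle_trans with (/ (2 * / v)).
    + apply Rinv_le_contravar; lra.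
    + rewrite Rinv_mult, Rinv_inv. lra.
Qed.

Let S12 : exists B, forall t, 0 <= t <= 2 * PI -> Cmod (cis t) <= B /\ Cmod (s t) <= B.
Proof.
  destruct (Ccontinuous_bounded s Cs) as [B HS]. exists (B + 1). intros t Ht. rewrite Cmod_cis.
  specialize (HS t Ht). generalize (Cmod_ge_0 (s t)). lra.
Qed.

(* The kernel of the curve splits into [- ln |Q|^2], the kernel of the circle and an error
   [e] whose mean tends to 0 with the regularization [eta]. *)
Let energy_bound eta c B : 0 < eta -> 1 <= c ->
  (forall t u, 0 <= t <= 2 * PI -> 0 <= u <= 2 * PI -> / c <= Cmod (Q t u) ^ 2 <= c) ->
  (forall t, 0 <= t <= 2 * PI -> Cmod (cis t) <= B /\ Cmod (s t) <= B) ->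
  2 * Re area_pairing <= 1 + Re (Csum (fun k => y k * Cconj (y k) / INR (k + 1))%C N)
    + 4 * (B * B * (ln (circle_alpha rho (c * eta) ^ 2) - ln (circle_alpha rho eta ^ 2))).
Proof.
  intros Heta Hc HQ HS.
  (* With 1 / c <= |Q|^2 <= c this choice gives eta^2 <= tau / |Q|^2 <= (c eta)^2, which places the
     error kernel between 0 and [G]. *)
  set (tau := c * eta ^ 2). assert (Htau : 0 < tau) by (unfold tau; apply Rmult_lt_0_compat; [lra|apply pow_lt; lra]).
  assert (Hce : 0 < c * eta) by (apply Rmult_lt_0_compat; lra).
  set (w := fun t => g (zc t)).
  assert (Cw : Ccontinuous w) by (apply (Ccontinuous_circle 1); [exact Hg|lra]).
  set (K := log_kernel w tau). assert (JK : jointC K) by (apply jointC_log_kernel; assumption).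
  set (L := circle_kernel rho eta). assert (JL : jointC L) by (apply jointC_circle_kernel; assumption).
  assert (JL2 : jointC (circle_kernel rho (c * eta))) by (apply jointC_circle_kernel; assumption).
  set (e := fun t u => ((-1) * (K t u + ln_kernel t u + L t u))%C).
  assert (Jneg : forall A, jointC A -> jointC (fun t u => (-1) * A t u)%C).
  { intros A JA. apply (jointC_mult (fun _ _ => (-1)%C) A); [apply jointC_const|exact JA]. }
  assert (JKL : jointC (fun t u => K t u + ln_kernel t u + L t u)%C) by (apply jointC_plus; [apply jointC_plus|]; assumption).
  assert (Je : jointC e) by (apply Jneg; exact JKL).
  assert (Ee : forall a b, Ccontinuous a -> Ccontinuous b -> form K a b = (- form ln_kernel a b - form L a b - form e a b)%C).
  { intros a b Ca Cb. unfold e. rewrite form_scal, !form_plus by (try assumption; apply jointC_plus; assumption). ring. }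
  (* The majorant is a difference of two regularized circle kernels, whose means are known
     exactly. *)
  set (G := fun t u => ln (Cmod (rho * cis t - rho * cis u) ^ 2 + (c * eta) ^ 2) - ln (Cmod (rho * cis t - rho * cis u) ^ 2 + eta ^ 2)).
  assert (EG : forall t u, RtoC (G t u) = (circle_kernel rho (c * eta) t u + (-1) * L t u)%C).
  { intros t u. unfold G. rewrite RtoC_minus. unfold L, circle_kernel. ring. }
  assert (JG : jointC (fun t u => RtoC (G t u))).
  { intros p. eapply contC_ext; [intros p'; symmetry; apply EG|]. apply (jointC_plus (circle_kernel rho (c * eta)) (fun t u => (-1) * L t u)%C); [exact JL2|apply Jneg; exact JL]. }
  assert (MG : mean (fun u => mean (fun t => RtoC (G t u))) = RtoC (ln (circle_alpha rho (c * eta) ^ 2) - ln (circle_alpha rho eta ^ 2))).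
  { rewrite <- mean_const. apply mean_ext. intros u.
    rewrite (mean_ext _ (fun t => circle_kernel rho (c * eta) t u + (-1) * L t u)%C) by (intros; apply EG).
    rewrite mean_plus, (mean_scal (-1) (fun t => L t u)).
    - unfold L. rewrite !circle_kernel_mean, RtoC_minus by assumption. ring.
    - exact (jointC_slice_fst L u JL).
    - exact (jointC_slice_fst _ u JL2).
    - exact (jointC_slice_fst _ u (Jneg L JL)). }
  assert (Be : forall t u, 0 <= t <= 2 * PI -> 0 <= u <= 2 * PI -> Cmod (e t u) <= G t u).
  { intros t u Ht Hu. specialize (HQ t u Ht Hu). assert (Qp := Q2_pos t u).
    set (D := Cmod (rho * cis t - rho * cis u) ^ 2). assert (HD : 0 <= D) by apply pow2_ge_0.
    (* Factoring |Q|^2 out of |w t - w u|^2 + tau leaves the circle kernel regularized by tau /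
       |Q|^2 in place of eta^2. *)
    assert (Ew : Cmod (w t - w u) ^ 2 = Cmod (Q t u) ^ 2 * D).
    { unfold w, D. rewrite ddiff_eq, Cmod_mult, Rpow_mult_distr. reflexivity. }
    assert (El : e t u = RtoC (ln (D + tau / Cmod (Q t u) ^ 2) - ln (D + eta ^ 2))).
    { assert (Ek : K t u = RtoC (- (ln (Cmod (Q t u) ^ 2) + ln (D + tau / Cmod (Q t u) ^ 2)))).
      { unfold K, log_kernel. rewrite Ew, <- ln_mult.
        - do 3 f_equal. field. apply Rgt_not_eq, Cmod_gt_0, Q_neq0.
        - exact Qp.
        - assert (0 < tau / Cmod (Q t u) ^ 2) by (apply Rdiv_lt_0_compat; assumption). lra. }
      unfold e. rewrite Ek. unfold ln_kernel, L, circle_kernel. fold D. rewrite <- !RtoC_plus, <- RtoC_mult. f_equal. ring. }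
    assert (He2 : 0 < eta ^ 2) by (apply pow_lt; exact Heta).
    assert (L1 : eta ^ 2 <= tau / Cmod (Q t u) ^ 2).
    { apply (proj1 (Rle_div_r (eta ^ 2) tau _ Qp)). unfold tau. rewrite Rmult_comm. apply Rmult_le_compat_r; lra. }
    assert (L2 : tau / Cmod (Q t u) ^ 2 <= (c * eta) ^ 2).
    { apply (proj2 (Rle_div_l tau _ _ Qp)). unfold tau.
      replace ((c * eta) ^ 2 * Cmod (Q t u) ^ 2) with (c * eta ^ 2 * (c * Cmod (Q t u) ^ 2)) by ring.
      rewrite <- (Rmult_1_r (c * eta ^ 2)) at 1. apply Rmult_le_compat_l; [unfold tau in Htau; lra|].
      rewrite <- (Rinv_r c) by lra. apply Rmult_le_compat_l; lra. }
    rewrite El, Cmod_R. unfold G. fold D.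
    assert (ln (D + eta ^ 2) <= ln (D + tau / Cmod (Q t u) ^ 2)) by (apply ln_le; lra).
    assert (ln (D + tau / Cmod (Q t u) ^ 2) <= ln (D + (c * eta) ^ 2)) by (apply ln_le; lra).
    rewrite Rabs_pos_eq; lra. }
  assert (Bf : forall a b, Ccontinuous a -> Ccontinuous b -> (forall t, 0 <= t <= 2 * PI -> Cmod (a t) <= B) ->
    (forall t, 0 <= t <= 2 * PI -> Cmod (b t) <= B) ->
    Rabs (Re (form e a b)) <= B * B * (ln (circle_alpha rho (c * eta) ^ 2) - ln (circle_alpha rho eta ^ 2))).
  { intros a b Ca Cb Ba Bb. eapply Rle_trans; [apply re_le_Cmod|].
    eapply Rle_trans; [apply (form_bound a b Ca Cb e G B B Je JG Ba Bb Be)|]. rewrite MG, re_RtoC. lra. }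
  assert (X := circle_ratio_bounds rho eta Hrho Heta). set (x := circle_ratio rho eta) in *.
  assert (F11 : form L cis cis = RtoC (- x)).
  { unfold form. rewrite <- mean_const. apply mean_ext. intros u. unfold L. rewrite circle_kernel_mean_cis by assumption.
    fold x. rewrite RtoC_opp. transitivity (- x * (cis u * Cconj (cis u)))%C; [ring|]. rewrite cis_conj. ring. }
  assert (F12 : form L cis s = 0%C).
  { unfold form. unfold s. rewrite mean_mult_conj_test_poly by (apply form_inner_cont; [exact Cc|exact JL]).
    rewrite (Csum_ext _ (fun k => 0 * 0)%C); [rewrite Csum_scal; ring|]. intros k _.
    rewrite (mean_ext _ (fun u => - x * cis u ^ S (S k))%C).
    - rewrite mean_scal, mean_cis_pow by apply Ccontinuous_cis_pow. ring.
    - intros u. unfold L. rewrite circle_kernel_mean_cis by assumption. fold x. simpl. ring. }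
  assert (F22 : form L s s = RtoC (- Re (Csum (fun k => (x ^ S k)%R * (y k * Cconj (y k) / INR (k + 1)))%C N))).
  { unfold form. unfold s at 2. rewrite mean_mult_conj_test_poly by (apply form_inner_cont; [exact Cs|exact JL]).
    rewrite (Csum_ext _ (fun j => RtoC (- (x ^ S j * (Cmod (y j) ^ 2 / INR (S j)))))).
    - clear. induction N as [|n IH].
      + simpl. apply Ceq_ReIm; simpl; ring.
      + change (Csum (fun j => RtoC (- (x ^ S j * (Cmod (y j) ^ 2 / INR (S j))))) (S n)) with
          (Csum (fun j => RtoC (- (x ^ S j * (Cmod (y j) ^ 2 / INR (S j))))) n + RtoC (- (x ^ S n * (Cmod (y n) ^ 2 / INR (S n)))))%C.
        rewrite IH. cbn [Csum]. rewrite re_plus, <- RtoC_plus. f_equal.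
        rewrite re_scal_l, <- Cmod2_conj. replace (n + 1)%nat with (S n) by lia.
        rewrite <- RtoC_div, re_RtoC by (apply not_0_INR; lia). ring.
    - intros j Hj.
      rewrite (mean_ext _ (fun u => Csum (fun k => (y k * - (x ^ S k / INR (S k))%R) * (/ cis u ^ S k * cis u ^ S j)) N)%C).
      + assert (Cp : forall k, Ccontinuous (fun u => / cis u ^ S k * cis u ^ S j)%C).
        { intros k u. apply contC_mult; [apply Ccontinuous_cis_pow_inv|apply Ccontinuous_cis_pow]. }
        rewrite (mean_Csum (fun k u => (y k * - (x ^ S k / INR (S k))%R) * (/ cis u ^ S k * cis u ^ S j))%C)
          by (intros k u; apply contC_mult; [apply contC_const|apply Cp]).
        rewrite (Csum_ext _ (fun k => (y k * - (x ^ S k / INR (S k))%R) * (if Nat.eq_dec k j then 1 else 0))%C).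
        * rewrite Csum_delta by exact Hj.
          rewrite RtoC_opp, RtoC_mult, RtoC_div, RtoC_div, Cmod2_conj by (apply not_0_INR; lia). unfold Cdiv. ring.
        * intros k _. rewrite mean_scal, mean_cis_pow_mult_inv by apply Cp.
          destruct (Nat.eq_dec j k), (Nat.eq_dec k j); try lia; reflexivity.
      + intros u. unfold s. rewrite mean_mult_test_poly by (apply (jointC_slice_fst L), JL).
        rewrite Cmult_comm, <- Csum_scal. apply Csum_ext. intros k _. unfold L. rewrite circle_kernel_mean_pow_inv by assumption. fold x. ring. }
  assert (Main := log_energy_nonneg w tau Cw Htau cis s Cc Cs mean_cis (mean_test_poly y N)). fold K in Main.
  rewrite !Ee in Main by assumption.
  rewrite ln_kernel_form_cis, ln_kernel_form_poly, ln_kernel_form_mixed, F11, F12, F22 in Main.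
  (* The error enters twice through the mixed form and once through each diagonal form, whence the
     factor 4 in the statement. *)
  assert (B1 := Bf cis cis Cc Cc (fun t Ht => proj1 (HS t Ht)) (fun t Ht => proj1 (HS t Ht))).
  assert (B2 := Bf cis s Cc Cs (fun t Ht => proj1 (HS t Ht)) (fun t Ht => proj2 (HS t Ht))).
  assert (B3 := Bf s s Cs Cs (fun t Ht => proj2 (HS t Ht)) (fun t Ht => proj2 (HS t Ht))).
  apply Rabs_le_between in B1. apply Rabs_le_between in B2. apply Rabs_le_between in B3.
  rewrite !re_minus, !re_opp, !re_RtoC, re_conj in Main.
  assert (Sx : Re (Csum (fun k => (x ^ S k)%R * (y k * Cconj (y k) / INR (k + 1)))%C N) <= Re (Csum (fun k => y k * Cconj (y k) / INR (k + 1))%C N)).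
  { clear - X. induction N as [|n IH]; [simpl; lra|]. cbn [Csum]. rewrite !re_plus. apply Rplus_le_compat; [exact IH|].
    rewrite re_scal_l, <- Cmod2_conj, <- RtoC_div, re_RtoC by (apply not_0_INR; lia).
    assert (0 <= Cmod (y n) ^ 2 / INR (n + 1)) by (apply Rdiv_le_0_compat; [apply pow2_ge_0|apply lt_0_INR; lia]).
    assert (x ^ S n <= 1) by (rewrite <- (pow1 (S n)); apply pow_incr; lra).
    rewrite <- (Rmult_1_l (_ / _)) at 2. apply Rmult_le_compat_r; assumption. }
  lra.
Qed.

Lemma area_pairing_bound : 2 * Re area_pairing <= 1 + Re (Csum (fun k => y k * Cconj (y k) / INR (k + 1))%C N).
Proof.
  destruct Q_bounds as [c [Hc HQ]]. destruct S12 as [B HS].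
  apply Rnot_lt_le. intros Lt.
  set (d := 2 * Re area_pairing - (1 + Re (Csum (fun k => y k * Cconj (y k) / INR (k + 1))%C N))).
  assert (Hd : 0 < d) by (unfold d; lra).
  (* The difference of logarithms is at most 2 c eta / rho, because alpha(c eta) <= rho + c eta and
     alpha(eta) > rho. The total error is then at most d / 2, less than the assumed excess d. *)
  set (eta := rho * d / (16 * (B * B + 1) * c)).
  assert (HSS : 0 <= B * B) by nra.
  assert (Heta : 0 < eta).
  { unfold eta. apply Rdiv_lt_0_compat; [apply Rmult_lt_0_compat; lra|]. apply Rmult_lt_0_compat; lra. }
  assert (Hce : 0 < c * eta) by (apply Rmult_lt_0_compat; lra).
  assert (E := energy_bound eta c B Heta Hc HQ HS).
  assert (B1 := circle_alpha_bounds rho eta Hrho Heta). assert (B2 := circle_alpha_bounds rho (c * eta) Hrho Hce).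
  assert (V : ln (circle_alpha rho (c * eta) ^ 2) - ln (circle_alpha rho eta ^ 2) <= 2 * (c * eta / rho)).
  { rewrite !ln_pow by lra. simpl INR.
    assert (ln (circle_alpha rho (c * eta)) <= ln rho + c * eta / rho).
    { apply Rle_trans with (ln (rho * exp (c * eta / rho))).
      - apply ln_le; [lra|]. assert (A := exp_ineq1_le (c * eta / rho)).
        apply Rle_trans with (rho * (1 + c * eta / rho)); [|apply Rmult_le_compat_l; lra].
        replace (rho * (1 + c * eta / rho)) with (rho + c * eta) by (field; lra). lra.
      - rewrite ln_mult, ln_exp by (try apply exp_pos; lra). lra. }
    assert (ln rho <= ln (circle_alpha rho eta)) by (apply ln_le; lra). lra. }
  assert (V2 : c * eta / rho = d / (16 * (B * B + 1))) by (unfold eta; field; lra).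
  rewrite V2 in V.
  assert (V3 : B * B * (ln (circle_alpha rho (c * eta) ^ 2) - ln (circle_alpha rho eta ^ 2)) <= d / 8).
  { apply Rle_trans with (B * B * (2 * (d / (16 * (B * B + 1))))); [apply Rmult_le_compat_l; lra|].
    apply Rmult_le_reg_r with (16 * (B * B + 1)); [lra|].
    replace (B * B * (2 * (d / (16 * (B * B + 1)))) * (16 * (B * B + 1))) with (2 * (B * B) * d) by (field; lra). nra. }
  unfold d in *. lra.
Qed.

End FixedRadius.

(** The choice of y maximizes the linear term minus the quadratic one: both then equal the same sum
    S, and 2 S <= 1 + S gives S <= 1. *)
Let area_sum_radius rho N : 0 < rho < 1 ->
  Re (Csum (fun k => RtoC (INR (k + 1) * (rho ^ (k + 2)) ^ 2 * Cmod (coef recip (k + 2)) ^ 2)) N) <= 1.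
Proof.
  intros Hr. set (y := fun k => (INR (k + 1) * rho ^ (k + 2) * Cconj (coef recip (k + 2)))%C).
  assert (B := area_pairing_bound rho Hr y N). unfold area_pairing in B.
  rewrite (Csum_ext _ (fun k => RtoC (INR (k + 1) * (rho ^ (k + 2)) ^ 2 * Cmod (coef recip (k + 2)) ^ 2))) in B.
  - rewrite (Csum_ext (fun k => y k * Cconj (y k) / INR (k + 1))%C (fun k => RtoC (INR (k + 1) * (rho ^ (k + 2)) ^ 2 * Cmod (coef recip (k + 2)) ^ 2))) in B; [lra|].
    intros k _. unfold y. rewrite !RtoC_mult, Cmod2_conj, !Cmult_conj, Cpow_conj, !RtoC_Cconj, Cconj_conj, !RtoC_pow.
    simpl. field. apply RtoC_neq0, not_0_INR; lia.
  - intros k _. unfold y. rewrite !RtoC_mult, Cmod2_conj, !RtoC_pow. simpl. ring.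
Qed.

Fixpoint Rsum (a : nat -> R) (n : nat) : R := match n with O => 0 | S n => Rsum a n + a n end.

(** For fixed N the sum is a polynomial in rho, so the bound for rho < 1 passes to rho = 1 by
    continuity. *)
Theorem area_theorem N : Rsum (fun k => INR (k + 1) * Cmod (coef recip (k + 2)) ^ 2) N <= 1.
Proof.
  assert (E : forall rho, Re (Csum (fun k => RtoC (INR (k + 1) * (rho ^ (k + 2)) ^ 2 * Cmod (coef recip (k + 2)) ^ 2)) N) =
    Rsum (fun k => INR (k + 1) * (rho ^ (k + 2)) ^ 2 * Cmod (coef recip (k + 2)) ^ 2) N).
  { intros rho. clear. induction N as [|n IH]; [reflexivity|]. cbn [Csum Rsum]. rewrite re_plus, IH. reflexivity. }
  apply Rnot_lt_le. intros Lt.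
  assert (Ct : continuity_pt (fun rho => Rsum (fun k => INR (k + 1) * (rho ^ (k + 2)) ^ 2 * Cmod (coef recip (k + 2)) ^ 2) N) 1).
  { clear. apply derivable_continuous_pt. induction N as [|n IH]; [apply derivable_pt_const|].
    apply (derivable_pt_plus _ (fun rho => INR (n + 1) * (rho ^ (n + 2)) ^ 2 * Cmod (coef recip (n + 2)) ^ 2)); [exact IH|].
    apply ex_derive_Reals_0. auto_derive. exact I. }
  set (V := Rsum (fun k => INR (k + 1) * Cmod (coef recip (k + 2)) ^ 2) N) in *.
  assert (E1 : Rsum (fun k => INR (k + 1) * (1 ^ (k + 2)) ^ 2 * Cmod (coef recip (k + 2)) ^ 2) N = V).
  { unfold V. clear. induction N as [|n IH]; [reflexivity|]. cbn [Rsum]. rewrite IH, !pow1. ring. }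
  destruct (Ct (V - 1)) as [d [Hd B]]; [lra|].
  specialize (B (Rmax (1 - d / 2) (1 / 2))).
  assert (R1 := Rmax_l (1 - d / 2) (1 / 2)). assert (R2 := Rmax_r (1 - d / 2) (1 / 2)).
  assert (R3 : Rmax (1 - d / 2) (1 / 2) < 1) by (apply Rmax_lub_lt; lra).
  set (r := Rmax (1 - d / 2) (1 / 2)) in *.
  assert (A := area_sum_radius r N ltac:(lra)). rewrite E in A.
  assert (Bc : Rabs (Rsum (fun k => INR (k + 1) * (r ^ (k + 2)) ^ 2 * Cmod (coef recip (k + 2)) ^ 2) N -
    Rsum (fun k => INR (k + 1) * (1 ^ (k + 2)) ^ 2 * Cmod (coef recip (k + 2)) ^ 2) N) < V - 1).
  { apply B. split; [split; [exact I|lra]|]. apply Rabs_def1; lra. }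
  rewrite E1 in Bc. apply Rabs_def2 in Bc. lra.
Qed.

End AreaTheorem.

(** * Consequences of the area theorem *)

Lemma Rsum_le a b n : (forall k, a k <= b k) -> Rsum a n <= Rsum b n.
Proof. intros H; induction n; simpl; [lra|]. specialize (H n). lra. Qed.

Lemma Rsum_plus a b n : Rsum (fun k => a k + b k) n = Rsum a n + Rsum b n.
Proof. induction n; simpl; [ring|]. rewrite IHn; ring. Qed.

Lemma Rsum_scal c a n : Rsum (fun k => c * a k) n = c * Rsum a n.
Proof. induction n; simpl; [ring|]. rewrite IHn; ring. Qed.

Lemma Rsum_ratio_bound t q n : 0 <= q < 1 -> (forall k, 0 <= t k) -> (forall k, t (S k) <= q * t k) ->
  Rsum t n <= t 0%nat / (1 - q).
Proof.
  intros Hq H0 H. assert (K : Rsum t n + t n / (1 - q) <= t 0%nat / (1 - q)).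
  { induction n as [|n IH]; simpl; [lra|].
    assert (t (S n) / (1 - q) <= q * t n / (1 - q)).
    { unfold Rdiv. apply Rmult_le_compat_r; [left; apply Rinv_0_lt_compat; lra|apply H]. }
    assert (q * t n / (1 - q) = t n / (1 - q) - t n) by (field; lra). lra. }
  assert (0 <= t n / (1 - q)) by (apply Rdiv_le_0_compat; [apply H0|lra]). lra.
Qed.

Lemma Rsum_S t n : Rsum t (S n) = t 0%nat + Rsum (fun k => t (S k)) n.
Proof. induction n as [|n IH]; [simpl; ring|]. simpl in *. rewrite IH. ring. Qed.

Lemma Rsum_mono t n m : (forall k, 0 <= t k) -> (n <= m)%nat -> Rsum t n <= Rsum t m.
Proof. intros H L. induction L; [lra|]. simpl. specialize (H m). lra. Qed.

Lemma Csum_Rsum c a n : (forall k, Cmod (c k) <= a k) -> Cmod (Csum c n) <= Rsum a n.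
Proof.
  intros H. induction n as [|n IH]; simpl; [rewrite Cmod_0; lra|].
  eapply Rle_trans; [apply Cmod_triangle|]. specialize (H n). lra.
Qed.

Lemma Clim_bound u l M : Clim u l -> (forall n, Cmod (u n) <= M) -> Cmod l <= M.
Proof.
  intros H B. replace l with (l - 0)%C by ring. apply (Clim_Cmod_le u l 0 M 0 H).
  intros n _. replace (u n - 0)%C with (u n) by ring. apply B.
Qed.

Section CoefficientBounds.
Variable b : nat -> C.
Hypothesis area : forall N, Rsum (fun k => INR (k + 1) * Cmod (b (k + 2)%nat) ^ 2) N <= 1.

(** Cauchy-Schwarz through the weighted inequality lam y <= (A / 2) i y^2 + lam^2 / (2 A i) with i =
    k + 1; each of the two sums contributes at most A / 2. *)
Lemma area_cauchy_schwarz lam A N : 0 < A -> (forall n, Rsum (fun k => lam k ^ 2 / INR (k + 1)) n <= A ^ 2) ->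
  Rsum (fun k => lam k * Cmod (b (k + 2)%nat)) N <= A.
Proof.
  intros HA HL.
  assert (K : Rsum (fun k => lam k * Cmod (b (k + 2)%nat)) N <=
     Rsum (fun k => A / 2 * (INR (k + 1) * Cmod (b (k + 2)%nat) ^ 2) + / (2 * A) * (lam k ^ 2 / INR (k + 1))) N).
  { apply Rsum_le. intros k. assert (P := lt_0_INR (k + 1) ltac:(lia)). set (i := INR (k + 1)) in *. set (y := Cmod (b (k + 2)%nat)).
    assert (E : A / 2 * (i * y ^ 2) + / (2 * A) * (lam k ^ 2 / i) - lam k * y = (A * i * y - lam k) ^ 2 / (2 * A * i)) by (field; lra).
    assert (0 <= (A * i * y - lam k) ^ 2 / (2 * A * i)).
    { apply Rdiv_le_0_compat; [apply pow2_ge_0|]. repeat apply Rmult_lt_0_compat; lra. }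
    lra. }
  rewrite Rsum_plus, !Rsum_scal in K. specialize (area N). specialize (HL N).
  assert (A / 2 * Rsum (fun k => INR (k + 1) * Cmod (b (k + 2)%nat) ^ 2) N <= A / 2 * 1) by (apply Rmult_le_compat_l; lra).
  assert (/ (2 * A) * Rsum (fun k => lam k ^ 2 / INR (k + 1)) N <= / (2 * A) * A ^ 2).
  { apply Rmult_le_compat_l; [left; apply Rinv_0_lt_compat; lra|exact HL]. }
  assert (/ (2 * A) * A ^ 2 = A / 2) by (field; lra). lra.
Qed.

Lemma area_series_bound (c : nat -> C) (lam : nat -> R) A r z l : 0 < A -> Cmod z <= r ->
  (forall k, Cmod (c k) <= lam k) ->
  (forall n, Rsum (fun k => (lam k * r ^ (k + 2)) ^ 2 / INR (k + 1)) n <= A ^ 2) ->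
  Clim (Csum (fun k => c k * b (k + 2)%nat * z ^ (k + 2))%C) l -> Cmod l <= A.
Proof.
  intros HA Hz Hc HL Hl. apply (Clim_bound _ _ _ Hl). intros n.
  eapply Rle_trans; [|apply (area_cauchy_schwarz (fun k => lam k * r ^ (k + 2)) A n HA HL)].
  apply Csum_Rsum. intros k. rewrite !Cmod_mult, Cmod_pow.
  replace (lam k * r ^ (k + 2) * Cmod (b (k + 2)%nat)) with (lam k * Cmod (b (k + 2)%nat) * r ^ (k + 2)) by ring.
  assert (0 <= Cmod z ^ (k + 2)) by (apply pow_le, Cmod_ge_0).
  apply Rmult_le_compat; [apply Rmult_le_pos; apply Cmod_ge_0|assumption| |apply pow_incr; split; [apply Cmod_ge_0|exact Hz]].
  apply Rmult_le_compat_r; [apply Cmod_ge_0|apply Hc].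
Qed.

End CoefficientBounds.

(** * Numerical bounds for the weighted geometric sums *)

(** The first term is kept exactly; from the second on, ratio 1/4 gives the factor 1 / (1 - 1/4) =
    4/3. *)
Lemma Rsum_first_ratio t n : (forall k, 0 <= t k) -> (forall k, t (S (S k)) <= t (S k) / 4) ->
  Rsum t n <= t 0%nat + 4 / 3 * t 1%nat.
Proof.
  intros H0 H. eapply Rle_trans; [apply (Rsum_mono t n (S n) H0); lia|]. rewrite Rsum_S.
  assert (B := Rsum_ratio_bound (fun k => t (S k)) (1 / 4) n ltac:(lra) ltac:(intros; apply H0)
    ltac:(intros k; specialize (H k); lra)). simpl in B. lra.
Qed.

Lemma pow_sq_shift r k : (r ^ (k + 2)) ^ 2 = (r ^ 2) ^ (k + 2).
Proof. rewrite <- !pow_mult. f_equal; lia. Qed.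

(** For n = k + 2 the weight is (n - 1)^2, the multiplier of T; divided by n - 1 after squaring it
    leaves (k + 1)^3 x^(k+2). From the second term on the ratio is at most (3/2)^3 x < 1/4. *)
Lemma sum_bound_sq n : Rsum (fun k => ((INR k + 1) ^ 2 * 0.26099 ^ (k + 2)) ^ 2 / INR (k + 1)) n <= 0.09 ^ 2.
Proof.
  set (x := 0.26099 ^ 2). assert (Hx : 0 < x <= 0.068116) by (unfold x; lra).
  eapply Rle_trans; [apply (Rsum_le _ (fun k => (INR k + 1) ^ 3 * x ^ (k + 2)))|].
  - intros k. rewrite plus_INR, Rpow_mult_distr, pow_sq_shift. change (INR 1) with 1. fold x. right. field.
    generalize (pos_INR k); lra.
  - eapply Rle_trans; [apply Rsum_first_ratio|].
    + intros k. apply Rmult_le_pos; [apply pow_le; generalize (pos_INR k); lra|apply pow_le; lra].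
    + intros k. rewrite !S_INR. assert (P := pos_INR k). set (a := INR k) in *.
      change (x ^ (S (S k) + 2)) with (x * x ^ (S k + 2)). assert (Q : 0 < x ^ (S k + 2)) by (apply pow_lt; lra).
      set (p := x ^ (S k + 2)) in *.
      assert (A : (a + 1 + 1 + 1) ^ 3 <= (3 / 2 * (a + 1 + 1)) ^ 3) by (apply pow_incr; lra).
      assert (B : 0 < (a + 1 + 1) ^ 3) by (apply pow_lt; lra).
      assert (C : (a + 1 + 1 + 1) ^ 3 * x <= (a + 1 + 1) ^ 3 / 4).
      { apply Rle_trans with ((3 / 2 * (a + 1 + 1)) ^ 3 * x); [apply Rmult_le_compat_r; lra|].
        rewrite Rpow_mult_distr. nra. }
      replace ((a + 1 + 1 + 1) ^ 3 * (x * p)) with ((a + 1 + 1 + 1) ^ 3 * x * p) by ring.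
      replace ((a + 1 + 1) ^ 3 * p / 4) with ((a + 1 + 1) ^ 3 / 4 * p) by field.
      apply Rmult_le_compat_r; lra.
    + simpl. unfold x. lra.
Qed.

(** For n = k + 2 the weight is n^2, the multiplier of the operator z d/dz applied twice. From the
    second term on the ratio is at most (4/3)^4 x < 1/4. *)
Lemma sum_bound_fourth n : Rsum (fun k => ((INR k + 2) ^ 2 * 0.26099 ^ (k + 2)) ^ 2 / INR (k + 1)) n <= 0.303 ^ 2.
Proof.
  set (x := 0.26099 ^ 2). assert (Hx : 0 < x <= 0.068116) by (unfold x; lra).
  eapply Rle_trans; [apply (Rsum_le _ (fun k => (INR k + 2) ^ 4 / (INR k + 1) * x ^ (k + 2)))|].
  - intros k. rewrite plus_INR, Rpow_mult_distr, pow_sq_shift. change (INR 1) with 1. fold x. right. field.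
    generalize (pos_INR k); lra.
  - eapply Rle_trans; [apply Rsum_first_ratio|].
    + intros k. assert (P := pos_INR k). apply Rmult_le_pos; [|apply pow_le; lra].
      apply Rdiv_le_0_compat; [apply pow_le; lra|lra].
    + intros k. rewrite !S_INR. assert (P := pos_INR k). set (a := INR k) in *.
      change (x ^ (S (S k) + 2)) with (x * x ^ (S k + 2)). assert (Q : 0 < x ^ (S k + 2)) by (apply pow_lt; lra).
      set (p := x ^ (S k + 2)) in *.
      assert (A : (a + 1 + 1 + 2) ^ 4 <= (4 / 3 * (a + 1 + 2)) ^ 4) by (apply pow_incr; lra).
      assert (B : 0 < (a + 1 + 2) ^ 4) by (apply pow_lt; lra).
      assert (C : (a + 1 + 1 + 2) ^ 4 * x <= (a + 1 + 2) ^ 4 / 4).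
      { apply Rle_trans with ((4 / 3 * (a + 1 + 2)) ^ 4 * x); [apply Rmult_le_compat_r; lra|].
        rewrite Rpow_mult_distr. nra. }
      assert (D : (a + 1 + 1 + 2) ^ 4 / (a + 1 + 1 + 1) * x <= (a + 1 + 2) ^ 4 / (a + 1 + 1) / 4).
      { replace ((a + 1 + 1 + 2) ^ 4 / (a + 1 + 1 + 1) * x) with ((a + 1 + 1 + 2) ^ 4 * x * / (a + 1 + 1 + 1)) by (field; lra).
        replace ((a + 1 + 2) ^ 4 / (a + 1 + 1) / 4) with ((a + 1 + 2) ^ 4 / 4 * / (a + 1 + 1)) by (field; lra).
        apply Rmult_le_compat; [|left; apply Rinv_0_lt_compat; lra|exact C|apply Rinv_le_contravar; lra].
        apply Rmult_le_pos; [apply pow_le; lra|lra]. }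
      replace ((a + 1 + 1 + 2) ^ 4 / (a + 1 + 1 + 1) * (x * p)) with ((a + 1 + 1 + 2) ^ 4 / (a + 1 + 1 + 1) * x * p) by (field; lra).
      replace ((a + 1 + 2) ^ 4 / (a + 1 + 1) * p / 4) with ((a + 1 + 2) ^ 4 / (a + 1 + 1) / 4 * p) by (field; lra).
      apply Rmult_le_compat_r; lra.
    + simpl. unfold x. lra.
Qed.

(** The bound has to stay below 9/4 * 3/4 - 1 = 0.6875, so three terms are kept exactly before
    comparing with a geometric series of ratio 0.5625. *)
Lemma sum_bound_bieberbach n : Rsum (fun k => (1 * 0.75 ^ (k + 2)) ^ 2 / INR (k + 1)) n <= 0.687 ^ 2.
Proof.
  set (x := 0.75 ^ 2). assert (Hx : x = 0.5625) by (unfold x; lra).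
  set (t := fun k => x ^ (k + 2) / (INR k + 1)).
  assert (t0 : forall k, 0 <= t k).
  { intros k. unfold t. apply Rdiv_le_0_compat; [apply pow_le; lra|generalize (pos_INR k); lra]. }
  eapply Rle_trans; [apply (Rsum_le _ t)|].
  - intros k. rewrite plus_INR, Rmult_1_l, pow_sq_shift. change (INR 1) with 1. right. reflexivity.
  - eapply Rle_trans; [apply (Rsum_mono t n (S (S (S n))) t0); lia|]. rewrite !Rsum_S.
    assert (B := Rsum_ratio_bound (fun k => t (S (S (S k)))) x n ltac:(lra) ltac:(intros; apply t0)).
    assert (Rsum (fun k => t (S (S (S k)))) n <= t 3%nat / (1 - x)).
    { apply B. intros k. unfold t. rewrite (S_INR (S (S (S k)))). assert (P := pos_INR (S (S (S k)))). set (a := INR (S (S (S k)))) in *.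
      change (x ^ (S (S (S (S k))) + 2)) with (x * x ^ (S (S (S k)) + 2)). assert (Q : 0 < x ^ (S (S (S k)) + 2)) by (apply pow_lt; lra).
      set (p := x ^ (S (S (S k)) + 2)) in *. unfold Rdiv. rewrite Rmult_assoc. apply Rmult_le_compat_l; [lra|].
      apply Rmult_le_compat_l; [lra|]. apply Rinv_le_contravar; lra. }
    eapply Rle_trans; [apply Rplus_le_compat_l, Rplus_le_compat_l, Rplus_le_compat_l; exact H|].
    unfold t. simpl. rewrite Hx. lra.
Qed.

(** * Bounds for the terms of order at least 2 and their derivatives *)

Section TailSeries.
Variable f : C -> C.
Hypothesis Hf : hol 1 f.

Lemma tail_series z : Cmod z < 1 ->
  Clim (Csum (fun k => 1 * coef f (k + 2) * z ^ (k + 2))%C) (f z - f 0 - C_derive f 0 * z)%C.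
Proof.
  intros Hz. assert (T := Clim_decr _ _ 2 (taylor f z Hf Hz)).
  apply (Clim_ext (fun n => Csum (fun n => coef f n * z ^ n)%C (2 + n) - f 0 - C_derive f 0 * z)%C).
  - intros n. change (2 + n)%nat with (S (S n)). rewrite !Csum_S, coef_0, coef_1 by exact Hf.
    rewrite (Csum_ext (fun k => coef f (S (S k)) * z ^ S (S k))%C (fun k => 1 * coef f (k + 2) * z ^ (k + 2))%C).
    + simpl. ring.
    + intros k _. replace (k + 2)%nat with (S (S k)) by lia. ring.
  - apply Clim_minus; [apply Clim_minus; [exact T|apply Clim_const]|apply Clim_const].
Qed.

Lemma tail_series_derive z : Cmod z < 1 ->
  Clim (Csum (fun k => INR (k + 2) * coef f (k + 2) * z ^ (k + 2))%C) (z * C_derive f z - C_derive f 0 * z)%C.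
Proof.
  intros Hz. assert (T := Clim_decr _ _ 1 (taylor _ z (hol_derive f Hf) Hz)).
  apply (Clim_ext (fun n => z * Csum (fun n => coef (C_derive f) n * z ^ n)%C (1 + n) - C_derive f 0 * z)%C).
  - intros n. change (1 + n)%nat with (S n). rewrite Csum_S, coef_0 by (apply hol_derive, Hf).
    rewrite (Csum_ext (fun k => INR (k + 2) * coef f (k + 2) * z ^ (k + 2))%C (fun k => z * (coef (C_derive f) (S k) * z ^ S k))%C).
    + rewrite Csum_scal. simpl. ring.
    + intros k _. rewrite coef_derive by exact Hf. replace (k + 2)%nat with (S (S k)) by lia. simpl (z ^ _)%C. ring.
  - apply Clim_minus; [apply Clim_scal, T|apply Clim_const].
Qed.

Lemma tail_series_derive2 z : Cmod z < 1 ->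
  Clim (Csum (fun k => (INR (k + 2) * INR (k + 1)) * coef f (k + 2) * z ^ (k + 2))%C) (z ^ 2 * C_derive (C_derive f) z)%C.
Proof.
  intros Hz. assert (H' := hol_derive f Hf). assert (T := taylor _ z (hol_derive _ H') Hz).
  apply (Clim_ext (fun n => z ^ 2 * Csum (fun n => coef (C_derive (C_derive f)) n * z ^ n)%C n)%C).
  - intros n. rewrite <- Csum_scal. apply Csum_ext. intros k _. rewrite !coef_derive by assumption.
    replace (k + 2)%nat with (S (S k)) by lia. replace (k + 1)%nat with (S k) by lia. simpl (z ^ _)%C. ring.
  - apply Clim_scal, T.
Qed.

Hypothesis area : forall N, Rsum (fun k => INR (k + 1) * Cmod (coef f (k + 2)) ^ 2) N <= 1.
Variable z : C.
Hypothesis Hz : Cmod z <= 0.26099.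

Let Hz1 : Cmod z < 1.
Proof. lra. Qed.

(** The multiplier 1 is at most (n - 1)^2 for n >= 2, so [sum_bound_sq] is reused. *)
Lemma tail_bound : Cmod (f z - f 0 - C_derive f 0 * z) <= 0.09.
Proof.
  apply (area_series_bound _ area (fun _ => 1%C) (fun k => (INR k + 1) ^ 2) 0.09 0.26099 z); try assumption; try lra.
  - intros k. rewrite Cmod_1. generalize (pos_INR k). nra.
  - exact sum_bound_sq.
  - apply tail_series, Hz1.
Qed.

(** Since 2 n <= n^2 for n >= 2, twice the left side is bounded by the constant for the multiplier
    n^2. *)
Lemma tail_bound_derive : Cmod (z * C_derive f z - C_derive f 0 * z) <= 0.1515.
Proof.
  assert (B : Cmod (2 * (z * C_derive f z - C_derive f 0 * z)) <= 0.303).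
  { apply (area_series_bound _ area (fun k => 2 * INR (k + 2))%C (fun k => (INR k + 2) ^ 2) 0.303 0.26099 z); try assumption; try lra.
    - intros k. rewrite <- RtoC_mult, Cmod_R, plus_INR. simpl (INR 2). generalize (pos_INR k). intros. rewrite Rabs_pos_eq; nra.
    - exact sum_bound_fourth.
    - eapply Clim_ext; [|apply (Clim_scal 2), tail_series_derive, Hz1]. intros n. cbv beta. rewrite <- Csum_scal.
      apply Csum_ext. intros; ring. }
  rewrite Cmod_mult, Cmod_R, Rabs_pos_eq in B; lra.
Qed.

(** The expression is T applied to the tail, because n (n - 1) - n + 1 = (n - 1)^2. *)
Lemma tail_bound_sq : Cmod (z ^ 2 * C_derive (C_derive f) z - (z * C_derive f z - C_derive f 0 * z) + (f z - f 0 - C_derive f 0 * z)) <= 0.09.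
Proof.
  apply (area_series_bound _ area (fun k => RtoC ((INR k + 1) ^ 2)) (fun k => (INR k + 1) ^ 2) 0.09 0.26099 z); try assumption; try lra.
  - intros k. rewrite Cmod_R, Rabs_pos_eq; [lra|apply pow2_ge_0].
  - exact sum_bound_sq.
  - eapply Clim_ext; [|exact (Clim_plus _ _ _ _ (Clim_minus _ _ _ _ (tail_series_derive2 z Hz1) (tail_series_derive z Hz1)) (tail_series z Hz1))].
    intros n. cbv beta.
    transitivity (Csum (fun k => (INR (k + 2) * INR (k + 1) * coef f (k + 2) * z ^ (k + 2) + (-1) * (INR (k + 2) * coef f (k + 2) * z ^ (k + 2)))
      + 1 * coef f (k + 2) * z ^ (k + 2)) n)%C.
    + rewrite !Csum_plus, Csum_scal. ring.
    + apply Csum_ext. intros k _. rewrite !plus_INR. simpl (INR 2). simpl (INR 1).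
      replace ((INR k + 1) ^ 2) with ((INR k + (1 + 1)) * (INR k + 1) - (INR k + (1 + 1)) + 1) by ring.
      rewrite !RtoC_plus, RtoC_minus, RtoC_mult, !RtoC_plus. ring.
Qed.

(** The expression is (z d/dz)^2 applied to the tail, because n (n - 1) + n = n^2. *)
Lemma tail_bound_fourth : Cmod (z ^ 2 * C_derive (C_derive f) z + (z * C_derive f z - C_derive f 0 * z)) <= 0.303.
Proof.
  apply (area_series_bound _ area (fun k => RtoC ((INR k + 2) ^ 2)) (fun k => (INR k + 2) ^ 2) 0.303 0.26099 z); try assumption; try lra.
  - intros k. rewrite Cmod_R, Rabs_pos_eq; [lra|apply pow2_ge_0].
  - exact sum_bound_fourth.
  - eapply Clim_ext; [|exact (Clim_plus _ _ _ _ (tail_series_derive2 z Hz1) (tail_series_derive z Hz1))].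
    intros n. cbv beta. rewrite <- Csum_plus.
    apply Csum_ext. intros k _. rewrite !plus_INR. simpl (INR 2). simpl (INR 1).
    replace ((INR k + 2) ^ 2) with ((INR k + (1 + 1)) * (INR k + 1) + (INR k + (1 + 1))) by ring.
    rewrite !RtoC_plus, RtoC_mult, !RtoC_plus. ring.
Qed.

End TailSeries.

Lemma Cconj_neq0 (z : C) : z <> 0%C -> Cconj z <> 0%C.
Proof. intros H E. apply H. rewrite <- (Cconj_conj z), E. apply Cconj_0. Qed.

(* If [|f' 0|] exceeded 9/4, the zero [z0] of [L = 1 + f' 0 z] would lie well inside [|z| = 3/4], where
   [|f - L| < |L|], i.e. [Re (L / f) > 1/2].  Replacing [z - z0] by its reflection in that circle turns [L / f]
   into a function with positive real part on the circle and the value 0 at its centre. *)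
Lemma second_coef_bound f : hol 1 f -> (forall z, Cmod z < 1 -> f z <> 0%C) -> f 0 = 1%C ->
  (forall N, Rsum (fun k => INR (k + 1) * Cmod (coef f (k + 2)) ^ 2) N <= 1) -> Cmod (C_derive f 0) <= 9 / 4.
Proof.
  intros Hf Nf F0 area. apply Rnot_lt_le. intros Hb. set (b := C_derive f 0) in *.
  assert (Nb : b <> 0%C) by (apply Cmod_gt_0; lra).
  set (z0 := (- (1) / b)%C).
  assert (Hz0 : Cmod z0 <= 4 / 9).
  { unfold z0. rewrite Cmod_div, Cmod_opp, Cmod_1 by exact Nb. apply Rle_div_l; lra. }
  (* 16/9 is 1 / |z|^2 on the circle, where therefore z * conj (D z) = z - z0 and L = b z * conj (D
     z). Hence b z / (f z * D z) equals L / (f |D|^2) there, while it vanishes at 0. *)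
  set (D := fun z => (1 - Cconj z0 * (16 / 9)%R * z)%C).
  assert (Bd : forall z, Cmod z < 1 -> Cmod (Cconj z0 * (16 / 9)%R * z) <= 64 / 81).
  { intros z Hz. rewrite !Cmod_mult, Cmod_conj, Cmod_R, Rabs_pos_eq by lra. generalize (Cmod_ge_0 z) (Cmod_ge_0 z0). nra. }
  assert (ND : forall z, Cmod z < 1 -> D z <> 0%C).
  { intros z Hz. apply Cminus_neq0. intros E. specialize (Bd z Hz). rewrite <- E, Cmod_1 in Bd. lra. }
  set (M := fun z => (b * z / (f z * D z))%C).
  assert (HM : hol 1 M).
  { apply hol_div.
    - intros z Hz. apply Cmult_neq_0; [apply Nf|apply ND]; exact Hz.
    - apply hol_mult; [apply hol_const|apply hol_id].
    - apply hol_mult; [exact Hf|]. apply hol_minus; [apply hol_const|apply hol_mult; [apply hol_const|apply hol_id]]. }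
  assert (MV := mean_hol_value M 0.75 HM ltac:(lra)).
  assert (M0 : M 0 = 0%C) by (unfold M, Cdiv; ring).
  rewrite M0 in MV.
  assert (CM := Ccontinuous_circle 1 M 0.75 HM ltac:(lra)).
  (* Re (L conj f) >= |f|^2 / 2 and |D|^2 <= 4 give Re M >= 1/8 on the circle; the sign is reversed
     because [Re_mean_le] bounds from above. *)
  assert (P : Re (mean (fun t => (-1) * M (0.75 * cis t))%C) <= - (1 / 8)).
  { apply Re_mean_le; [intros t; apply contC_mult; [apply contC_const|apply CM]|]. intros t _.
    set (z := (0.75 * cis t)%C). assert (Hz : Cmod z = 0.75) by (apply Cmod_circle; lra).
    assert (Hz1 : Cmod z < 1) by lra.
    set (L := (1 + b * z)%C).
    assert (A1 : Cmod (f z - L) <= 0.687).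
    { replace (f z - L)%C with (f z - f 0 - C_derive f 0 * z)%C by (rewrite F0; unfold L, b; ring).
      apply (area_series_bound _ area (fun _ => 1%C) (fun _ => 1) 0.687 0.75 z); try lra.
      - intros; rewrite Cmod_1; lra.
      - exact sum_bound_bieberbach.
      - apply tail_series; assumption. }
    assert (A2 : 0.6875 < Cmod L).
    { generalize (Cmod_triangle L (- (1))). replace (L + - (1))%C with (b * z)%C by (unfold L; ring).
      rewrite Cmod_mult, Hz, Cmod_opp, Cmod_1. lra. }
    assert (Nz := Nf z Hz1). assert (NDz := ND z Hz1).
    assert (Pf : 0 < Cmod (f z) ^ 2) by (apply pow_lt, Cmod_gt_0, Nz).
    assert (PD : 0 < Cmod (D z)) by (apply Cmod_gt_0, NDz).
    assert (UD : Cmod (D z) ^ 2 <= 4).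
    { assert (Cmod (D z) <= 1 + 64 / 81).
      { unfold D. eapply Rle_trans; [apply Cmod_triangle|]. rewrite Cmod_opp, Cmod_1. specialize (Bd z Hz1). lra. }
      nra. }
    assert (A3 : Cmod (f z) ^ 2 <= 2 * Re (L * Cconj (f z))).
    { assert (X : Cmod (f z - L) ^ 2 <= Cmod L ^ 2) by (apply pow_incr; split; [apply Cmod_ge_0|lra]).
      rewrite !Cmod2_alt in *. rewrite re_minus, im_minus in X. rewrite re_mult, re_conj, im_conj. lra. }
    assert (EL : (L = b * z * Cconj (D z))%C).
    { unfold D. rewrite Cminus_conj, !Cmult_conj, Cconj_conj, !RtoC_Cconj.
      assert (Ez : (z * Cconj z = (9 / 16)%R)%C) by (rewrite <- Cmod2_conj, Hz; f_equal; lra).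
      transitivity (b * z - b * z0 * (16 / 9)%R * (z * Cconj z))%C; [|ring].
      rewrite Ez. unfold L, z0.
      transitivity (b * z + (16 / 9)%R * (9 / 16)%R)%C.
      - rewrite <- RtoC_mult. replace (16 / 9 * (9 / 16)) with 1 by field. ring.
      - field. exact Nb. }
    assert (EM : Re (M z) = Re (L * Cconj (f z)) / (Cmod (f z) ^ 2 * Cmod (D z) ^ 2)).
    { assert (E : M z = (L * Cconj (f z) * / (Cmod (f z) ^ 2 * Cmod (D z) ^ 2)%R)%C).
      { rewrite RtoC_mult, !Cmod2_conj, EL. unfold M. field.
        repeat split; try assumption; apply Cconj_neq0; assumption. }
      rewrite E. rewrite <- RtoC_inv by (apply Rgt_not_eq, Rmult_lt_0_compat; [exact Pf|apply pow_lt, PD]).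
      rewrite re_scal_r. reflexivity. }
    replace ((-1) * M z)%C with ((-1)%R * M z)%C by reflexivity. rewrite re_scal_l, EM.
    assert (1 / 8 <= Re (L * Cconj (f z)) / (Cmod (f z) ^ 2 * Cmod (D z) ^ 2)); [|lra].
    assert (PD2 : 0 < Cmod (D z) ^ 2) by (apply pow_lt, PD).
    apply (proj1 (Rle_div_r (1 / 8) _ (Cmod (f z) ^ 2 * Cmod (D z) ^ 2) ltac:(apply Rmult_lt_0_compat; assumption))).
    apply Rle_trans with (1 / 8 * (Cmod (f z) ^ 2 * 4)); [|lra].
    apply Rmult_le_compat_l; [lra|]. apply Rmult_le_compat_l; lra. }
  rewrite mean_scal, MV in P by exact CM. replace (-1 * 0)%C with (RtoC 0) in P by ring. rewrite re_RtoC in P. lra.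
Qed.

(** * Products of reciprocals *)

Section Product.
Variables p q : C -> C.
Hypotheses (Hp : hol 1 p) (Hq : hol 1 q).

Let pq (z : C) : C := (p z * q z)%C.
Let dpq (z : C) : C := (C_derive p z * q z + p z * C_derive q z)%C.

Lemma cder_product z : Cmod z < 1 -> cder pq z (dpq z).
Proof. intros Hz. apply cder_mult; apply (hol_C_derive 1); assumption. Qed.

Lemma cder_derive_product z : Cmod z < 1 ->
  cder dpq z (C_derive (C_derive p) z * q z + 2 * (C_derive p z * C_derive q z) + p z * C_derive (C_derive q) z)%C.
Proof.
  intros Hz. assert (Hp' := hol_derive p Hp). assert (Hq' := hol_derive q Hq).
  match goal with |- cder _ _ ?X => replace X with ((C_derive (C_derive p) z * q z + C_derive p z * C_derive q z)
    + (C_derive p z * C_derive q z + p z * C_derive (C_derive q) z))%C by ring end.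
  apply cder_plus; apply cder_mult; apply (hol_C_derive 1); assumption.
Qed.

Hypotheses (p0 : p 0 = 1%C) (q0 : q 0 = 1%C).
Hypothesis areap : forall N, Rsum (fun k => INR (k + 1) * Cmod (coef p (k + 2)) ^ 2) N <= 1.
Hypothesis areaq : forall N, Rsum (fun k => INR (k + 1) * Cmod (coef q (k + 2)) ^ 2) N <= 1.
Hypotheses (bp : Cmod (C_derive p 0) <= 9 / 4) (bq : Cmod (C_derive q 0) <= 9 / 4).

Lemma product_bound z : Cmod z <= 0.26099 ->
  Cmod (z ^ 2 * (C_derive (C_derive p) z * q z + 2 * (C_derive p z * C_derive q z) + p z * C_derive (C_derive q) z)
    - z * dpq z + pq z - 1) <= 1.
Proof.
  intros Hz. unfold dpq, pq.
  assert (P1 := tail_bound p Hp areap z Hz). assert (P2 := tail_bound_derive p Hp areap z Hz).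
  assert (P3 := tail_bound_sq p Hp areap z Hz). assert (P4 := tail_bound_fourth p Hp areap z Hz).
  assert (Q1 := tail_bound q Hq areaq z Hz). assert (Q2 := tail_bound_derive q Hq areaq z Hz).
  assert (Q3 := tail_bound_sq q Hq areaq z Hz). assert (Q4 := tail_bound_fourth q Hq areaq z Hz).
  rewrite p0 in P1, P3. rewrite q0 in Q1, Q3.
  set (b := C_derive p 0) in *. set (c := C_derive q 0) in *.
  set (a0 := p z) in *. set (a1 := C_derive p z) in *. set (a2 := C_derive (C_derive p) z) in *.
  set (c0 := q z) in *. set (c1 := C_derive q z) in *. set (c2 := C_derive (C_derive q) z) in *.
  set (A0 := (a0 - 1 - b * z)%C) in *. set (A1 := (z * a1 - b * z)%C) in *.
  set (A3 := (z ^ 2 * a2 - A1 + A0)%C) in *. set (A4 := (z ^ 2 * a2 + A1)%C) in *.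
  set (C0 := (c0 - 1 - c * z)%C) in *. set (C1 := (z * c1 - c * z)%C) in *.
  set (C3 := (z ^ 2 * c2 - C1 + C0)%C) in *. set (C4 := (z ^ 2 * c2 + C1)%C) in *.
  (* T 1 = 1, T z = 0, T (z^2) = z^2 and T (z v) = z (z d/dz)^2 v. For the product of the tails, T
     (u v) = u T v + v T u - u v + 2 (z u') (z v'), where A3, C3 are T of the tails and A4, C4 their
     images under (z d/dz)^2. *)
  replace (z ^ 2 * (a2 * c0 + 2 * (a1 * c1) + a0 * c2) - z * (a1 * c0 + a0 * c1) + a0 * c0 - 1)%C with
    (b * c * z ^ 2 + (A3 + C3) + (b * z * C4 + c * z * A4) + ((A3 - A0) * C0 + (C3 - C0) * A0)
      + (2 * (A1 * C1) + A0 * C0))%C.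
  2: { unfold A3, A4, C3, C4, A0, A1, C0, C1. simpl. ring. }
  assert (T : forall x y X Y, Cmod x <= X -> Cmod y <= Y -> Cmod (x + y) <= X + Y).
  { intros x y X Y Hx Hy. eapply Rle_trans; [apply Cmod_triangle|lra]. }
  assert (Ml : forall x y X Y, Cmod x <= X -> Cmod y <= Y -> Cmod (x * y) <= X * Y).
  { intros x y X Y Hx Hy. rewrite Cmod_mult. apply Rmult_le_compat; try apply Cmod_ge_0; assumption. }
  assert (Tm : forall x y X Y, Cmod x <= X -> Cmod y <= Y -> Cmod (x - y) <= X + Y).
  { intros x y X Y Hx Hy. apply T; [exact Hx|]. rewrite Cmod_opp. exact Hy. }
  assert (H2 : Cmod 2 <= 2) by (rewrite Cmod_R, Rabs_pos_eq; lra).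
  assert (Hz2 : Cmod (z ^ 2) <= 0.26099 ^ 2) by (rewrite Cmod_pow; apply pow_incr; split; [apply Cmod_ge_0|exact Hz]).
  eapply Rle_trans.
  (* The contributions are about 0.345, 0.18, 0.356, 0.033, 0.046 and 0.008, with sum about
     0.967. *)
  - repeat first [eassumption | apply Tm | apply T | apply Ml].
  - lra.
Qed.

End Product.

(** * From the reciprocals to the class M *)

Lemma class_S_spec g : class_S g ->
  hol 1 g /\ (forall z w, Cmod z < 1 -> Cmod w < 1 -> g z = g w -> z = w) /\ g 0 = 0%C /\ C_derive g 0 = 1%C.
Proof.
  intros [[Ha [G0 G1]] Inj]. repeat split; try assumption.
  intros z Hz. destruct (locally_singleton _ _ (Ha z Hz)) as [l Hl]. exists l. apply is_derive_cder, Hl.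
Qed.

Lemma class_S_recip g : class_S g -> hol 1 (recip g) /\ (forall z, Cmod z < 1 -> recip g z <> 0%C) /\ recip g 0 = 1%C /\
  (forall N, Rsum (fun k => INR (k + 1) * Cmod (coef (recip g) (k + 2)) ^ 2) N <= 1) /\ Cmod (C_derive (recip g) 0) <= 9 / 4.
Proof.
  intros H. destruct (class_S_spec g H) as [Hg [Inj [G0 G1]]].
  assert (Hr := recip_hol g Hg Inj). assert (Nr := recip_neq0 g Hg Inj). assert (R0 := recip_0 g G1).
  assert (Ar := area_theorem g Hg Inj G0 G1).
  repeat split; try assumption. apply second_coef_bound; assumption.
Qed.

Lemma class_S_eq_recip g z : class_S g -> Cmod z < 1 -> g z = (z / recip g z)%C.
Proof.
  intros H Hz. destruct (class_S_spec g H) as [Hg [Inj [G0 G1]]].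
  assert (N := ddiff_neq0 g Hg Inj 0 z ltac:(rewrite Cmod_0; lra) Hz).
  assert (E := ddiff_eq g 0 z). rewrite G0 in E. unfold recip.
  replace (g z) with (g z - 0)%C by ring. rewrite E. field. exact N.
Qed.

Theorem class_S_product_in_class_M r g h : r <= 0.26099 -> class_S g -> class_S h ->
  class_M_on (closed_disk r) (mul_over_id g h).
Proof.
  intros Hr Sg Sh. set (p := recip g). set (q := recip h). set (F := mul_over_id g h).
  destruct (class_S_recip g Sg) as [Hp [Np [p0 [Ap Bp]]]]. fold p in Hp, Np, p0, Ap, Bp.
  destruct (class_S_recip h Sh) as [Hq [Nq [q0 [Aq Bq]]]]. fold q in Hq, Nq, q0, Aq, Bq.
  assert (EF : forall z, Cmod z < 1 -> F z = (z / (p z * q z))%C).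
  { intros z Hz. assert (N1 := Np z Hz). assert (N2 := Nq z Hz). unfold F, mul_over_id. destruct (Ceq_dec z 0) as [e|n].
    - subst z. unfold Cdiv. ring.
    - rewrite (class_S_eq_recip g z Sg Hz), (class_S_eq_recip h z Sh Hz). fold p q. field. auto. }
  assert (EI : forall z, Cmod z < 1 -> id_over F z = (p z * q z)%C).
  { intros z Hz. unfold id_over. destruct (Ceq_dec z 0) as [e|n].
    - subst z. rewrite p0, q0. ring.
    - rewrite EF by exact Hz. field. repeat split; auto. }
  assert (DF : forall z, Cmod z < 1 ->
    cder F z (1 * / (p z * q z) + z * (- (C_derive p z * q z + p z * C_derive q z) / ((p z * q z) * (p z * q z))))%C).
  { intros z Hz. apply (cder_ext_loc (fun z => z * / (p z * q z))%C).
    - generalize (locally_disk 1 z Hz). apply filter_imp. intros w Hw. symmetry. apply EF, Hw.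
    - apply (cder_mult (fun z => z) (fun z => / (p z * q z))%C); [apply cder_id|].
      apply (cder_inv (fun z => p z * q z)%C); [apply Cmult_neq_0; auto|]. apply cder_product; assumption. }
  assert (DI : forall z, Cmod z < 1 -> C_derive (id_over F) z = (C_derive p z * q z + p z * C_derive q z)%C).
  { intros z Hz. apply C_derive_cder. apply (cder_ext_loc (fun z => p z * q z)%C).
    - generalize (locally_disk 1 z Hz). apply filter_imp. intros w Hw. symmetry. apply EI, Hw.
    - apply cder_product; assumption. }
  assert (DDI : forall z, Cmod z < 1 -> C_derive (C_derive (id_over F)) z =
    (C_derive (C_derive p) z * q z + 2 * (C_derive p z * C_derive q z) + p z * C_derive (C_derive q) z)%C).
  { intros z Hz. apply C_derive_cder. apply (cder_ext_loc (fun z => C_derive p z * q z + p z * C_derive q z)%C).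
    - generalize (locally_disk 1 z Hz). apply filter_imp. intros w Hw. symmetry. apply DI, Hw.
    - apply cder_derive_product; assumption. }
  split; [split; [|split]|split].
  - intros z Hz. unfold closed_disk in Hz. unfold analytic_at.
    generalize (locally_disk 1 z ltac:(lra)). apply filter_imp. intros w Hw.
    eexists. apply is_derive_cder, DF, Hw.
  - unfold F, mul_over_id. destruct (Ceq_dec 0 0) as [_|n]; [reflexivity|congruence].
  - rewrite (C_derive_cder _ _ _ (DF 0%C ltac:(rewrite Cmod_0; lra))), p0, q0. unfold Cdiv. field.
  - intros z Hz Nz E. unfold closed_disk in Hz. assert (Hz1 : Cmod z < 1) by lra. rewrite EF in E by exact Hz1.
    apply Nz. assert (N : (p z * q z)%C <> 0%C) by (apply Cmult_neq_0; auto).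
    replace z with (z / (p z * q z) * (p z * q z))%C by (field; auto). rewrite E. ring.
  - intros z Hz. unfold closed_disk in Hz. assert (Hz1 : Cmod z < 1) by lra.
    rewrite DDI, EI, (C_derive_cder _ _ _ (DF z Hz1)) by exact Hz1.
    (* For F = z / (p q) one has F' (z / F)^2 = p q - z (p q)', so the defining expression is T (p
       q) - 1. *)
    eapply Rle_trans; [|apply (product_bound p q Hp Hq p0 q0 Ap Aq Bp Bq z ltac:(lra))].
    right. f_equal. simpl. field. split; auto.
Qed.

(** * The root *)

(** The quotient (1 - y) / (1 - x) has logarithm at most itself minus 1, which is at most - (y -
    x). *)
Lemma ln_add_le x y : 0 <= x -> x <= y -> y < 1 -> - (ln (1 - x) + x) <= - (ln (1 - y) + y).
Proof.
  intros Hx Hxy Hy.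
  assert (E : ln (1 - y) = ln (1 - x) + ln ((1 - y) / (1 - x))).
  { rewrite <- ln_mult by (try apply Rdiv_lt_0_compat; lra). f_equal. field. lra. }
  assert (B : ln ((1 - y) / (1 - x)) <= (1 - y) / (1 - x) - 1).
  { assert (Q : 0 < (1 - y) / (1 - x)) by (apply Rdiv_lt_0_compat; lra).
    generalize (exp_ineq1_le (ln ((1 - y) / (1 - x)))). rewrite exp_ln by exact Q. lra. }
  assert (C : (1 - y) / (1 - x) - 1 <= - (y - x)).
  { assert (y - x <= (y - x) / (1 - x)).
    { apply (proj1 (Rle_div_r (y - x) (y - x) (1 - x) ltac:(lra))). nra. }
    replace ((1 - y) / (1 - x) - 1) with (- ((y - x) / (1 - x))) by (field; lra). lra. }
  lra.
Qed.

Lemma ln_add_nonneg x : 0 <= x < 1 -> 0 <= - (ln (1 - x) + x).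
Proof. intros Hx. generalize (ln_add_le 0 x). rewrite !Rminus_0_r, ln_1. lra. Qed.

Lemma Rdiv_le_compat a b c d : 0 <= a -> a <= c -> 0 < d -> d <= b -> a / b <= c / d.
Proof.
  intros. unfold Rdiv. apply Rmult_le_compat; [assumption| |assumption|apply Rinv_le_contravar; assumption].
  left. apply Rinv_0_lt_compat. lra.
Qed.

(** * Monotonicity of the radius function on [0, 0.3] *)

Section Monotone.
Variables r s : R.
Hypotheses (H0 : 0 <= r) (Hrs : r <= s) (Hs : s <= 0.3).

Let X : 0 <= r ^ 2 <= s ^ 2.
Proof. split; [apply pow2_ge_0|apply pow_incr; lra]. Qed.

Let Y : s ^ 2 <= 0.09.
Proof. replace 0.09 with (0.3 ^ 2) by lra. apply pow_incr; lra. Qed.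

(** The polynomial is regrouped, in the variable t^2, into products of factors that are nonnegative
    and increasing for t^2 <= 0.09. *)
Lemma radicand_mono : 0 <= - 8 * r ^ 10 + 31 * r ^ 8 - 44 * r ^ 6 + 27 * r ^ 4 <=
  - 8 * s ^ 10 + 31 * s ^ 8 - 44 * s ^ 6 + 27 * s ^ 4.
Proof.
  assert (E : forall t, - 8 * t ^ 10 + 31 * t ^ 8 - 44 * t ^ 6 + 27 * t ^ 4 =
    t ^ 2 * (t ^ 2 * (27 - 44 * t ^ 2)) + (t ^ 2) ^ 3 * (t ^ 2 * (31 - 8 * t ^ 2))) by (intros; ring).
  rewrite !E. set (x := r ^ 2) in *. set (y := s ^ 2) in *. clearbody x y.
  assert (A : 0 <= x * (27 - 44 * x) <= y * (27 - 44 * y)) by nra.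
  assert (B : 0 <= x * (31 - 8 * x) <= y * (31 - 8 * y)) by nra.
  assert (C : 0 <= x ^ 3 <= y ^ 3) by (split; [apply pow_le; lra|apply pow_incr; lra]).
  split.
  - apply Rplus_le_le_0_compat; apply Rmult_le_pos; lra.
  - apply Rplus_le_compat; apply Rmult_le_compat; lra.
Qed.

Lemma log_radicand_mono :
  r ^ 8 * (15 - 20 * r ^ 2 + 15 * r ^ 4 - 4 * r ^ 6) / (1 - r ^ 2) ^ 4 - r ^ 4 * (ln (1 - r ^ 2) + r ^ 2) <=
  s ^ 8 * (15 - 20 * s ^ 2 + 15 * s ^ 4 - 4 * s ^ 6) / (1 - s ^ 2) ^ 4 - s ^ 4 * (ln (1 - s ^ 2) + s ^ 2).
Proof.
  assert (L := ln_add_le (r ^ 2) (s ^ 2) ltac:(lra) ltac:(lra) ltac:(lra)).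
  assert (L0 := ln_add_nonneg (r ^ 2) ltac:(lra)).
  assert (E : forall t, t ^ 8 * (15 - 20 * t ^ 2 + 15 * t ^ 4 - 4 * t ^ 6) =
    (t ^ 2) ^ 3 * (t ^ 2 * (15 - 20 * t ^ 2) + (t ^ 2) ^ 2 * (t ^ 2 * (15 - 4 * t ^ 2)))) by (intros; ring).
  assert (E4 : forall t, t ^ 4 = (t ^ 2) ^ 2) by (intros; ring).
  rewrite !E, !E4. set (x := r ^ 2) in *. set (y := s ^ 2) in *. clearbody x y.
  assert (A : 0 <= x * (15 - 20 * x) <= y * (15 - 20 * y)) by nra.
  assert (B : 0 <= x * (15 - 4 * x) <= y * (15 - 4 * y)) by nra.
  assert (C3 : 0 <= x ^ 3 <= y ^ 3) by (split; [apply pow_le; lra|apply pow_incr; lra]).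
  assert (C2 : 0 <= x ^ 2 <= y ^ 2) by (split; [apply pow_le; lra|apply pow_incr; lra]).
  assert (D : 0 <= x ^ 2 * (x * (15 - 4 * x)) <= y ^ 2 * (y * (15 - 4 * y))).
  { split; [apply Rmult_le_pos; lra|apply Rmult_le_compat; lra]. }
  unfold Rminus at 1 6. apply Rplus_le_compat.
  - apply Rdiv_le_compat.
    + apply Rmult_le_pos; lra.
    + apply Rmult_le_compat; lra.
    + apply pow_lt; lra.
    + apply pow_incr; lra.
  - rewrite !Ropp_mult_distr_r. apply Rmult_le_compat; lra.
Qed.

(** Keeping 6 r^2 apart makes the growth strict without derivatives: two roots r < r0 in this range
    would give 6 r^2 >= 6 r0^2. *)
Lemma radius_fun_mono : radius_fun r - 6 * r ^ 2 <= radius_fun s - 6 * s ^ 2.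
Proof.
  unfold radius_fun.
  assert (C3 : 0 <= r ^ 3 <= s ^ 3) by (split; [apply pow_le; lra|apply pow_incr; lra]).
  assert (A1 : 4 * (sqrt 2 + 4) * r ^ 3 <= 4 * (sqrt 2 + 4) * s ^ 3).
  { apply Rmult_le_compat_l; [generalize (sqrt_pos 2); lra|lra]. }
  assert (A2 : 2 * r ^ 2 * sqrt (- 8 * r ^ 10 + 31 * r ^ 8 - 44 * r ^ 6 + 27 * r ^ 4) / (1 - r ^ 2) ^ 2 <=
    2 * s ^ 2 * sqrt (- 8 * s ^ 10 + 31 * s ^ 8 - 44 * s ^ 6 + 27 * s ^ 4) / (1 - s ^ 2) ^ 2).
  { apply Rdiv_le_compat.
    - apply Rmult_le_pos; [lra|apply sqrt_pos].
    - apply Rmult_le_compat; [lra|apply sqrt_pos|lra|apply sqrt_le_1_alt, radicand_mono].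
    - apply pow_lt; lra.
    - apply pow_incr; lra. }
  assert (A3 : r ^ 4 * (4 * r ^ 2 - 11 * r + 9) / (1 - r) ^ 3 <= s ^ 4 * (4 * s ^ 2 - 11 * s + 9) / (1 - s) ^ 3).
  { assert (E : forall t, t ^ 4 * (4 * t ^ 2 - 11 * t + 9) = t ^ 3 * (t * (9 - 11 * t) + 4 * t ^ 3)) by (intros; ring).
    rewrite !E. assert (A : 0 <= r * (9 - 11 * r) <= s * (9 - 11 * s)) by nra.
    apply Rdiv_le_compat.
    - apply Rmult_le_pos; lra.
    - apply Rmult_le_compat; lra.
    - apply pow_lt; lra.
    - apply pow_incr; lra. }
  assert (A4 := sqrt_le_1_alt _ _ log_radicand_mono). lra.
Qed.

End Monotone.

(** The bound 0.07 exceeds r0^2, about 0.0681, and 0.07^8 / 0.93 is below 10^-9. *)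
Lemma ln_add_approx x : 0 <= x <= 0.07 -> Rabs (- (ln (1 - x) + x) - (log_series 8 x - x)) <= 0.000000001.
Proof.
  intros Hx. replace (- (ln (1 - x) + x) - (log_series 8 x - x)) with (- ln (1 - x) - log_series 8 x) by ring.
  eapply Rle_trans; [apply (log_series_bound 8 x 0.07)|]; [rewrite Rabs_pos_eq; lra|lra|]. lra.
Qed.

Lemma sqrt_le_of_sq a b : 0 <= b -> a <= b ^ 2 -> sqrt a <= b.
Proof. intros Hb H. rewrite <- (sqrt_pow2 b Hb). apply sqrt_le_1_alt, H. Qed.

Lemma sqrt_ge_of_sq a b : 0 <= b -> b ^ 2 <= a -> b <= sqrt a.
Proof. intros Hb H. rewrite <- (sqrt_pow2 b Hb) at 1. apply sqrt_le_1_alt, H. Qed.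

Lemma radius_fun_continuous r : 0.2 <= r <= 0.3 -> continuity_pt radius_fun r.
Proof.
  intros Hr. assert (Hx : 0.04 <= r ^ 2 <= 0.09) by (split; nra).
  assert (P1 : 0 < - 8 * r ^ 10 + 31 * r ^ 8 - 44 * r ^ 6 + 27 * r ^ 4).
  { replace (- 8 * r ^ 10 + 31 * r ^ 8 - 44 * r ^ 6 + 27 * r ^ 4) with
      ((r ^ 2) ^ 2 * (27 - 44 * r ^ 2 + (r ^ 2) ^ 2 * (31 - 8 * r ^ 2))) by ring.
    set (x := r ^ 2) in *. clearbody x. apply Rmult_lt_0_compat; [apply pow_lt; lra|].
    assert (0 <= x ^ 2 * (31 - 8 * x)) by (apply Rmult_le_pos; [apply pow_le; lra|lra]). lra. }
  assert (L0 := ln_add_nonneg (r ^ 2) ltac:(lra)).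
  assert (P2 : 0 < r ^ 8 * (15 - 20 * r ^ 2 + 15 * r ^ 4 - 4 * r ^ 6) / (1 - r ^ 2) ^ 4 - r ^ 4 * (ln (1 - r ^ 2) + r ^ 2)).
  { assert (0 < r ^ 8 * (15 - 20 * r ^ 2 + 15 * r ^ 4 - 4 * r ^ 6) / (1 - r ^ 2) ^ 4).
    { replace (r ^ 8 * (15 - 20 * r ^ 2 + 15 * r ^ 4 - 4 * r ^ 6)) with
        ((r ^ 2) ^ 4 * (15 - 20 * r ^ 2 + (r ^ 2) ^ 2 * (15 - 4 * r ^ 2))) by ring.
      set (x := r ^ 2) in *. clearbody x. apply Rdiv_lt_0_compat; [|apply pow_lt; lra].
      apply Rmult_lt_0_compat; [apply pow_lt; lra|].
      assert (0 <= x ^ 2 * (15 - 4 * x)) by (apply Rmult_le_pos; [apply pow_le; lra|lra]). lra. }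
    assert (0 <= r ^ 4 * - (ln (1 - r ^ 2) + r ^ 2)) by (apply Rmult_le_pos; [apply pow_le; lra|exact L0]). lra. }
  apply derivable_continuous_pt, ex_derive_Reals_0.
  unfold radius_fun.
  assert (N1 : (1 - r ^ 2) ^ 2 <> 0) by (apply pow_nonzero; lra).
  assert (N2 : (1 - r) ^ 3 <> 0) by (apply pow_nonzero; lra).
  assert (N3 : (1 - r ^ 2) ^ 4 <> 0) by (apply pow_nonzero; lra).
  auto_derive. unfold Rminus, Rdiv in *. repeat split; try assumption; lra.
Qed.

(** The left end of the bracket 0.260985 -+ 0.0000005. Each square root is replaced by a decimal
    upper bound checked by squaring, and the logarithm by its series; what is left is rational
    arithmetic. *)
Lemma radius_fun_lo : radius_fun 0.2609845 < 0.
Proof.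
  set (r := 0.2609845). set (x := r ^ 2). assert (Ex : x = 0.06811290924025) by (unfold x, r; lra).
  assert (V := ln_add_approx x ltac:(lra)). apply Rabs_le_between in V.
  assert (S2 : sqrt 2 <= 1.4142136) by (apply sqrt_le_of_sq; lra).
  assert (SA : sqrt (- 8 * r ^ 10 + 31 * r ^ 8 - 44 * r ^ 6 + 27 * r ^ 4) <= 0.3346856) by (apply sqrt_le_of_sq; unfold r; lra).
  assert (SI : sqrt (r ^ 8 * (15 - 20 * r ^ 2 + 15 * r ^ 4 - 4 * r ^ 6) / (1 - r ^ 2) ^ 4 - r ^ 4 * (ln (1 - r ^ 2) + r ^ 2)) <= 0.0200614).
  { apply sqrt_le_of_sq; [lra|]. fold x. simpl log_series in V.
    assert (W : - (ln (1 - x) + x) <= 0.0024307107) by (rewrite Ex in V |- *; lra).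
    replace (r ^ 4) with (x ^ 2) by (unfold x; ring). replace (r ^ 6) with (x ^ 3) by (unfold x; ring). replace (r ^ 8) with (x ^ 4) by (unfold x; ring).
    assert (x ^ 2 * - (ln (1 - x) + x) <= x ^ 2 * 0.0024307107) by (apply Rmult_le_compat_l; [apply pow2_ge_0|exact W]).
    apply Rle_trans with (x ^ 4 * (15 - 20 * x + 15 * x ^ 2 - 4 * x ^ 3) / (1 - x) ^ 4 + x ^ 2 * 0.0024307107); [lra|].
    rewrite Ex. lra. }
  unfold radius_fun. fold x in SI |- *.
  assert (T3 : 2 * x * sqrt (- 8 * r ^ 10 + 31 * r ^ 8 - 44 * r ^ 6 + 27 * r ^ 4) / (1 - x) ^ 2 <= 2 * x * 0.3346856 / (1 - x) ^ 2).
  { unfold Rdiv. apply Rmult_le_compat_r; [left; apply Rinv_0_lt_compat, pow_lt; lra|]. apply Rmult_le_compat_l; lra. }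
  assert (T2 : 4 * (sqrt 2 + 4) * r ^ 3 <= 4 * (1.4142136 + 4) * r ^ 3).
  { apply Rmult_le_compat_r; [apply pow_le; unfold r; lra|lra]. }
  apply Rle_lt_trans with (6 * x + 4 * (1.4142136 + 4) * r ^ 3 + 2 * x * 0.3346856 / (1 - x) ^ 2 + r ^ 4 * (4 * x - 11 * r + 9) / (1 - r) ^ 3 + 4 * 0.0200614 - 1); [lra|].
  rewrite Ex. unfold r. lra.
Qed.

Lemma radius_fun_hi : 0 < radius_fun 0.2609855.
Proof.
  set (r := 0.2609855). set (x := r ^ 2). assert (Ex : x = 0.06811343121025) by (unfold x, r; lra).
  assert (V := ln_add_approx x ltac:(lra)). apply Rabs_le_between in V.
  assert (S2 : 1.41421356 <= sqrt 2) by (apply sqrt_ge_of_sq; lra).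
  assert (SA : 0.3346879 <= sqrt (- 8 * r ^ 10 + 31 * r ^ 8 - 44 * r ^ 6 + 27 * r ^ 4)) by (apply sqrt_ge_of_sq; unfold r; lra).
  assert (SI : 0.0200616 <= sqrt (r ^ 8 * (15 - 20 * r ^ 2 + 15 * r ^ 4 - 4 * r ^ 6) / (1 - r ^ 2) ^ 4 - r ^ 4 * (ln (1 - r ^ 2) + r ^ 2))).
  { apply sqrt_ge_of_sq; [lra|]. fold x. simpl log_series in V.
    assert (W : 0.0024307467 <= - (ln (1 - x) + x)) by (rewrite Ex in V |- *; lra).
    replace (r ^ 4) with (x ^ 2) by (unfold x; ring). replace (r ^ 6) with (x ^ 3) by (unfold x; ring). replace (r ^ 8) with (x ^ 4) by (unfold x; ring).
    assert (x ^ 2 * 0.0024307467 <= x ^ 2 * - (ln (1 - x) + x)) by (apply Rmult_le_compat_l; [apply pow2_ge_0|exact W]).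
    apply Rle_trans with (x ^ 4 * (15 - 20 * x + 15 * x ^ 2 - 4 * x ^ 3) / (1 - x) ^ 4 + x ^ 2 * 0.0024307467); [|lra].
    rewrite Ex. lra. }
  unfold radius_fun. fold x in SI |- *.
  assert (T3 : 2 * x * 0.3346879 / (1 - x) ^ 2 <= 2 * x * sqrt (- 8 * r ^ 10 + 31 * r ^ 8 - 44 * r ^ 6 + 27 * r ^ 4) / (1 - x) ^ 2).
  { unfold Rdiv. apply Rmult_le_compat_r; [left; apply Rinv_0_lt_compat, pow_lt; lra|]. apply Rmult_le_compat_l; lra. }
  assert (T2 : 4 * (1.41421356 + 4) * r ^ 3 <= 4 * (sqrt 2 + 4) * r ^ 3).
  { apply Rmult_le_compat_r; [apply pow_le; unfold r; lra|lra]. }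
  apply Rlt_le_trans with (6 * x + 4 * (1.41421356 + 4) * r ^ 3 + 2 * x * 0.3346879 / (1 - x) ^ 2 + r ^ 4 * (4 * x - 11 * r + 9) / (1 - r) ^ 3 + 4 * 0.0200616 - 1); [|lra].
  rewrite Ex. unfold r. lra.
Qed.

Lemma radius_fun_root : exists r0, 0.2609845 <= r0 <= 0.2609855 /\ is_smallest_root_in_01 radius_fun r0.
Proof.
  destruct (IVT_interv radius_fun 0.2609845 0.2609855) as [r0 [H0 H1]].
  - intros a Ha. apply radius_fun_continuous. lra.
  - lra.
  - exact radius_fun_lo.
  - exact radius_fun_hi.
  - exists r0. split; [exact H0|]. split; [lra|]. split; [exact H1|].
    intros r Hr E. apply Rnot_lt_le. intros L.
    generalize (radius_fun_mono r r0 ltac:(lra) ltac:(lra) ltac:(lra)). rewrite E, H1. nra.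
Qed.

Theorem theorem4p2 :
  exists r0 : R,
    is_smallest_root_in_01 radius_fun r0 /\
    Rabs (r0 - 0.260985) <= 0.0000005 /\
    forall g h : C -> C,
      class_S g -> class_S h ->
      class_M_on (closed_disk r0) (mul_over_id g h).

Proof.
  destruct radius_fun_root as [r0 [Hr0 Root]]. exists r0. split; [exact Root|]. split.
  - apply Rabs_le. lra.
  - intros g h Sg Sh. apply class_S_product_in_class_M; [lra|exact Sg|exact Sh].
Qed.
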